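(* Let $m$ and $n$ be non-negative integers and let $s=s_{m,n}$. The following identities hold in the Hecke algebra $\mathcal{H}$ of the affine Weyl group $W$ of type $\widetilde{A}_2$. (i) If $m=n=0$, then $\underline{\mathbf{H}}_{s_0\theta(0,0)s}=\mathbf{N}_{s_0\theta(0,0)s}+v^2\mathbf{N}_{s_0}$. (ii) If $m>0$ and $n=0$, then \begin{align*} \underline{\mathbf{H}}_{s_0\theta(m,0)s}&=\mathbf{N}_{s_0\theta(m,0)s}+v\,\mathbf{M}_{s_0\theta(m-1,0),\,\rho(\theta(m-1,0))}+v\,\underline{\mathbf{H}}_{\rho^2(\theta(m-1,0))s}\\ &=\mathbf{N}_{s_0\theta(m,0)s}+v\,\mathbf{M}_{\rho^2(\theta(m-1,0))s,\,\rho(\theta(m-1,0))}+v\,\underline{\mathbf{H}}_{s_0\theta(m-1,0)}. \end{align*} (iii) If $m=0$ and $n>0$, then \begin{align*} \underline{\mathbf{H}}_{s_0\theta(0,n)s}&=\mathbf{N}_{s_0\theta(0,n)s}+v\,\mathbf{M}_{s_0\theta(0,n-1),\,\rho^2(\theta(0,n-1))}+v\,\underline{\mathbf{H}}_{\rho(\theta(0,n-1))s}\\ &=\mathbf{N}_{s_0\theta(0,n)s}+v\,\mathbf{M}_{\rho(\theta(0,n-1))s,\,\rho^2(\theta(0,n-1))}+v\,\underline{\mathbf{H}}_{s_0\theta(0,n-1)}. \end{align*} (iv) If $m>0$ and $n>0$, then \begin{align*} \underline{\mathbf{H}}_{s_0\theta(m,n)s}&=\mathbf{N}_{s_0\theta(m,n)s}+v\,\mathbf{M}_{s_0\theta(m,n-1),\,s_0\theta(m-1,n)}+v\,\underline{\mathbf{H}}_{\rho(\theta(m,n-1))s}+v\,\underline{\mathbf{H}}_{\rho^2(\theta(m-1,n))s}\\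 &=\mathbf{N}_{s_0\theta(m,n)s}+v\,\mathbf{M}_{\rho(\theta(m,n-1))s,\,\rho^2(\theta(m-1,n))s}+v\,\underline{\mathbf{H}}_{s_0\theta(m,n-1)}+v\,\underline{\mathbf{H}}_{s_0\theta(m-1,n)}. \end{align*}
   Context: $W$ is the Coxeter group generated by $S=\{s_0,s_1,s_2\}$ with relations $s_i^2=\mathrm{id}$, $(s_is_j)^3=\mathrm{id}$ for $i\ne j$; $\ell$ is the length function and $\le$ the Bruhat order. For any integer $k$, write $s_k$ for $s_{k \bmod 3}$. $\rho$ is the automorphism of $W$ with $\rho(s_0)=s_1$, $\rho(s_1)=s_2$, $\rho(s_2)=s_0$. For integers $m,n\ge 0$ define $$\theta(m,n)=s_1s_2s_3\cdots s_{2m+1}s_{2m+2}s_{2m+1}s_{2m}\cdots s_{2m-2n+1}$$ (indices increase by one from $1$ to $2m+2$ and then decrease by one to $2m-2n+1$); this is a reduced expression, so $\ell(\theta(m,n))=2m+2n+3$. The right descent set of $\theta(m,n)$ consists of exactly two simple reflections, and $s_{m,n}\in S$ denotes the unique simple reflection with $\ell(\theta(m,n)s_{m,n})>\ell(\theta(m,n))$. $\mathcal{H}$ is the $\mathbb{Z}[v,v^{-1}]$-algebra generated by $\mathbf{H}_{s_0},\mathbf{H}_{s_1},\mathbf{H}_{s_2}$ with relations $\mathbf{H}_{s_i}^2=(v^{-1}-v)\mathbf{H}_{s_i}+1$ and $\mathbf{H}_{s_i}\mathbf{H}_{s_j}\mathbf{H}_{s_i}=\mathbf{H}_{s_j}\mathbf{H}_{s_i}\mathbf{H}_{s_j}$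 for $i\neq j$; it has standard basis $\{\mathbf{H}_w\}_{w\in W}$, where $\mathbf{H}_w=\mathbf{H}_{r_1}\cdots\mathbf{H}_{r_k}$ for any reduced expression $r_1\cdots r_k$ of $w$. $\{\underline{\mathbf{H}}_w\}_{w\in W}$ is the Kazhdan-Lusztig basis in Soergel's normalization: $\underline{\mathbf{H}}_w$ is the unique element of $\mathbf{H}_w+\sum_{x<w}v\mathbb{Z}[v]\mathbf{H}_x$ invariant under the ring involution $v\mapsto v^{-1}$, $\mathbf{H}_x\mapsto(\mathbf{H}_{x^{-1}})^{-1}$. (For example $\underline{\mathbf{H}}_s=\mathbf{H}_s+v$ for $s\in S$.) For $x,y\in W$, define $\mathbf{N}_x=\sum_{z\le x}v^{\ell(x)-\ell(z)}\mathbf{H}_z$ and $$\mathbf{M}_{x,y}=\sum_{w\le x\text{ or }w\le y}v^{\ell(x)-\ell(w)}\mathbf{H}_w$$ (the exponent always uses $\ell(x)$, the length of the first index). *)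

(* Defs.v *)
From HB Require Import structures.
From mathcomp Require Import all_boot fingroup.
From mathcomp Require Import ssralg ssrint poly zmodp fraction.
From mathcomp Require Import finmap generic_quotient.
From mathcomp Require Import boolp classical_sets fsbigop.
From mathcomp Require Import monalg.
From Stdlib Require Relation_Operators.

Set Implicit Arguments.
Unset Strict Implicit.
Unset Printing Implicit Defensive.

Import GRing.Theory.
Local Open Scope quotient_scope.
Local Open Scope classical_set_scope.
Local Open Scope ring_scope.

(** * The affine Weyl group W *)

(* The simple reflections are indexed by Z/3.  Since they are involutions, the
   group with presentation < s_i | s_i^2, (s_i s_j)^3 > is the quotient of the
   free monoid of words by the congruence generated by the relations. *)
Definition word := seq 'Z_3.

Inductive cox_cong : word -> word -> Prop :=
| cox_refl u : cox_cong u u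
| cox_sym u v : cox_cong u v -> cox_cong v u
| cox_trans u v w : cox_cong u v -> cox_cong v w -> cox_cong u w
| cox_cat u u' v v' :
    cox_cong u u' -> cox_cong v v' -> cox_cong (u ++ v) (u' ++ v')
| cox_sq i : cox_cong [:: i; i] [::]
| cox_braid i j : i != j -> cox_cong [:: i; j; i; j; i; j] [::].

Definition cox_rel : rel word := fun u v => `[< cox_cong u v >].

Lemma cox_rel_refl : reflexive cox_rel.
Proof. by move=> u; apply/asboolP; exact: cox_refl. Qed.
Lemma cox_rel_sym : symmetric cox_rel.
Proof. by move=> u v; apply/asboolP/asboolP; exact: cox_sym. Qed.
Lemma cox_rel_trans : transitive cox_rel.
Proof.
by move=> v u w /asboolP uv /asboolP vw; apply/asboolP; exact: cox_trans vw.
Qed.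

Canonical cox_equiv := EquivRel cox_rel cox_rel_refl cox_rel_sym cox_rel_trans.

Definition W := {eq_quot cox_equiv}.
HB.instance Definition _ := Choice.on W.
HB.instance Definition _ := EqQuotient.on W.

Definition of_word (u : word) : W := \pi_W u.

Lemma of_wordP u v : of_word u = of_word v <-> cox_cong u v.
Proof.
split=> [/eqmodP/asboolP //|uv].
by apply/eqmodP; apply/asboolP.
Qed.

Lemma of_word_repr (x : W) : of_word (repr x) = x.
Proof. exact: reprK. Qed.

Lemma cox_repr u : cox_cong (repr (of_word u)) u.
Proof. by apply/of_wordP; rewrite of_word_repr. Qed.

Definition W_one : W := of_word [::].
Definition W_mul (x y : W) : W := of_word (repr x ++ repr y).
Definition W_inv (x : W) : W := of_word (rev (repr x)).

Lemma W_mul_word u v : W_mul (of_word u) (of_word v) = of_word (u ++ v).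
Proof. by apply/of_wordP; apply: cox_cat; exact: cox_repr. Qed.

Lemma cox_rev u v : cox_cong u v -> cox_cong (rev u) (rev v).
Proof.
elim=> {u v} [u|u v _|u v w _ uv _ vw|u u' v v' _ uu' _ vv'|i|i j ij].
- exact: cox_refl.
- exact: cox_sym.
- exact: cox_trans vw.
- by rewrite !rev_cat; exact: cox_cat.
- exact: cox_sq.
- by apply: cox_braid; rewrite eq_sym.
Qed.

Lemma W_inv_word u : W_inv (of_word u) = of_word (rev u).
Proof. by apply/of_wordP; apply: cox_rev; exact: cox_repr. Qed.

Lemma cox_revl u : cox_cong (rev u ++ u) [::].
Proof.
elim: u => [|i u IH]; first exact: cox_refl.
rewrite rev_cons -cats1 -catA -[[:: i] ++ i :: u]/([:: i; i] ++ u).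
apply: cox_trans IH; apply: cox_cat; first exact: cox_refl.
rewrite -[X in cox_cong _ X]cat0s.
by apply: cox_cat; [exact: cox_sq | exact: cox_refl].
Qed.

Lemma W_mulA : associative W_mul.
Proof.
move=> x y z; rewrite -[x]of_word_repr -[y]of_word_repr -[z]of_word_repr.
by rewrite !W_mul_word catA.
Qed.
Lemma W_mul1 : left_id W_one W_mul.
Proof. by move=> x; rewrite -[x]of_word_repr W_mul_word. Qed.
Lemma W_mul1r : right_id W_one W_mul.
Proof. by move=> x; rewrite -[x]of_word_repr W_mul_word cats0. Qed.
Lemma W_mulV : left_inverse W_one W_inv W_mul.
Proof.
move=> x; rewrite -[x]of_word_repr W_inv_word W_mul_word.
by apply/of_wordP; exact: cox_revl.
Qed.
Lemma W_mulVr : right_inverse W_one W_inv W_mul.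
Proof.
move=> x; rewrite -[x]of_word_repr W_inv_word W_mul_word.
by apply/of_wordP; rewrite -{1}[repr x]revK; exact: cox_revl.
Qed.

HB.instance Definition _ :=
  isGroup.Build W W_mulA W_mul1 W_mul1r W_mulV W_mulVr.

Lemma of_wordM u v : of_word (u ++ v) = (of_word u * of_word v)%g.
Proof. by rewrite -W_mul_word. Qed.

Definition gen (i : 'Z_3) : W := of_word [:: i].
Definition s_ (k : int) : W := gen k%:~R.

Lemma of_wordE u : of_word u = (\prod_(i <- u) gen i)%g.
Proof.
elim: u => [|i u IH]; first by rewrite big_nil.
by rewrite big_cons -IH -cat1s of_wordM.
Qed.

Lemma length_ex (w : W) :
  exists k, (fun k => `[< exists u, of_word u = w /\ size u = k >]) k.
Proof.
by exists (size (repr w)); apply/asboolP; exists (repr w); rewrite of_word_repr.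
Qed.
Definition length (w : W) : nat := ex_minn (length_ex w).

Definition reduced (w : W) (u : word) := of_word u = w /\ size u = length w.

Lemma reduced_ex (w : W) : exists u, reduced w u.
Proof. by rewrite /reduced /length; case: ex_minnP => k /asboolP. Qed.

Definition red_word (w : W) : word := xget [::] [set u | reduced w u].

Lemma red_wordP (w : W) : reduced w (red_word w).
Proof. exact: (xgetPex _ (reduced_ex w)). Qed.

Definition reflection (t : W) := exists i w, t = (gen i ^ w)%g.

Definition bruhat : W -> W -> Prop :=
  Relation_Operators.clos_refl_trans W (fun x y =>
    exists2 t, reflection t & y = (x * t)%g /\ (length x < length y)%N).

Definition rho (w : W) : W := of_word [seq i + 1 | i <- repr w].

Lemma cox_shift u v :
  cox_cong u v -> cox_cong [seq i + 1 | i <- u] [seq i + 1 | i <- v].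
Proof.
elim=> {u v} [u|u v _|u v w _ uv _ vw|u u' v v' _ uu' _ vv'|i|i j ij].
- exact: cox_refl.
- exact: cox_sym.
- exact: cox_trans vw.
- by rewrite !map_cat; exact: cox_cat.
- exact: cox_sq.
- by apply: cox_braid; apply: contra ij => /eqP/addIr ->.
Qed.

Lemma rho_word u : rho (of_word u) = of_word [seq i + 1 | i <- u].
Proof. by apply/of_wordP; apply: cox_shift; exact: cox_repr. Qed.

Lemma rhoM : {morph rho : x y / (x * y)%g}.
Proof.
move=> x y; rewrite -[x]of_word_repr -[y]of_word_repr.
by rewrite -of_wordM !rho_word map_cat of_wordM.
Qed.

Lemma rho_s k : rho (s_ k) = s_ (k + 1).
Proof. by rewrite /s_ /gen rho_word /= intrD. Qed.

Lemma rho3 w : rho (rho (rho w)) = w.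
Proof.
rewrite -[w]of_word_repr !rho_word -!map_comp.
rewrite (@eq_map _ _ _ id) ?map_id // => i /=.
by rewrite -!addrA (_ : 1 + (1 + 1) = 0 :> 'Z_3) ?addr0 //; apply/val_inj.
Qed.

Definition theta (m n : nat) : W :=
  ((\prod_(1 <= k < (2 * m + 2).+1) s_ k%:Z)
   * \prod_(0 <= j < (2 * n).+1) s_ ((2 * m + 1)%:Z - j%:Z))%g.

(* The default value 0 is never used: such a simple reflection exists. *)
Definition s_mn (m n : nat) : W :=
  gen (odflt 0 [pick i | (length (theta m n) < length (theta m n * gen i)%g)%N]).

(** * The ring Z[v,v^-1], as a subring of the fraction field of Z[v] *)

Definition laurent_pred : {pred {fraction {poly int}}} :=
  fun x => `[< exists (p : {poly int}) (k : nat), x * tofrac 'X^k = tofrac p >].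

Fact laurent_subring : subring_closed laurent_pred.
Proof.
split.
- by apply/asboolP; exists 1, 0%N; rewrite expr0 mulr1.
- move=> x y /asboolP[p [k xk]] /asboolP[q [l yl]]; apply/asboolP.
  exists (p * 'X^l - q * 'X^k), (k + l)%N.
  rewrite exprD tofracB !tofracM -xk -yl mulrBl.
  by rewrite -!mulrA [tofrac 'X^l * _]mulrC.
- move=> x y /asboolP[p [k xk]] /asboolP[q [l yl]]; apply/asboolP.
  by exists (p * q), (k + l)%N; rewrite exprD !tofracM -xk -yl mulrACA.
Qed.

HB.instance Definition _ :=
  GRing.isSubringClosed.Build {fraction {poly int}} laurent_pred laurent_subring.

Record laurent := Laurent {
  laurent_val :> {fraction {poly int}};
  _ : laurent_val \in laurent_pred }.

HB.instance Definition _ := [isSub for laurent_val].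
HB.instance Definition _ := [Choice of laurent by <:].
HB.instance Definition _ := [SubChoice_isSubComNzRing of laurent by <:].

Definition laurent_unit : {pred laurent} :=
  fun x => (x != 0) && ((laurent_val x)^-1 \in laurent_pred).
Definition laurent_inv (x : laurent) : laurent :=
  if x \in laurent_unit then insubd x (laurent_val x)^-1 else x.

Lemma laurent_val_eq0 (x : laurent) : (laurent_val x == 0) = (x == 0).
Proof. by rewrite -(inj_eq (val_inj : injective laurent_val)). Qed.

Fact laurent_mulV : {in laurent_unit, left_inverse 1 laurent_inv *%R}.
Proof.
move=> x xU; rewrite /laurent_inv xU; case/andP: xU => x0 xV.
apply/val_inj.
have -> : val (insubd x (laurent_val x)^-1 * x)
          = val (insubd x (laurent_val x)^-1) * val x by [].
rewrite (insubdK x xV); apply: mulVf; by rewrite laurent_val_eq0.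
Qed.
Fact laurent_unitPl (x y : laurent) : y * x = 1 -> laurent_unit x.
Proof.
move=> yx; have x0 : x != 0.
  by apply: contra_eq_neq yx => ->; rewrite mulr0 eq_sym oner_neq0.
apply/andP; split=> //; suff -> : (laurent_val x)^-1 = val y by exact: valP.
apply: (mulIf (x := laurent_val x)); first by rewrite laurent_val_eq0.
rewrite mulVf ?laurent_val_eq0 //.
by have /(congr1 laurent_val) := yx.
Qed.
Fact laurent_inv_out : {in [predC laurent_unit], laurent_inv =1 id}.
Proof. by move=> x; rewrite inE /laurent_inv => /negPf ->. Qed.

HB.instance Definition _ := GRing.ComNzRing_hasMulInverse.Build laurent
  laurent_mulV laurent_unitPl laurent_inv_out.

Fact v_subproof : tofrac 'X \in laurent_pred.
Proof. by apply/asboolP; exists 'X, 0%N; rewrite expr0 mulr1. Qed.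
Fact v_key : unit. Proof. exact: tt. Qed.
Definition v : laurent := locked_with v_key (Laurent v_subproof).
Lemma v_val : laurent_val v = tofrac 'X.
Proof. by rewrite /v unlock. Qed.

Lemma v_unit : v \is a GRing.unit.
Proof.
have v0 : tofrac 'X != 0 :> {fraction {poly int}}.
  by rewrite tofrac_eq0 polyX_eq0.
apply/andP; split; first by rewrite -laurent_val_eq0 v_val.
by apply/asboolP; exists 1, 1%N; rewrite v_val expr1 mulVf ?tofrac1.
Qed.

(** * The Hecke algebra, as a quotient of the free algebra on 'Z_3 *)

(* The construction makes sense over any commutative ring [A] with a unit [v];
   the Hecke algebra of the affine Weyl group is the case A = Z[v,v^-1]. *)

Section FreeAlgebra.
Context (R : comNzRingType) (K : monomType).

Lemma malg_scaleU c (x : R) (k : K) : c *: << x *g k >> = << c * x *g k >>.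
Proof. by apply/malgP => k'; rewrite mcoeffZ !mcoeffU mulrnAr. Qed.

Lemma malg_scaleAr c (a b : {malg R[K]}) : c *: (a * b) = a * (c *: b).
Proof.
rewrite [a]monalgE [b]monalgE !mulr_suml !scaler_sumr.
apply: eq_bigr => i _; rewrite !mulr_sumr scaler_sumr.
apply: eq_bigr => j _.
by rewrite malg_scaleU !malgM_def !fgmulUU malg_scaleU mulrCA.
Qed.

End FreeAlgebra.

Section Hecke.
Context (A : comUnitRingType) (v : A).

Definition free_alg := {malg A[{fmonom 'Z_3}]}.

(* Locks that keep unification from unfolding the construction. *)
Fact hecke_key : unit. Proof. exact: tt. Qed.
Definition free_gen : 'Z_3 -> free_alg :=
  locked_with hecke_key (fun i => << fmu i >>).

(* The two-sided ideal generated by the defining relations. *)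
Inductive hecke_ideal : free_alg -> Prop :=
| hecke_quad i : hecke_ideal
    (free_gen i * free_gen i - ((v^-1 - v) *: free_gen i + 1))
| hecke_braid i j : i != j -> hecke_ideal
    (free_gen i * free_gen j * free_gen i
     - free_gen j * free_gen i * free_gen j)
| hecke_ideal0 : hecke_ideal 0
| hecke_idealD a b : hecke_ideal a -> hecke_ideal b -> hecke_ideal (a + b)
| hecke_idealMl a b : hecke_ideal b -> hecke_ideal (a * b)
| hecke_idealMr a b : hecke_ideal a -> hecke_ideal (a * b).

Definition hecke_rel : rel free_alg := fun a b => `[< hecke_ideal (a - b) >].

Lemma hecke_idealN a : hecke_ideal a -> hecke_ideal (- a).
Proof. by rewrite -mulN1r; exact: hecke_idealMl. Qed.

Lemma hecke_rel_refl : reflexive hecke_rel.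
Proof. by move=> a; apply/asboolP; rewrite subrr; exact: hecke_ideal0. Qed.
Lemma hecke_rel_sym : symmetric hecke_rel.
Proof.
by move=> a b; apply/asboolP/asboolP => /hecke_idealN; rewrite opprB.
Qed.
Lemma hecke_rel_trans : transitive hecke_rel.
Proof.
move=> b a c /asboolP ab /asboolP bc; apply/asboolP.
by rewrite -(subrKA b); exact: hecke_idealD.
Qed.

Canonical hecke_equiv :=
  EquivRel hecke_rel hecke_rel_refl hecke_rel_sym hecke_rel_trans.

Definition hecke := {eq_quot hecke_equiv}.
HB.instance Definition _ := Choice.on hecke.
HB.instance Definition _ := EqQuotient.on hecke.

Definition of_free (a : free_alg) : hecke := \pi_hecke a.

Lemma of_freeP a b : of_free a = of_free b <-> hecke_ideal (a - b).
Proof.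
split=> [/eqmodP/asboolP //|ab].
by apply/eqmodP; apply/asboolP.
Qed.

Lemma of_free_repr (x : hecke) : of_free (repr x) = x.
Proof. exact: reprK. Qed.

Lemma hecke_repr a : hecke_ideal (repr (of_free a) - a).
Proof. by apply/of_freeP; rewrite of_free_repr. Qed.

Definition hecke_zero : hecke := of_free 0.
Definition hecke_one : hecke := of_free 1.
Definition hecke_opp : hecke -> hecke :=
  locked_with hecke_key (fun x => of_free (- repr x)).
Definition hecke_add : hecke -> hecke -> hecke :=
  locked_with hecke_key (fun x y => of_free (repr x + repr y)).
Definition hecke_mul : hecke -> hecke -> hecke :=
  locked_with hecke_key (fun x y => of_free (repr x * repr y)).
Definition hecke_scale : A -> hecke -> hecke :=
  locked_with hecke_key (fun c x => of_free (c *: repr x)).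

Lemma hecke_opp_free a : hecke_opp (of_free a) = of_free (- a).
Proof.
rewrite /hecke_opp unlock; by apply/of_freeP; rewrite -opprD; apply: hecke_idealN; exact: hecke_repr.
Qed.
Lemma hecke_add_free a b :
  hecke_add (of_free a) (of_free b) = of_free (a + b).
Proof.
rewrite /hecke_add unlock; apply/of_freeP; rewrite opprD addrACA.
by apply: hecke_idealD; exact: hecke_repr.
Qed.
Lemma hecke_mul_free a b :
  hecke_mul (of_free a) (of_free b) = of_free (a * b).
Proof.
rewrite /hecke_mul unlock; apply/of_freeP; set a' := repr _; set b' := repr _.
have -> : a' * b' - a * b = a' * (b' - b) + (a' - a) * b.
  by rewrite mulrBr mulrBl subrKA.
by apply: hecke_idealD; [apply: hecke_idealMl | apply: hecke_idealMr];
  exact: hecke_repr.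
Qed.
Lemma hecke_scale_free c a : hecke_scale c (of_free a) = of_free (c *: a).
Proof.
rewrite /hecke_scale unlock; apply/of_freeP; rewrite -scalerBr -mul_malgC.
by apply: hecke_idealMl; exact: hecke_repr.
Qed.

Ltac hecke_lift :=
  repeat (let x := fresh "x" in move=> x);
  repeat match goal with x : hecke |- _ =>
    rewrite -[x]of_free_repr; move: (repr x) => {x} x end;
  rewrite ?(hecke_opp_free, hecke_add_free, hecke_mul_free, hecke_scale_free).

Lemma hecke_addA : associative hecke_add.
Proof. by hecke_lift; rewrite addrA. Qed.
Lemma hecke_addC : commutative hecke_add.
Proof. by hecke_lift; rewrite addrC. Qed.
Lemma hecke_add0 : left_id hecke_zero hecke_add.
Proof. by hecke_lift; rewrite add0r. Qed.
Lemma hecke_addN : left_inverse hecke_zero hecke_opp hecke_add.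
Proof. by hecke_lift; rewrite addNr. Qed.

HB.instance Definition _ := GRing.isZmodule.Build hecke
  hecke_addA hecke_addC hecke_add0 hecke_addN.

Lemma of_freeD a b : of_free (a + b) = of_free a + of_free b.
Proof. by rewrite -hecke_add_free. Qed.

Lemma hecke_mulA : associative hecke_mul.
Proof. by hecke_lift; rewrite mulrA. Qed.
Lemma hecke_mul1 : left_id hecke_one hecke_mul.
Proof. by hecke_lift; rewrite mul1r. Qed.
Lemma hecke_mul1r : right_id hecke_one hecke_mul.
Proof. by hecke_lift; rewrite mulr1. Qed.
Lemma hecke_mulDl : left_distributive hecke_mul hecke_add.
Proof. by hecke_lift; rewrite mulrDl. Qed.
Lemma hecke_mulDr : right_distributive hecke_mul hecke_add.
Proof. by hecke_lift; rewrite mulrDr. Qed.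

HB.instance Definition _ := GRing.Zmodule_isPzRing.Build hecke
  hecke_mulA hecke_mul1 hecke_mul1r hecke_mulDl hecke_mulDr.

(* The quotient is not the zero ring: all generators can be sent to v^-1. *)
Definition index_root : A := if v \is a GRing.unit then v^-1 else 1.

Lemma index_rootE : index_root * index_root = (v^-1 - v) * index_root + 1.
Proof.
rewrite /index_root; case: ifPn => [vU|/invr_out ->].
  by rewrite mulrBl mulrV // subrK.
by rewrite subrr mul0r add0r mulr1.
Qed.

Definition index_mon (m : {fmonom 'Z_3}) : A := index_root ^+ fdeg m.

Lemma index_mon_morph : mmorphism index_mon.
Proof.
by split=> [m m'|]; rewrite /index_mon ?fdegM ?exprD // fdeg1 expr0.
Qed.
HB.instance Definition _ :=
  monalg.isMultiplicative.Build {fmonom 'Z_3} A index_mon index_mon_morph.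

Definition index_free : free_alg -> A := mmap idfun index_mon.
HB.instance Definition _ := GRing.RMorphism.copy index_free (mmap idfun index_mon).

Lemma index_free_gen i : index_free (free_gen i) = index_root.
Proof.
by rewrite /index_free /free_gen unlock mmapU mul1r /index_mon fdegU expr1.
Qed.
Lemma index_freeD a b : index_free (a + b) = index_free a + index_free b.
Proof. exact: rmorphD. Qed.
Lemma index_freeB a b : index_free (a - b) = index_free a - index_free b.
Proof. exact: rmorphB. Qed.
Lemma index_freeM a b : index_free (a * b) = index_free a * index_free b.
Proof. exact: rmorphM. Qed.
Lemma index_freeM3 a b c :
  index_free (a * b * c) = index_free a * index_free b * index_free c.
Proof. by rewrite !index_freeM. Qed.
Lemma index_free0 : index_free 0 = 0.
Proof. exact: rmorph0. Qed.
Lemma index_free1 : index_free 1 = 1.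
Proof. exact: rmorph1. Qed.
Lemma index_freeZ c a : index_free (c *: a) = c * index_free a.
Proof. exact: mmapZ. Qed.

Lemma index_ideal a : hecke_ideal a -> index_free a = 0.
Proof.
elim=> {a} [i|i j ij||a b _ a0 _ b0|a b _ b0|a b _ a0].
- rewrite index_freeB; apply/eqP; rewrite subr_eq0; apply/eqP.
  transitivity (index_root * index_root).
    by rewrite index_freeM !index_free_gen.
  by rewrite index_rootE index_freeD index_free1 index_freeZ index_free_gen.
- rewrite index_freeB; apply/eqP; rewrite subr_eq0; apply/eqP.
  transitivity (index_root * index_root * index_root).
    by rewrite index_freeM3 !index_free_gen.
  by rewrite index_freeM3 !index_free_gen.
- exact: index_free0.
- by rewrite index_freeD a0 b0 addr0.
- by rewrite index_freeM b0 mulr0.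
- by rewrite index_freeM a0 mul0r.
Qed.

Lemma hecke_oner_neq0 : (1 : hecke) != 0.
Proof.
apply/eqP => /of_freeP /index_ideal; rewrite index_freeB index_free1.
by rewrite index_free0 subr0; apply/eqP; exact: oner_neq0.
Qed.

HB.instance Definition _ :=
  GRing.PzSemiRing_isNonZero.Build hecke hecke_oner_neq0.

Lemma of_freeM a b : of_free (a * b) = of_free a * of_free b.
Proof. by rewrite -hecke_mul_free. Qed.

Lemma hecke_scaleA c d x :
  hecke_scale c (hecke_scale d x) = hecke_scale (c * d) x.
Proof. by move: c d x; hecke_lift; rewrite scalerA. Qed.
Lemma hecke_scale1 : left_id 1 hecke_scale.
Proof. by hecke_lift; rewrite scale1r. Qed.
Lemma hecke_scaleDr : right_distributive hecke_scale hecke_add.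
Proof. by move=> c; hecke_lift; rewrite scalerDr. Qed.
Lemma hecke_scaleDl x c d :
  hecke_scale (c + d) x = hecke_add (hecke_scale c x) (hecke_scale d x).
Proof. by move: x; hecke_lift; rewrite scalerDl. Qed.

HB.instance Definition _ := GRing.Zmodule_isLmodule.Build A hecke
  hecke_scaleA hecke_scale1 hecke_scaleDr hecke_scaleDl.

Lemma of_freeZ c a : of_free (c *: a) = c *: of_free a.
Proof. by rewrite -hecke_scale_free. Qed.

Lemma hecke_scaleAl (c : A) (x y : hecke) : c *: (x * y) = (c *: x) * y.
Proof.
rewrite -[x]of_free_repr -[y]of_free_repr; move: (repr x) (repr y) => a b.
by rewrite -of_freeM -of_freeZ scalerAl of_freeM of_freeZ.
Qed.
Lemma hecke_scaleAr (c : A) (x y : hecke) : c *: (x * y) = x * (c *: y).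
Proof.
rewrite -[x]of_free_repr -[y]of_free_repr; move: (repr x) (repr y) => a b.
by rewrite -of_freeM -of_freeZ malg_scaleAr of_freeM of_freeZ.
Qed.

HB.instance Definition _ :=
  GRing.Lmodule_isLalgebra.Build A hecke hecke_scaleAl.
HB.instance Definition _ :=
  GRing.Lalgebra_isAlgebra.Build A hecke hecke_scaleAr.

Definition Hgen (i : 'Z_3) : hecke := of_free (free_gen i).

Lemma Hgen_quad i : Hgen i * Hgen i = (v^-1 - v) *: Hgen i + 1.
Proof.
have -> : (v^-1 - v) *: Hgen i + 1 = of_free ((v^-1 - v) *: free_gen i + 1).
  by rewrite of_freeD of_freeZ.
by rewrite -of_freeM; apply/of_freeP; exact: hecke_quad.
Qed.

Lemma Hgen_braid i j :
  i != j -> Hgen i * Hgen j * Hgen i = Hgen j * Hgen i * Hgen j.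
Proof. by move=> ij; rewrite -!of_freeM; apply/of_freeP; exact: hecke_braid. Qed.

(** * Standard and Kazhdan-Lusztig bases *)

(* By Matsumoto's theorem this does not depend on the reduced word. *)
Definition H (w : W) : hecke := \prod_(i <- red_word w) Hgen i.

(* Such an [f] is unique, since [hecke] is generated as a ring by v, v^-1 and
   the [H (s_ k)]. *)
Definition is_bar (f : {rmorphism hecke -> hecke}) : Prop :=
  [/\ involutive f,
      f v%:A = v^-1%:A
    & forall x : W, f (H x) * H x^-1%g = 1 /\ H x^-1%g * f (H x) = 1].

Definition bar_invariant (C : hecke) : Prop :=
  exists f : {rmorphism hecke -> hecke}, is_bar f /\ f C = C.

(* Sums over \in range over the support of the summand; they are the usual
   finite sums because Bruhat lower intervals are finite. *)
Definition is_KL (w : W) (C : hecke) : Prop :=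
  bar_invariant C /\
  exists p : W -> {poly int},
    C = H w + \sum_(x \in [set x | bruhat x w /\ x <> w])
                (v * (map_poly intr (p x)).[v]) *: H x.

(* The element satisfying [is_KL w] exists and is unique, so 0 is never used. *)
Definition KL (w : W) : hecke := xget 0 [set C | is_KL w C].

Definition N (x : W) : hecke :=
  \sum_(z \in [set z | bruhat z x])
    v ^ ((length x)%:Z - (length z)%:Z) *: H z.

(* The exponent is an integer, as [length w] may exceed [length x] when
   [bruhat w y]. *)
Definition M (x y : W) : hecke :=
  \sum_(w \in [set w | bruhat w x \/ bruhat w y])
    v ^ ((length x)%:Z - (length w)%:Z) *: H w.

End Hecke.

(* Main.v *)
(** Alcove geometry describes the lower Bruhat intervals: w <= theta(m,n) if and
    only if the vertex of type 2m+n mod 3 of the alcove of w lies in the hexagon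
    spanned by the orbit of the weight n w_1 + m w_2 under the finite Weyl group.

    For a lower set S put [S] = sum_(w in S) v^(-l(w)) H_w, and let C_s = H_s + v.
    Then [S] C_s = v [S u Ss] + v^-1 [S n Ss], so that products with the C_s reduce
    to unions and intersections of hexagons.  In this way the elements
    T(m,n) = sum_i v^(2i) N_(theta(m-i,n-i)) satisfy
      T(m+1,n) = T(m,n) (C_s C_s' - 1) - T(m-1,n+1) - T(m,n-1),
    where s = s_(m,n) and s' is the next simple reflection, together with a similar
    recursion in n when m = 0.  Hence they are bar invariant.

    Let S be the lower interval of theta(m,n).  The set S n s_0 S is the union of the
    intervals of rho(theta(m,n-1)) and rho^2(theta(m-1,n)), and S n Ss is the union of
    those of theta(m,n-1) and theta(m-1,n).  Expanding C_(s_0) T(m,n) C_s from the left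
    or from the right, the overlap of the two intervals cancels against the term
    T(m-1,n-1), and the two formulas of the theorem appear with C_(s_0) T(m,n) C_s,
    C_(s_0) T(m,n) and rho^k(T(m,n) C_s) in place of the Kazhdan-Lusztig elements.
    These products are bar invariant, and by the same expansions their coefficients
    other than the leading one lie in v Z[v], so they are Kazhdan-Lusztig elements. *)

From Stdlib Require Import Relation_Operators Operators_Properties.
From HB Require Import structures.
From mathcomp Require Import all_boot all_order fingroup.
From mathcomp Require Import ssralg ssrnum ssrint poly zmodp fraction zify ring.
From mathcomp Require Import finmap generic_quotient monalg.
From mathcomp Require Import boolp classical_sets cardinality fsbigop.
Require Import Defs.

Set Implicit Arguments.
Unset Strict Implicit.
Unset Printing Implicit Defensive.

Import Order.TTheory GRing.Theory Num.Theory.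
Local Open Scope ring_scope.

Local Notation len := Defs.length.
Local Notation g0 := (gen 0).
Local Notation g1 := (gen 1).
Local Notation g2 := (gen (1 + 1)).

(** * Words, generators and braid relations *)

Section CoxeterGroup.
Local Open Scope group_scope.

(** The recursion for [T(m,n)] has the shape of the rule for tensoring an irreducible SL_3-module
    with a three-dimensional one: [T(m,n)] plays the role of the character of highest weight n w_1 +
    m w_2. Passing from one hexagon to the next inner one raises the weight multiplicities by one,
    whence the sum over nested hexagons. Comparing coefficients requires the [H w] to be linearly
    independent. This is obtained by letting the Hecke algebra act on functions on [W], where the
    action of [H w] on the function supported at 1 can be computed. The alcove picture is used in
    one direction: elements act on vertices, but faithfulness of this action is needed only for the
    six elements fixing the origin, which start the induction on lower intervals. Everything else is
    a statement about the three vertices of a single alcove, hence linear arithmetic in six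
    orientations. The power [k] of [rho] is carried as a parameter through the construction of
    [T(m,n)], which replaces the transport of bar invariance and of Kazhdan-Lusztig elements along
    an automorphism of the Hecke algebra. *)

Lemma of_word_cons i u : of_word (i :: u) = gen i * of_word u.
Proof. by rewrite -cat1s of_wordM. Qed.

Lemma of_word_nil : of_word [::] = 1.
Proof. by []. Qed.

Lemma gen_sq i : gen i * gen i = 1.
Proof. by rewrite -of_wordM; apply/of_wordP; exact: cox_sq. Qed.

Lemma genV i : (gen i)^-1 = gen i.
Proof. by rewrite -[LHS]mulg1 -(gen_sq i) mulKg. Qed.

Lemma genK i (x : W) : gen i * (gen i * x) = x.
Proof. by rewrite mulgA gen_sq mul1g. Qed.

Lemma mulgenK i (x : W) : x * gen i * gen i = x.
Proof. by rewrite -mulgA gen_sq mulg1. Qed.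

Lemma gen_braid i j : i != j -> gen i * (gen j * gen i) = gen j * (gen i * gen j).
Proof.
move=> ij; have : of_word [:: i; j; i; j; i; j] = 1.
  by apply/of_wordP; exact: cox_braid.
rewrite !of_word_cons of_word_nil mulg1 => E.
by rewrite -[RHS]mul1g -E -!mulgA !genK gen_sq mulg1.
Qed.

Lemma gen_braidM i j x : i != j ->
  gen i * (gen j * (gen i * x)) = gen j * (gen i * (gen j * x)).
Proof.
by move/gen_braid/(congr1 (fun y => y * x)); rewrite -!mulgA.
Qed.

Lemma of_word_rev u : of_word (rev u) = (of_word u)^-1.
Proof. by rewrite -W_inv_word. Qed.

Lemma W_ind (P : W -> Prop) :
  P 1 -> (forall i w, P w -> P (gen i * w)) -> forall w, P w.
Proof.
move=> P1 PM w; rewrite -(of_word_repr w).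
by elim: (repr w) => [|i u IH] //; rewrite of_word_cons; exact: PM.
Qed.

Lemma W_ind_r (P : W -> Prop) :
  P 1 -> (forall i w, P w -> P (w * gen i)) -> forall w, P w.
Proof.
move=> P1 PM w; rewrite -[w]invgK; elim/W_ind: w^-1 => [|i x IH].
  by rewrite invg1.
by rewrite invMg genV; exact: PM.
Qed.

(** * Length and exchange *)

Lemma len_le u : (len (of_word u) <= size u)%N.
Proof.
rewrite /len; case: ex_minnP => k _ kmin; apply: kmin.
by apply/asboolP; exists u.
Qed.

Lemma len_word w : exists2 u, of_word u = w & size u = len w.
Proof. by have [u [uw us]] := reduced_ex w; exists u. Qed.

Lemma len1 : len 1 = 0%N.
Proof. by apply/eqP; rewrite -leqn0; exact: (len_le [::]). Qed.

Lemma lenM (x y : W) : (len (x * y)%g <= len x + len y)%N.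
Proof.
have [u <- <-] := len_word x; have [t <- <-] := len_word y.
by rewrite -of_wordM -size_cat len_le.
Qed.

Lemma len_gen i : (len (gen i) <= 1)%N.
Proof. exact: (len_le [:: i]). Qed.

Lemma len_genM_le i w : (len (gen i * w)%g <= (len w).+1)%N.
Proof. by apply: leq_trans (lenM _ _) _; rewrite -add1n leq_add2r len_gen. Qed.

Lemma lenV x : len x^-1 = len x.
Proof.
suff le y : (len y^-1 <= len y)%N by apply/eqP; rewrite eqn_leq le -{1}[x]invgK le.
by have [u <- <-] := len_word y; rewrite -of_word_rev -(size_rev u) len_le.
Qed.

Lemma cox_odd u u' : cox_cong u u' -> odd (size u) = odd (size u').
Proof.
elim=> {u u'} // [u u' x _ -> _ -> //|u u' x x' _ Eu _ Ex].
by rewrite !size_cat !oddD Eu Ex.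
Qed.

Lemma odd_len u : odd (len (of_word u)) = odd (size u).
Proof. by have [t /of_wordP/cox_odd tu <-] := len_word (of_word u). Qed.

Lemma odd_lenM (x y : W) : odd (len (x * y)) = odd (len x) (+) odd (len y).
Proof.
rewrite -(of_word_repr x) -(of_word_repr y) -of_wordM !odd_len.
by rewrite size_cat oddD.
Qed.

Lemma odd_len_gen i : odd (len (gen i)).
Proof. by rewrite odd_len. Qed.

(* [eta u t] is the parity of the number of times [t] occurs among the left
   inversions [s_1 .. s_(k-1) s_k s_(k-1) .. s_1] of the word [u]. *)
Fixpoint eta (u : word) (t : W) : bool :=
  if u is i :: u' then (t == gen i) (+) eta u' (gen i * t * gen i) else false.

Lemma eta_cat u u' t :
  eta (u ++ u') t = eta u t (+) eta u' ((of_word u)^-1 * t * of_word u).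
Proof.
elim: u t => [|i u IH] t /=; first by rewrite of_word_nil invg1 mul1g mulg1.
by rewrite IH addbA of_word_cons invMg genV !mulgA.
Qed.

(** Each defining relation contributes every reflection an even number of times, so the parity
    survives although the list of inversions of a word does not. *)
Lemma eta_cong u u' : cox_cong u u' -> eta u =1 eta u'.
Proof.
elim=> {u u'} //=.
- by move=> u u' _ E t; rewrite E.
- by move=> u u' x _ E _ E' t; rewrite E E'.
- move=> u u' x x' uu' E _ E' t; rewrite !eta_cat E E'.
  by move/of_wordP: uu' => ->.
- move=> i t; rewrite addbF.
  suff -> : (gen i * t * gen i == gen i) = (t == gen i) by rewrite addbb.
  apply/eqP/eqP => [|->]; last by rewrite gen_sq mul1g.
  move=> /(canRL (mulgK _)); rewrite genV gen_sq => /(canRL (mulKg _)).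
  by rewrite genV mulg1.
- move=> i j ij t.
  (* [x] is the longest element of the subgroup generated by [gen i] and [gen j]; conjugation by it
     exchanges the two generators. Hence the last three tests in the sum repeat the first three and
     cancel them. *)
  have [x xD] : exists x, x = gen i * (gen j * gen i) by exists (gen i * (gen j * gen i)).
  have xE : x = gen j * (gen i * gen j) by rewrite xD gen_braid.
  have xx : x * x = 1 by rewrite xE -!mulgA !genK gen_sq.
  have ix : gen i * x = x * gen j by rewrite {1}xE xD -!mulgA.
  have jx : gen j * x = x * gen i by rewrite {1}xD xE -!mulgA.
  have conj k l y : gen k * x = x * gen l -> (x * y * x == gen k) = (y == gen l).
    move=> kx; have kE : gen k = x * gen l * x by rewrite -kx -mulgA xx mulg1.
    apply/eqP/eqP => [|->]; last by [].
    by rewrite kE => /mulIg/mulgI.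
  have y3 : gen i * (gen j * (gen i * t * gen i) * gen j) * gen i = x * t * x.
    by rewrite xD -!mulgA.
  have y4 : gen j * (x * t * x) * gen j = x * (gen i * t * gen i) * x.
    by rewrite !mulgA jx -!mulgA -ix.
  have y5 : gen i * (x * (gen i * t * gen i) * x) * gen i
            = x * (gen j * (gen i * t * gen i) * gen j) * x.
    by rewrite !mulgA ix -!mulgA -jx.
  rewrite y3 y4 y5 (conj j i) // (conj i j) // (conj j i) //.
  by do 3!case: (_ == _).
Qed.

Lemma eta_of_word u u' t : of_word u = of_word u' -> eta u t = eta u' t.
Proof. by move/of_wordP/eta_cong. Qed.

Definition linv (t w : W) : bool := eta (repr w) t.

Lemma linv_word t u : linv t (of_word u) = eta u t.
Proof. by apply: eta_of_word; rewrite of_word_repr. Qed.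

Lemma linv1 t : linv t 1 = false.
Proof. by rewrite -of_word_nil linv_word. Qed.

(** The cocycle identity: with [linv_gen] it reduces questions about inversions to equalities
    between reflections. *)
Lemma linvM t x y : linv t (x * y) = linv t x (+) linv (x^-1 * t * x) y.
Proof.
rewrite -(of_word_repr x) -(of_word_repr y) -of_wordM !linv_word.
exact: eta_cat.
Qed.

Lemma linv_gen t i : linv t (gen i) = (t == gen i).
Proof. by rewrite linv_word /= addbF. Qed.

Lemma linv_genM t i w :
  linv t (gen i * w) = (t == gen i) (+) linv (gen i * t * gen i) w.
Proof. by rewrite linvM linv_gen genV. Qed.

Lemma reflection_gen i : reflection (gen i).
Proof. by exists i, 1; rewrite conjg1. Qed.

Lemma reflectionJ t w : reflection t -> reflection (t ^ w).
Proof. by case=> i [x ->]; exists i, (x * w); rewrite conjgM. Qed.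

Lemma conj_gen t i : t ^ gen i = gen i * t * gen i.
Proof. by rewrite conjgE genV mulgA. Qed.

Lemma reflection_sq t : reflection t -> t * t = 1.
Proof. by case=> i [w ->]; rewrite -conjMg gen_sq conj1g. Qed.

Lemma reflectionV t : reflection t -> t^-1 = t.
Proof. by move/reflection_sq => tt; rewrite -[LHS]mulg1 -tt mulKg. Qed.

Lemma linv_refl t : reflection t -> linv t t.
Proof.
case=> i [w ->]; elim/W_ind_r: w => [|j w IH].
  by rewrite conjg1 linv_gen eqxx.
rewrite conjgM; set t' := gen i ^ w in IH *.
rewrite conj_gen -mulgA linv_genM genK mulgenK linvM IH mulVg mul1g linv_gen.
suff -> : (gen j * (t' * gen j) == gen j) = (t' == gen j) by case: (_ == _).
apply/eqP/eqP => [E|->]; last by rewrite gen_sq mulg1.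
by rewrite -[LHS](mulgenK j) -[X in X * _](genK j) -mulgA E gen_sq mulg1.
Qed.

Lemma eta_exchange u t : eta u t ->
  exists2 u', of_word u' = t * of_word u & (size u' < size u)%N.
Proof.
elim: u t => [|i u IH] t //=; case: eqP => [->|_] /=.
  by exists u; rewrite ?of_word_cons ?genK.
case/IH => u' Eu' su'; exists (i :: u') => //.
by rewrite !of_word_cons Eu' -!mulgA genK.
Qed.

Lemma linv_lt t w : linv t w -> (len (t * w)%g < len w)%N.
Proof.
have [u <- <-] := len_word w; rewrite linv_word => /eta_exchange[u' <- su'].
exact: leq_ltn_trans (len_le _) su'.
Qed.

(** If [t] is not an inversion of [w], the cocycle identity and [linv_refl] make it one of [t * w],
    so that [w] is the shorter of the two. *)
Lemma lt_linv t w : reflection t -> (len (t * w)%g < len w)%N = linv t w.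
Proof.
move=> rt; apply/idP/idP => [|/linv_lt //]; apply: contraTT => tw.
rewrite -leqNgt ltnW // -{1}[w]mul1g -(reflection_sq rt) -mulgA.
apply: linv_lt; rewrite linvM linv_refl // (reflectionV rt) (reflection_sq rt) mul1g.
by rewrite (negPf tw).
Qed.

Lemma odd_len_refl t : reflection t -> odd (len t).
Proof.
case=> i [w ->]; rewrite conjgE odd_lenM odd_lenM lenV odd_len_gen addbC -addbA.
by rewrite addbb.
Qed.

Lemma gt_linv t w : reflection t -> (len w < len (t * w)%g)%N = ~~ linv t w.
Proof.
move=> rt; rewrite -lt_linv // -leqNgt [in RHS]leq_eqVlt.
suff -> : (len w == len (t * w)%g) = false by [].
apply: contraTF (odd_len_refl rt) => /eqP/(congr1 odd); rewrite odd_lenM.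
by case: (odd _); case: (odd _).
Qed.

Lemma len_genM i w : len (gen i * w) = if linv (gen i) w then (len w).-1 else (len w).+1.
Proof.
have ri := reflection_gen i.
have le1 := len_genM_le i w.
have le2 : (len w <= (len (gen i * w)%g).+1)%N.
  by rewrite -{1}(genK i w); exact: len_genM_le.
move: (lt_linv w ri) (gt_linv w ri) le1 le2; case: linv => /= [+ _ _|_].
  move: (len _) (len w) => a b ab ba; apply/eqP.
  by rewrite eqn_leq -ltnS (ltn_predK ab) ab -subn1 leq_subLR add1n.
by move=> lt le _; apply/eqP; rewrite eqn_leq le lt.
Qed.

Definition rinv (w t : W) : bool := linv t w^-1.

Lemma rinv_linv w t : rinv w t = linv (w * t * w^-1) w.
Proof.
rewrite /rinv; have := linvM t w^-1 w; rewrite mulVg linv1 invgK.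
by case: linv => /esym; case: linv.
Qed.

Lemma len_mulgen w i : len (w * gen i) = if rinv w (gen i) then (len w).-1 else (len w).+1.
Proof. by rewrite -lenV invMg genV len_genM /rinv lenV. Qed.

Lemma rinvM x y t : rinv (x * y) t = rinv y t (+) rinv x (y * t * y^-1).
Proof. by rewrite /rinv invMg linvM invgK. Qed.

Lemma rinv_gen i t : rinv (gen i) t = (t == gen i).
Proof. by rewrite /rinv genV linv_gen. Qed.

Lemma gt_rinv t w : reflection t -> (len w < len (w * t)%g)%N = ~~ rinv w t.
Proof.
move=> rt; rewrite -(lenV w) -(lenV (w * t)) invMg (reflectionV rt).
exact: gt_linv.
Qed.

Lemma len0 w : len w = 0%N -> w = 1.
Proof. by have [u <- <-] := len_word w => /size0nil ->. Qed.

(** * Bruhat order *)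

Lemma bruhat_refl x : bruhat x x.
Proof. exact: rt_refl. Qed.

Lemma bruhat_trans x y z : bruhat x y -> bruhat y z -> bruhat x z.
Proof. exact: rt_trans. Qed.

Lemma bruhat_step x t : reflection t -> ~~ rinv x t -> bruhat x (x * t).
Proof.
move=> rt xt; apply: rt_step; exists t => //; split=> //.
by rewrite gt_rinv.
Qed.

Lemma bruhat_stepl t x : reflection t -> ~~ linv t x -> bruhat x (t * x).
Proof.
move=> rt tx; have -> : t * x = x * t ^ x by rewrite conjgE !mulgA mulgV mul1g.
apply: bruhat_step; first exact: reflectionJ.
by rewrite rinv_linv conjgE !mulgA mulgV mul1g mulgK.
Qed.

Lemma bruhat_len x y : bruhat x y -> (len x <= len y)%N.
Proof.
elim=> // [{}x {}y [t _ [_ /ltnW]]|{}x {}y z _ xy _ yz] //.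
exact: leq_trans yz.
Qed.

Lemma bruhat_len_lt x y : bruhat x y -> x <> y -> (len x < len y)%N.
Proof.
elim=> [{}x {}y [t _ [_]]|//|{}x {}y z _ xy _ yz xz] //.
have [E|/eqP ne] := eqVneq x y; first by rewrite E in xz *; exact: yz.
apply: leq_trans (xy ne) _; have [<-//|/eqP ne'] := eqVneq y z.
by rewrite ltnW // yz.
Qed.

Lemma bruhatV x y : bruhat x y -> bruhat x^-1 y^-1.
Proof.
elim=> [{}x {}y [t rt [-> lt]]|{}x|{}x {}y z _ xy _ yz].
- rewrite invMg (reflectionV rt); apply: bruhat_stepl => //.
  have E : t * x^-1 = (x * t)^-1 by rewrite invMg (reflectionV rt).
  by rewrite -gt_linv // E !lenV.
- exact: bruhat_refl.
- exact: bruhat_trans yz.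
Qed.

Lemma rinv_mulgen x i : rinv (x * gen i) (gen i) = ~~ rinv x (gen i).
Proof. by rewrite rinvM rinv_gen eqxx genV mulgenK. Qed.

Lemma linv_genMl x i : linv (gen i) (gen i * x) = ~~ linv (gen i) x.
Proof. by rewrite linv_genM eqxx mulgenK. Qed.

Lemma bruhat_mulgen x i : ~~ rinv x (gen i) -> bruhat x (x * gen i).
Proof. exact/bruhat_step/reflection_gen. Qed.

Lemma bruhat_mulgen_lt x i : rinv x (gen i) -> bruhat (x * gen i) x.
Proof.
move=> xi; rewrite -{2}(mulgenK i x); apply: bruhat_mulgen.
by rewrite rinv_mulgen xi.
Qed.

(* A reflection step stays a step after right multiplication by a simple
   reflection [s], unless it is the step from [x] to [x s]. *)
Lemma bstep_mulgen x t i : reflection t -> ~~ rinv x t -> t <> gen i ->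
  bruhat (x * gen i) (x * t * gen i).
Proof.
move=> rt xt ti.
have -> : x * t * gen i = x * gen i * t ^ gen i by rewrite conj_gen -!mulgA genK.
apply: bruhat_step; first exact: reflectionJ.
rewrite rinvM rinv_gen conj_gen genV -!mulgA genK gen_sq mulg1.
rewrite (negPf xt) addbF; apply/eqP => /(canRL (mulKg _)).
by rewrite genV gen_sq => /(canRL (mulgK _)); rewrite mul1g genV.
Qed.

Lemma bruhat_genr x y i :
  bruhat x y -> bruhat (x * gen i) y \/ bruhat (x * gen i) (y * gen i).
Proof.
move=> H; have {H} := clos_rt_rt1n _ _ _ _ H; elim=> [{}x|{}x z {}y [t rt [zE lt]] zy IH].
  by right; exact: bruhat_refl.
have xt : ~~ rinv x t by rewrite -gt_rinv // -zE.
have [ti|/eqP ti] := eqVneq t (gen i).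
  by left; rewrite -ti -zE; apply/clos_rt1n_rt.
have st : bruhat (x * gen i) (z * gen i) by rewrite zE; exact: bstep_mulgen.
by case: IH => H; [left|right]; exact: bruhat_trans st H.
Qed.

Lemma bruhat_lift x y i : rinv y (gen i) -> bruhat x y ->
  bruhat x (y * gen i) \/ bruhat (x * gen i) (y * gen i).
Proof.
move=> + H; have {H} := clos_rt_rtn1 _ _ _ _ H; elim=> {y} [|y z [t rt [zE lt]] xy IH] zi.
  by right; exact: bruhat_refl.
have yt : ~~ rinv y t by rewrite -gt_rinv // -zE.
have {}xy : bruhat x y by apply/clos_rtn1_rt.
have [ti|/eqP ti] := eqVneq t (gen i).
  by left; rewrite zE ti mulgenK.
have st : bruhat (y * gen i) (z * gen i) by rewrite zE; exact: bstep_mulgen.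
have [yi|yi] := boolP (rinv y (gen i)).
  by case: (IH yi) => H; [left|right]; exact: bruhat_trans st.
by left; apply: bruhat_trans xy (bruhat_trans (bruhat_mulgen yi) st).
Qed.

(** The lifting property in the form used to compute lower intervals: going up by a simple
    reflection adds the translate of the interval. *)
Lemma bruhat_mulgenE x y i : ~~ rinv y (gen i) ->
  bruhat x (y * gen i) <-> bruhat x y \/ bruhat (x * gen i) y.
Proof.
move=> yi; split=> [H|].
  by have := bruhat_lift (i := i) _ H; rewrite mulgenK rinv_mulgen; apply.
have le := bruhat_mulgen yi.
case=> H; first exact: bruhat_trans le.
case: (bruhat_genr i H); rewrite mulgenK // => H'.
exact: bruhat_trans le.
Qed.

Lemma bruhat_genME x y i : ~~ linv (gen i) y ->
  bruhat x (gen i * y) <-> bruhat x y \/ bruhat (gen i * x) y.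
Proof.
move=> yi; have V a b : bruhat a b <-> bruhat a^-1 b^-1.
  by split=> [/bruhatV //|/bruhatV]; rewrite !invgK.
rewrite V invMg genV bruhat_mulgenE; last by rewrite /rinv invgK.
by rewrite V (V (gen i * x)) invMg genV !invgK.
Qed.

(** * Distinctness of the generators, double descents, finiteness and lower sets *)

Lemma Z3_ind (P : 'Z_3 -> Prop) : P 0%R -> P 1%R -> P (1 + 1)%R -> forall i, P i.
Proof.
move=> P0 P1 P2 [[|[|[|//]]] lti]; [move: P0|move: P1|move: P2];
  by congr P; apply/val_inj.
Qed.

(* The action of [W] on Z/3 in which [gen i] is the reflection fixing [i]. *)
Definition dihedral (u : word) (x : 'Z_3) : 'Z_3 :=
  foldr (fun i y => i + i - y)%R x u.

Lemma dihedral_cong u u' : cox_cong u u' -> dihedral u =1 dihedral u'.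
Proof.
elim=> {u u'} //.
- by move=> u u' _ E x; rewrite E.
- by move=> u u' x _ E _ E' y; rewrite E E'.
- move=> u u' x x' _ E _ E' y; rewrite /dihedral !foldr_cat.
  by rewrite -/(dihedral _ _) -/(dihedral x y) E' E.
- by move=> i x; rewrite /= subKr.
- by move=> i j _ x; apply/eqP; move: i j x; do 3!apply: Z3_ind.
Qed.

Lemma gen_inj : injective gen.
Proof.
move=> i j /of_wordP/dihedral_cong/(_ i)/eqP; rewrite /= addrK.
by move: i j; do 2!apply: Z3_ind => //.
Qed.

(** The exchange step behind Matsumoto's theorem: an element with two left descents starts with the
    longest element of the subgroup they generate. *)
Lemma braid_descent i j w : i != j -> linv (gen i) w -> linv (gen j) w ->
  exists2 c, w = gen i * (gen j * (gen i * c)) & len w = (len c).+3.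
Proof.
move=> ij iw jw.
have neq k l : k != l -> (gen k * gen l * gen k == gen k) = false.
  move=> /eqP kl; apply/eqP => /(canRL (mulgK _)); rewrite mulgV.
  by move=> /(canRL (mulKg _)); rewrite genV mulg1 => /gen_inj/esym.
have rJ k l : reflection (gen k * gen l * gen k).
  by rewrite -conj_gen; exact/reflectionJ/reflection_gen.
(* As [gen l] is an inversion of [w], its conjugate by [gen k] is one of [gen k * w]; multiplying by
   it shortens a second time. *)
have two k l : k != l -> linv (gen k) w -> linv (gen l) w ->
    ((len (gen k * (gen l * w))%g).+2 <= len w)%N.
  move=> kl kw lw; have lk : l != k by rewrite eq_sym.
  have : linv (gen k * gen l * gen k) (gen k * w).
    by rewrite linv_genM neq // -!mulgA !genK gen_sq mulg1.
  move=> /linv_lt; rewrite -!mulgA genK => lt.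
  exact: leq_ltn_trans lt (linv_lt kw).
exists (gen i * (gen j * (gen i * w))); first by rewrite !genK.
have ji : j != i by rewrite eq_sym.
have jd : linv (gen i) (gen j * (gen i * w)).
  rewrite !linv_genM (inj_eq gen_inj) (negPf ij) /= -mulgA gen_braid // mulgA neq //.
  by rewrite -!mulgA !genK gen_sq mulg1.
apply/eqP; rewrite eqn_leq; apply/andP; split.
  rewrite -{1}(genK i w) -{1}(genK j (gen i * w)) -{1}(genK i (gen j * (gen i * w))).
  by do 3!(apply: leq_trans (len_genM_le _ _) _; rewrite ltnS).
by apply: leq_trans (two j i ji jw iw); rewrite !ltnS; exact: linv_lt jd.
Qed.

(** Words padded with [None] to length [k] present this set inside the image of a finite type. *)
Lemma finite_len k : finite_set [set w : W | (len w <= k)%N].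
Proof.
apply: (@sub_finite_set _ _ ((fun t : k.-tuple (option 'Z_3) => of_word (pmap id t)) @` setT)).
  move=> w /= wk; have [u uE uw] := len_word w.
  have st : size ([seq Some i | i <- u] ++ nseq (k - len w) None) == k.
    by rewrite size_cat size_map size_nseq uw subnKC.
  exists (Tuple st) => //=; rewrite -uE; congr of_word.
  rewrite pmap_cat -[RHS]cats0; congr (_ ++ _); first by rewrite map_pK.
  by elim: (k - _)%N.
exact/finite_image/finite_finset.
Qed.

Lemma finite_bruhat x : finite_set [set z | bruhat z x].
Proof.
apply: sub_finite_set (finite_len (len x)) => z /=; exact: bruhat_len.
Qed.

Definition lower_closed (A : pred W) := forall x y, bruhat x y -> A y -> A x.

Lemma lower_closed_gen (A : pred W) i : lower_closed A ->
  forall x, ~~ rinv x (gen i) -> A (x * gen i) -> A x.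
Proof. by move=> lA x xi; apply: lA; exact: bruhat_mulgen. Qed.

Lemma lower_closedUr (A : pred W) i : lower_closed A ->
  lower_closed (fun x => A x || A (x * gen i)).
Proof.
move=> lA x y xy /orP[Ay|Ay]; first by rewrite (lA _ _ xy Ay).
have [yi|yi] := boolP (rinv y (gen i)).
  case: (bruhat_lift yi xy) => H; by rewrite (lA _ _ H Ay) ?orbT.
by rewrite (lA _ _ xy) // (lA _ _ (bruhat_mulgen yi) Ay).
Qed.

Lemma lower_closedIr (A : pred W) i : lower_closed A ->
  lower_closed (fun x => A x && A (x * gen i)).
Proof.
move=> lA x y xy /andP[Ay Ayi]; rewrite (lA _ _ xy Ay) /=.
by case: (bruhat_genr i xy) => H; [apply: lA H Ay|apply: lA H Ayi].
Qed.

Lemma lower_closedV (A : pred W) : lower_closed A -> lower_closed (fun x => A x^-1).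
Proof. by move=> lA x y /bruhatV; exact: lA. Qed.

Lemma lower_closedUl (A : pred W) i : lower_closed A ->
  lower_closed (fun x => A x || A (gen i * x)).
Proof.
move=> /lower_closedV/(@lower_closedUr _ i)/lower_closedV lA x y /lA.
by rewrite !invMg !invgK genV.
Qed.

Lemma lower_closedIl (A : pred W) i : lower_closed A ->
  lower_closed (fun x => A x && A (gen i * x)).
Proof.
move=> /lower_closedV/(@lower_closedIr _ i)/lower_closedV lA x y /lA.
by rewrite !invMg !invgK genV.
Qed.

End CoxeterGroup.

Section BraidInversions.
Local Open Scope group_scope.

Lemma linv_braid i j w : i != j -> linv (gen i) w -> linv (gen j) w ->
  linv (gen i * gen j * gen i) w.
Proof.
move=> ij iw jw; have [c wE wl] := braid_descent ij iw jw.
rewrite -lt_linv; last by rewrite -conj_gen; exact/reflectionJ/reflection_gen.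
by rewrite wl wE -!mulgA !genK ltnS ltnW.
Qed.

Lemma linv_gen_neq i j w : i != j ->
  linv (gen j) (gen i * w) = linv (gen i * gen j * gen i) w.
Proof. by move=> ij; rewrite linv_genM (inj_eq gen_inj) eq_sym (negPf ij). Qed.

Lemma conj_gen_neq i j : i != j -> (gen i * gen j * gen i == gen j) = false.
Proof.
move=> ij; apply/eqP; rewrite -mulgA gen_braid // => /(canRL (mulKg _)).
rewrite mulVg => /(canRL (mulgK _)); rewrite mul1g genV => /gen_inj.
exact/eqP.
Qed.

Lemma linv_gen_gen i j w : i != j ->
  linv (gen i) (gen j * (gen i * w)) = linv (gen j) w.
Proof.
move=> ij; have ji : j != i by rewrite eq_sym.
rewrite linv_gen_neq // linv_genM conj_gen_neq //=.
by rewrite -[_ * gen j]mulgA -gen_braid // -!mulgA !genK gen_sq mulg1.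
Qed.

(** Multiplication by the longest element of the dihedral subgroup complements the inversions lying
    in that subgroup, which turns the claim into [linv_braid]. *)
Lemma linv_braidN i j w : i != j -> ~~ linv (gen i) w -> ~~ linv (gen j) w ->
  ~~ linv (gen i * gen j * gen i) w.
Proof.
move=> ij iw jw; have ji : j != i by rewrite eq_sym.
pose w' := gen i * (gen j * (gen i * w)).
have iw' : linv (gen i) w' by rewrite linv_genMl linv_gen_gen.
have jw' : linv (gen j) w'.
  by rewrite /w' !mulgA -[_ * gen j * _]mulgA gen_braid // -!mulgA linv_genMl linv_gen_gen.
have := linv_braid ij iw' jw'; set t := _ * gen i.
have -> : w' = t * w by rewrite /w' /t -!mulgA.
have rt : reflection t by rewrite /t -conj_gen; exact/reflectionJ/reflection_gen.
by rewrite linvM linv_refl // (reflectionV rt) (reflection_sq rt) mul1g.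
Qed.
End BraidInversions.

(** * The Hecke algebra acting on functions on [W], and coefficients *)

Section Regular.
Context (A : comUnitRingType) (v : A).
Local Notation q := (v^-1 - v).
Local Notation fn := (W -> A).

(** What left multiplication by [Hgen v i] does to coefficients in the standard basis, written down
    before that basis is known to exist. *)
Definition lact i (f : fn) : fn :=
  fun w => f (gen i * w)%g + (linv (gen i) w)%:R * (q * f w).
Definition ract i (f : fn) : fn :=
  fun w => f (w * gen i)%g + (rinv w (gen i))%:R * (q * f w).

(** The two actions interfere only where [gen i * w] equals [w * gen j]; there the left and right
    descent conditions coincide, and the correction terms agree. *)
Lemma lact_ract i j f : lact i (ract j f) = ract j (lact i f).
Proof.
apply/funext => w; rewrite /lact /ract mulgA.
rewrite linvM linv_gen rinvM rinv_gen.
have -> : (w^-1 * gen i * w == gen j)%g = (w * gen j * w^-1 == gen i)%g.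
  apply/eqP/eqP => <-; first by rewrite -!mulgA mulgV mulg1 mulKVg.
  by rewrite -!mulgA mulVg mulg1 mulKg.
case: eqP => [E | _] /=.
  rewrite rinv_linv E -(canRL (mulgKV _) E).
  by case: linv => /=; ring.
by case: linv; case: rinv => /=; ring.
Qed.

Lemma lact_quad i f w : lact i (lact i f) w = q * lact i f w + f w.
Proof.
rewrite /lact genK linv_genMl; case: linv => /=; ring.
Qed.

(** Both sides depend on which of the three reflections generated by [gen i] and [gen j] are
    inversions of [w]. Two of the eight patterns are impossible by [linv_braid] and [linv_braidN];
    in the other six the identity is polynomial. *)
Lemma lact_braid i j f w : i != j ->
  lact i (lact j (lact i f)) w = lact j (lact i (lact j f)) w.
Proof.
move=> ij; have ji : j != i by rewrite eq_sym.
rewrite /lact !linv_genMl !linv_gen_gen // !linv_gen_neq //.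
have E : (gen j * gen i * gen j = gen i * gen j * gen i)%g.
  by rewrite -!mulgA gen_braid.
rewrite !genK !mulgA !E.
have := @linv_braid i j w ij; have := @linv_braidN i j w ij.
case: (linv (gen i) w); case: (linv (gen j) w); case: (linv (_ * _)%g w) => /= H1 H2.
all: try (by have := H1 isT isT).
all: try (by have := H2 isT isT).
all: by ring.
Qed.

Lemma lact_sum i (I : Type) (r : seq I) (c : I -> A) (F : I -> fn) w :
  lact i (fun w => \sum_(k <- r) c k * F k w) w = \sum_(k <- r) c k * lact i (F k) w.
Proof.
rewrite /lact !mulr_sumr -big_split /=; apply: eq_bigr => k _; ring.
Qed.

Definition word_lact (u : seq 'Z_3) (f : fn) : fn := foldr lact f u.

Lemma word_lact_sum u (I : Type) (r : seq I) (c : I -> A) (F : I -> fn) w :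
  word_lact u (fun w => \sum_(k <- r) c k * F k w) w = \sum_(k <- r) c k * word_lact u (F k) w.
Proof.
elim: u w => [|i u IH] w //=; rewrite -lact_sum; congr (lact i _ w).
exact/funext.
Qed.

Lemma word_lact_ract u j f : word_lact u (ract j f) = ract j (word_lact u f).
Proof. by elim: u => //= i u ->; rewrite lact_ract. Qed.

Definition free_act (a : free_alg A) (f : fn) : fn :=
  fun w => mmap idfun (fun m : {fmonom 'Z_3} => word_lact m f w) a.

Lemma free_actE a f w :
  free_act a f w = \sum_(k <- msupp a) mcoeff k a * word_lact k f w.
Proof. by []. Qed.

Lemma free_act0 f w : free_act 0 f w = 0.
Proof. exact: mmap0. Qed.

Lemma free_actD a b f w : free_act (a + b) f w = free_act a f w + free_act b f w.
Proof. exact: mmapD. Qed.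

Lemma free_actB a b f w : free_act (a - b) f w = free_act a f w - free_act b f w.
Proof. exact: mmapB. Qed.

Lemma free_actU c (k : {fmonom 'Z_3}) f w : free_act << c *g k >> f w = c * word_lact k f w.
Proof. exact: mmapU. Qed.

Lemma free_actZ c a f w : free_act (c *: a) f w = c * free_act a f w.
Proof.
rewrite /free_act (mmapEw (msuppZ_le _ _)) mmapE big_distrr /=.
by apply/eq_bigr=> k _; rewrite linearZ /= mulrA.
Qed.

Lemma free_act1 f w : free_act 1 f w = f w.
Proof. by rewrite /free_act mmapU mul1r fm1. Qed.

Lemma free_actM a b f w : free_act (a * b) f w = free_act a (free_act b f) w.
Proof.
rewrite malgME /free_act raddf_sum mmapE /=; apply: eq_bigr => k _.
rewrite raddf_sum [X in _ * X](_ : _ = \sum_(l <- msupp b) mcoeff l b * word_lact k (word_lact l f) w).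
  rewrite mulr_sumr; apply: eq_bigr => l _.
  by rewrite /= mmapU /= fmM /word_lact foldr_cat mulrA.
by rewrite -word_lact_sum; congr (word_lact _ _ _).
Qed.

Lemma free_act_gen i f w : free_act (free_gen A i) f w = lact i f w.
Proof. by rewrite /free_gen unlock free_actU mul1r fmU. Qed.

Lemma free_act_ract a j f w : free_act a (ract j f) w = ract j (free_act a f) w.
Proof.
rewrite !free_actE /ract !free_actE !mulr_sumr -big_split /=; apply: eq_bigr => k _.
by rewrite word_lact_ract /ract; ring.
Qed.

Lemma free_act_eq0 a f w : (forall w, f w = 0) -> free_act a f w = 0.
Proof.
move=> f0; have -> : f = (fun w => \sum_(k <- [::] : seq A) k * f w).
  by apply/funext => w'; rewrite big_nil f0.
by rewrite free_actE big1 // => k _; rewrite word_lact_sum big_nil mulr0.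
Qed.

Lemma free_act_ideal a f w : hecke_ideal v a -> free_act a f w = 0.
Proof.
move=> ia; elim: ia f w => {a} [i|i j ij||a b _ a0 _ b0|a b _ b0|a b _ a0] f w.
- rewrite free_actB free_actM free_actD free_actZ free_act1 !free_act_gen.
  rewrite (_ : free_act _ f = lact i f); last by apply/funext => ?; rewrite free_act_gen.
  by rewrite lact_quad subrr.
- have M3 k l : free_act (free_gen A k * free_gen A l * free_gen A k) f w
                = lact k (lact l (lact k f)) w.
    rewrite !free_actM free_act_gen; congr (lact k _ w).
    apply/funext => w1; rewrite free_act_gen; congr (lact l _ w1).
    by apply/funext => w2; rewrite free_act_gen.
  rewrite free_actB; apply/eqP; rewrite subr_eq0; apply/eqP.
  exact: etrans (M3 i j) (etrans (lact_braid f w ij) (esym (M3 j i))).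
- exact: free_act0.
- by rewrite free_actD a0 b0 addr0.
- by rewrite free_actM free_act_eq0 // => w'; exact: b0.
- by rewrite free_actM a0.
Qed.

Definition delta (x : W) : fn := fun w => (w == x)%:R.

(* The coefficient of [H w] in [h], computed through the action of [h] on the
   function supported at [1]. *)
Definition coef (h : hecke v) : fn := free_act (repr h) (delta 1%g).

Lemma coef_free a w : coef (of_free v a) w = free_act a (delta 1%g) w.
Proof.
apply/eqP; rewrite -subr_eq0 -free_actB; apply/eqP/free_act_ideal.
exact: hecke_repr.
Qed.

Lemma coefD g h w : coef (g + h) w = coef g w + coef h w.
Proof.
by rewrite -[g]of_free_repr -[h]of_free_repr -of_freeD !coef_free free_actD.
Qed.

Lemma coefZ c h w : coef (c *: h) w = c * coef h w.
Proof. by rewrite -[h]of_free_repr -of_freeZ !coef_free free_actZ. Qed.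

Lemma coef0 w : coef 0 w = 0.
Proof. by rewrite -(scale0r 0) coefZ mul0r. Qed.

Lemma coefN h w : coef (- h) w = - coef h w.
Proof. by rewrite -scaleN1r coefZ mulN1r. Qed.

Lemma coefB g h w : coef (g - h) w = coef g w - coef h w.
Proof. by rewrite coefD coefN. Qed.

Lemma coef_sum (I : Type) (r : seq I) (P : pred I) (F : I -> hecke v) w :
  coef (\sum_(i <- r | P i) F i) w = \sum_(i <- r | P i) coef (F i) w.
Proof. exact: (big_morph (coef^~ w) (fun g h => coefD g h w) (coef0 w)). Qed.

Lemma coef1 : coef 1 = delta 1%g.
Proof. by apply/funext => w; rewrite coef_free free_act1. Qed.

Lemma coef_genM i h : coef (Hgen v i * h) = lact i (coef h).
Proof.
apply/funext => w; rewrite -[h]of_free_repr -of_freeM coef_free free_actM free_act_gen.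
by congr (lact i _ w); apply/funext => w'; rewrite coef_free.
Qed.

Lemma lact_delta1 i : lact i (delta 1%g) = delta (gen i).
Proof.
apply/funext => w; rewrite /lact /delta.
case: (eqVneq w 1%g) => [->|_]; first by rewrite linv1 mul0r addr0 mulg1 eq_sym.
rewrite !mulr0 addr0; congr (GRing.natmul _ (nat_of_bool _)); apply/eqP/eqP => [|->]; last exact: gen_sq.
by move/(canRL (mulKg _)); rewrite genV mulg1.
Qed.

Lemma ract_delta1 i : ract i (delta 1%g) = delta (gen i).
Proof.
apply/funext => w; rewrite /ract /delta.
case: (eqVneq w 1%g) => [->|_].
  by rewrite /rinv invg1 linv1 mul0r addr0 mul1g eq_sym.
rewrite !mulr0 addr0; congr (GRing.natmul _ (nat_of_bool _)); apply/eqP/eqP => [|->]; last exact: gen_sq.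
by move/(canRL (mulgK _)); rewrite genV mul1g.
Qed.

(** On the function supported at 1 the left and the right action of a generator agree, and the right
    action then moves outside because it commutes with the left one. *)
Lemma coef_mulgen i h : coef (h * Hgen v i) = ract i (coef h).
Proof.
apply/funext => w; rewrite -[h]of_free_repr -of_freeM coef_free free_actM.
rewrite [X in free_act _ X](_ : _ = ract i (delta 1%g)); last first.
  by apply/funext => w'; rewrite free_act_gen lact_delta1 ract_delta1.
by rewrite free_act_ract; congr (ract i _ w); apply/funext => w'; rewrite coef_free.
Qed.

Lemma coef_Hword u : coef (\prod_(i <- u) Hgen v i) = word_lact u (delta 1%g).
Proof.
elim: u => [|i u IH]; first by rewrite big_nil coef1.
by rewrite big_cons coef_genM IH.
Qed.

(** * Standard basis *)

Lemma lact_delta i x : ~~ linv (gen i) x -> lact i (delta x) = delta (gen i * x)%g.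
Proof.
move=> ix; apply/funext => w; rewrite /lact /delta.
have -> : (gen i * w == x)%g = (w == gen i * x)%g.
  by apply/eqP/eqP => [<-|->]; rewrite genK.
by case: (eqVneq w x) => [->|_]; rewrite ?(negPf ix) ?mul0r ?mulr0 addr0.
Qed.

Lemma word_lact_reduced u : size u = len (of_word u) -> word_lact u (delta 1%g) = delta (of_word u).
Proof.
elim: u => [|i u IH] //=; rewrite of_word_cons len_genM => E.
have nu : ~~ linv (gen i) (of_word u).
  apply/negP => iu; have := leq_trans (leq_pred _) (len_le u).
  by move: E; rewrite iu => <-; rewrite ltnn.
by move: E; rewrite (negPf nu) => -[/IH ->]; rewrite lact_delta.
Qed.

(** Matsumoto's theorem. If the first letters differ, [braid_descent] supplies a common remainder
    [t], and the two words are joined through [i j i t] and [j i j t], with the induction hypothesis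
    applied to the tails. *)
Lemma Hword_reduced u u' : of_word u = of_word u' ->
  size u = len (of_word u) -> size u' = len (of_word u) ->
  \prod_(i <- u) Hgen v i = \prod_(i <- u') Hgen v i.
Proof.
have [k] := ubnP (size u); elim: k u u' => // k IH [|i u] [|j u'] // ku E su su'.
- by move: su'; rewrite -su.
- by move: su; rewrite -su'.
have red l t : size (l :: t) = len (of_word (l :: t)) ->
    linv (gen l) (of_word (l :: t)) /\ size t = len (of_word t).
  rewrite of_word_cons linv_genMl len_genM; have := len_le t.
  case: linv => /= le st; last by case: st.
  by have := leq_trans (leq_pred _) le; rewrite -st ltnn.
have [iu ru] := red _ _ su.
have [ju ru'] : linv (gen j) (of_word (j :: u')) /\ size u' = len (of_word u').
  by apply: red; rewrite -E.
rewrite !big_cons; case: (eqVneq i j) => [Eij|ij].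
  subst j; congr (_ * _); apply: IH => //.
    by move: E; rewrite !of_word_cons => /mulgI.
  by move: E; rewrite !of_word_cons => /mulgI ->.
rewrite -E in ju; have [c wE wl] := braid_descent ij iu ju.
have [t tc st] := len_word c.
have uE : of_word u = of_word [:: j, i & t].
  by move: wE; rewrite !of_word_cons tc => /mulgI.
have u'E : of_word u' = of_word [:: i, j & t].
  by move: E; rewrite wE gen_braidM // !of_word_cons tc => /mulgI.
have su'u : size u' = size u.
  by apply: succn_inj; rewrite -[LHS]/(size (j :: u')) su' -su.
have stu : (size t).+2 = size u.
  by apply: succn_inj; rewrite -[RHS]/(size (i :: u)) su wl st.
rewrite (IH u [:: j, i & t]) //= ?stu // (IH u' [:: i, j & t]) //= ?su'u ?stu //.
  by rewrite !big_cons !mulrA Hgen_braid.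
by rewrite -ru' su'u.
Qed.

Lemma H_word u : size u = len (of_word u) -> H v (of_word u) = \prod_(i <- u) Hgen v i.
Proof.
move=> su; have [rE rs] := red_wordP (of_word u).
by apply: Hword_reduced; rewrite rE // -rs.
Qed.

Lemma coefH x : coef (H v x) = delta x.
Proof.
by have [rE rs] := red_wordP x; rewrite coef_Hword word_lact_reduced rE.
Qed.

Lemma H1 : H v 1%g = 1.
Proof. by rewrite -of_word_nil H_word ?big_nil // of_word_nil len1. Qed.

Lemma H_genM i x : ~~ linv (gen i) x -> H v (gen i * x)%g = Hgen v i * H v x.
Proof.
move=> ix; have [u uE su] := len_word x; rewrite -uE -of_word_cons.
rewrite !H_word ?big_cons ?uE //; by rewrite of_word_cons uE len_genM (negPf ix) /= su.
Qed.

Lemma H_gen i : H v (gen i) = Hgen v i.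
Proof. by rewrite -[gen i]mulg1 H_genM ?linv1 // H1 mulr1. Qed.

Lemma genM_H i x : Hgen v i * H v x =
  H v (gen i * x)%g + (linv (gen i) x)%:R *: (q *: H v x).
Proof.
have [ix|ix] := boolP (linv (gen i) x); last by rewrite H_genM // scale0r addr0.
have ix' : ~~ linv (gen i) (gen i * x)%g by rewrite linv_genMl ix.
rewrite -{1}(genK i x) H_genM // mulrA Hgen_quad mulrDl mul1r -scalerAl.
by rewrite -H_genM // genK scale1r addrC.
Qed.

Lemma of_free_sum (I : Type) (r : seq I) (F : I -> free_alg A) :
  of_free v (\sum_(i <- r) F i) = \sum_(i <- r) of_free v (F i).
Proof. exact: (big_morph (of_free v) (@of_freeD _ v) erefl). Qed.

Lemma of_freeU c (k : {fmonom 'Z_3}) :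
  of_free v << c *g k >> = c *: \prod_(i <- k) Hgen v i.
Proof.
rewrite -[c]mulr1 -malg_scaleU of_freeZ mulr1; congr (_ *: _).
case: k => u /=; elim: u => [|i u IH].
  by rewrite big_nil -fmoneE.
rewrite big_cons -IH /Hgen -of_freeM; congr (of_free v _).
rewrite /free_gen unlock malgM_def fgmulUU mulr1; congr (<< _ *g _ >>).
by apply/val_inj; rewrite /= fmM fmU.
Qed.

Lemma hecke_span_word (h : hecke v) : exists s : seq (A * word),
  h = \sum_(p <- s) p.1 *: \prod_(i <- p.2) Hgen v i.
Proof.
rewrite -[h]of_free_repr; move: (repr h) => a.
exists [seq (mcoeff k a, k : seq _) | k <- msupp a].
by rewrite {1}[a]monalgE of_free_sum big_map; apply: eq_bigr => k _; rewrite of_freeU.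
Qed.

Definition spanned (h : hecke v) := exists s : seq (A * W),
  h = \sum_(p <- s) p.1 *: H v p.2.

Lemma spanned0 : spanned 0. Proof. by exists [::]; rewrite big_nil. Qed.

Lemma spannedD g h : spanned g -> spanned h -> spanned (g + h).
Proof. by case=> s -> [t ->]; exists (s ++ t); rewrite big_cat. Qed.

Lemma spannedZ c h : spanned h -> spanned (c *: h).
Proof.
case=> s ->; exists [seq (c * p.1, p.2) | p <- s].
by rewrite big_map scaler_sumr; apply: eq_bigr => p _; rewrite scalerA.
Qed.

Lemma spannedH x : spanned (H v x).
Proof. by exists [:: (1, x)]; rewrite big_seq1 scale1r. Qed.

Lemma spanned_sum (I : Type) (r : seq I) (F : I -> hecke v) :
  (forall i, spanned (F i)) -> spanned (\sum_(i <- r) F i).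
Proof.
by move=> sF; elim: r => [|i r IH]; rewrite ?big_nil ?big_cons;
  [exact: spanned0 | exact: spannedD].
Qed.

Lemma spanned_genM i h : spanned h -> spanned (Hgen v i * h).
Proof.
case=> s ->; rewrite mulr_sumr; apply: spanned_sum => p.
rewrite -scalerAr genM_H.
by do !(apply: spannedZ || apply: spannedD || apply: spannedH).
Qed.

Lemma hecke_spanned h : spanned h.
Proof.
have [s ->] := hecke_span_word h; apply: spanned_sum => p; apply: spannedZ.
elim: p.2 => [|i u IH]; first by rewrite big_nil -H1; exact: spannedH.
by rewrite big_cons; exact: spanned_genM.
Qed.

(** The [H w] span, and their coefficient functions are the [delta w]; collecting equal group
    elements in a spanning expression gives the claim. From here on, identities in the Hecke algebra
    are checked coefficientwise. *)
Lemma coef_inj g h : coef g =1 coef h -> g = h.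
Proof.
move=> gh; apply/eqP; rewrite -subr_eq0; apply/eqP.
have {gh} : coef (g - h) =1 fun=> 0 by move=> w; rewrite coefB gh subrr.
have [s ->] := hecke_spanned (g - h) => c0.
pose t := undup [seq p.2 | p <- s].
transitivity (\sum_(y <- t) \sum_(p <- s) (p.1 * delta p.2 y) *: H v y).
  rewrite exchange_big /= big_seq [RHS]big_seq; apply: eq_bigr => p ps.
  rewrite (bigD1_seq p.2) ?undup_uniq ?mem_undup ?map_f //=.
  rewrite {1}/delta eqxx mulr1 big1 ?addr0 // => y /negPf yp.
  by rewrite /delta yp mulr0 scale0r.
rewrite big1 // => y _; rewrite -scaler_suml.
have := c0 y; rewrite coef_sum => e.
rewrite (eq_bigr (fun p => coef (p.1 *: H v p.2) y)) ?e ?scale0r // => p _.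
by rewrite coefZ coefH.
Qed.

Lemma coef_sumH (s : seq W) (c : W -> A) w : uniq s ->
  coef (\sum_(y <- s) c y *: H v y) w = (w \in s)%:R * c w.
Proof.
move=> us; rewrite coef_sum; case: (boolP (w \in s)) => ws.
  rewrite (bigD1_seq w) //= coefZ coefH /delta eqxx mulr1 mul1r big1 ?addr0 //.
  by move=> y /negPf yw; rewrite coefZ coefH /delta eq_sym yw mulr0.
rewrite mul0r big_seq big1 // => y ys; rewrite coefZ coefH /delta.
by case: eqVneq ys => [<-|]; rewrite ?(negPf ws) // mulr0.
Qed.

Lemma hecke_coefE (s : seq W) h : uniq s -> (forall w, coef h w != 0 -> w \in s) ->
  h = \sum_(y <- s) coef h y *: H v y.
Proof.
move=> us hs; apply: coef_inj => w; rewrite coef_sumH //.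
case: (boolP (w \in s)) => [|ws]; first by rewrite mul1r.
by rewrite mul0r; apply/eqP; apply: contraNT ws; exact: hs.
Qed.

Lemma hecke_support h : exists2 s : seq W, uniq s & forall w, coef h w != 0 -> w \in s.
Proof.
have [s ->] := hecke_spanned h.
exists (undup [seq p.2 | p <- s]); first exact: undup_uniq.
move=> w; apply: contraNT; rewrite mem_undup => ws.
rewrite coef_sum big_seq big1 // => p ps; rewrite coefZ coefH /delta.
by case: eqVneq ws => [->|]; rewrite ?map_f // mulr0.
Qed.

Lemma coef_fsbig (S : set W) (c : W -> A) w : finite_set S ->
  coef (\sum_(z \in S) c z *: H v z) w = `[< S w >]%:R * c w.
Proof.
move=> fS; rewrite fsbig_finite //= coef_sumH; last exact: fset_uniq.
by rewrite in_fset_set // /in_mem /= /mem_set; congr (_%:R * _).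
Qed.

End Regular.

(** * The bar involution of the Laurent polynomials *)

Definition lev (p : {poly int}) (a : laurent) : laurent := (map_poly intr p).[a].

Lemma levD p q a : lev (p + q) a = lev p a + lev q a.
Proof. by rewrite /lev rmorphD hornerD. Qed.

Lemma levB p q a : lev (p - q) a = lev p a - lev q a.
Proof. by rewrite /lev rmorphB hornerD hornerN. Qed.

Lemma levM p q a : lev (p * q) a = lev p a * lev q a.
Proof. by rewrite /lev rmorphM hornerM. Qed.

Lemma lev1 a : lev 1 a = 1.
Proof. by rewrite /lev rmorph1 hornerC. Qed.

Lemma levXn k a : lev 'X^k a = a ^+ k.
Proof. by rewrite /lev map_polyXn hornerXn. Qed.

Lemma levC c a : lev c%:P a = c%:~R.
Proof. by rewrite /lev map_polyC hornerC. Qed.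

Lemma lev0 a : lev 0 a = 0.
Proof. by rewrite /lev rmorph0 horner0. Qed.

Lemma levX a : lev 'X a = a.
Proof. by rewrite /lev map_polyX hornerX. Qed.

Lemma lev_cons p c a : lev (p * 'X + c%:P) a = lev p a * a + c%:~R.
Proof. by rewrite levD levM levX levC. Qed.

Lemma lev_val p : laurent_val (lev p v) = tofrac p.
Proof.
have valD x y : laurent_val (x + y) = laurent_val x + laurent_val y by [].
have valM x y : laurent_val (x * y) = laurent_val x * laurent_val y by [].
elim/poly_ind: p => [|p c IH]; first by rewrite lev0 tofrac0.
rewrite lev_cons valD valM IH v_val tofracD tofracM; congr (_ + _).
have -> : laurent_val c%:~R = c%:~R by exact: (rmorph_int (val : {rmorphism laurent -> _})).
by rewrite -[c in RHS]intz !rmorph_int.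
Qed.

Lemma lev_inj p q : lev p v = lev q v -> p = q.
Proof.
by move/(congr1 laurent_val); rewrite !lev_val => /eqP; rewrite tofrac_eq => /eqP.
Qed.

Lemma laurentP (x : laurent) : exists pk : {poly int} * nat, x * v ^+ pk.2 = lev pk.1 v.
Proof.
have /asboolP[p [k E]] := valP x; exists (p, k) => /=.
apply/val_inj => /=; rewrite lev_val -E /=.
by rewrite -(levXn k v) -[RHS]/(laurent_val x * _) -lev_val.
Qed.

Lemma vV : v * v^-1 = 1. Proof. exact: (divrr v_unit). Qed.
Lemma Vv : v^-1 * v = 1. Proof. exact: (mulVr v_unit). Qed.

Definition lbar (x : laurent) : laurent :=
  let pk := sval (cid (laurentP x)) in lev pk.1 v^-1 * v ^+ pk.2.

(** Independence of the chosen denominator: evaluation at [v] is injective, so cross-multiplication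
    gives an identity of polynomials, which can be evaluated at [v^-1]. *)
Lemma lbarE x p k : x * v ^+ k = lev p v -> lbar x = lev p v^-1 * v ^+ k.
Proof.
rewrite /lbar; case: (cid _) => -[q l] /= ql pk.
have /lev_inj : lev (p * 'X^l) v = lev (q * 'X^k) v.
  by rewrite !levM !levXn -pk -ql mulrAC.
move/(congr1 (fun r => lev r v^-1)); rewrite !levM !levXn => E.
have cancel (y : laurent) j : y * v^-1 ^+ j * v ^+ j = y.
  by rewrite -mulrA -exprMn Vv expr1n mulr1.
have /= := congr1 (fun y => y * v ^+ k * v ^+ l) E.
by rewrite (cancel (lev q _)) mulrAC (cancel (lev p _)) => ->.
Qed.

Lemma lbarB : {morph lbar : x y / x - y}.
Proof.
move=> x y; have [[p k] /= xE] := laurentP x; have [[q l] /= yE] := laurentP y.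
have := @lbarE (x - y) (p * 'X^l - q * 'X^k) (k + l)%N.
rewrite (lbarE xE) (lbarE yE) !levB !levM !levXn -xE -yE => -> //; last first.
  by rewrite exprD; ring.
rewrite exprD.
transitivity (lev p v^-1 * v ^+ k * (v^-1 * v) ^+ l - lev q v^-1 * v ^+ l * (v^-1 * v) ^+ k).
  by rewrite !exprMn; ring.
by rewrite Vv !expr1n !mulr1.
Qed.

Lemma lbarM : {morph lbar : x y / x * y}.
Proof.
move=> x y; have [[p k] /= xE] := laurentP x; have [[q l] /= yE] := laurentP y.
rewrite (lbarE xE) (lbarE yE) (@lbarE (x * y) (p * q) (k + l)%N).
  by rewrite levM exprD; ring.
by rewrite levM -xE -yE exprD; ring.
Qed.

Lemma lbar1 : lbar 1 = 1.
Proof. by rewrite (@lbarE 1 1 0) ?lev1 ?expr0 ?mulr1. Qed.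

HB.instance Definition _ := GRing.isZmodMorphism.Build laurent laurent lbar lbarB.
HB.instance Definition _ := GRing.isMonoidMorphism.Build laurent laurent lbar (lbar1, lbarM).

Lemma lbar_v : lbar v = v^-1.
Proof.
by rewrite (@lbarE v 'X 0) ?levX ?expr0 ?mulr1.
Qed.

Lemma lbar_vV : lbar v^-1 = v.
Proof.
have E : lbar v^-1 * v^-1 = 1 by rewrite -[X in _ * X]lbar_v -lbarM Vv lbar1.
by rewrite -[LHS]mulr1 -Vv mulrA E mul1r.
Qed.

Lemma lbar_lev p a : lbar (lev p a) = lev p (lbar a).
Proof.
elim/poly_ind: p => [|p c IH]; first by rewrite !lev0 rmorph0.
by rewrite !lev_cons rmorphD rmorphM /= IH rmorph_int.
Qed.

Lemma lbarK : involutive lbar.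
Proof.
move=> x; have [[p k] /= xE] := laurentP x.
rewrite (lbarE xE) lbarM lbar_lev rmorphXn /= lbar_v lbar_vV -xE.
by rewrite -mulrA -exprMn vV expr1n mulr1.
Qed.

Definition vpoly (a : laurent) := exists p, a = v * lev p v.

Lemma levE (p : {poly int}) a n : (size p <= n)%N -> lev p a = \sum_(i < n) (p`_i)%:~R * a ^+ i.
Proof.
move=> pn; rewrite /lev (@horner_coef_wide _ n).
  by apply: eq_bigr => i _; rewrite coef_map.
exact: leq_trans (size_poly _ _) pn.
Qed.

Lemma lev_sum (I : Type) (r : seq I) (F : I -> {poly int}) a :
  lev (\sum_(i <- r) F i) a = \sum_(i <- r) lev (F i) a.
Proof.
by apply: (big_morph (lev^~ a) (fun p q => levD p q a)); rewrite lev0.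
Qed.

(* If [a = v p(v)] equals [v^-1 p(v^-1)], then clearing denominators equates
   X^(n+1) p with a polynomial of size at most [n], where [n] is the size of [p]. *)
Lemma lbar_vpoly a : vpoly a -> lbar a = a -> a = 0.
Proof.
case=> p ->; rewrite lbarM lbar_v lbar_lev lbar_v => E.
case: (eqVneq p 0) => [->|p0]; first by rewrite lev0 mulr0.
set n := size p; pose r := \sum_(i < n) (p`_i)%:P * 'X^(n.-1 - i).
have n0 : (0 < n)%N by rewrite size_poly_gt0.
have : 'X^(n.+1) * p = r.
  apply: lev_inj; rewrite levM levXn exprSr -mulrA -E /r lev_sum.
  rewrite (levE _ (leqnn _)) !mulr_sumr; apply: eq_bigr => i _.
  rewrite levM levC levXn; set k := (n.-1 - i)%N.
  have -> : v ^+ n = v ^+ k * v ^+ i.+1.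
    by rewrite -exprD /k addnS subnK ?prednK // -ltnS prednK.
  transitivity ((p`_i)%:~R * v ^+ k * (v * v^-1) ^+ i.+1).
    rewrite exprMn !exprS; move: (v^-1) (v ^+ k) (v ^+ i) => V x y; ring.
  by rewrite vV expr1n mulr1.
move/(congr1 (fun q : {poly int} => size q)) => /= sE.
have : (size r <= n)%N.
  apply: leq_trans (size_sum _ _ _) _; apply/bigmax_leqP => i _.
  apply: leq_trans (size_mul_leq _ _) _; rewrite size_polyXn.
  have := size_polyC_leq1 p`_i; case: size => [|[|//]] _ /=; rewrite ?add0n ?add1n /=.
    by rewrite (leq_trans (leq_subr _ _)) ?leq_pred.
  by rewrite -[X in (_ < X)%N](prednK n0) ltnS leq_subr.
by rewrite -sE mulrC size_mulXn // addSn ltnNge leq_addl.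
Qed.

Lemma vpolyB a b : vpoly a -> vpoly b -> vpoly (a - b).
Proof. by case=> p -> [q ->]; exists (p - q); rewrite levB mulrBr. Qed.

Lemma vpoly0 : vpoly 0.
Proof. by exists 0; rewrite lev0 mulr0. Qed.

(** * The bar involution of the Hecke algebra *)

Local Notation hv := (hecke v).

Definition Hinv i : hv := Hgen v i + (v - v^-1)%:A.

Lemma Hgen_inv i : Hgen v i * Hinv i = 1.
Proof.
rewrite mulrDr Hgen_quad -scalerAr mulr1 addrAC -scalerDl.
by rewrite addrC [X in X *: _](_ : _ = 0) ?scale0r ?addr0 //; ring.
Qed.

Lemma Hinv_gen i : Hinv i * Hgen v i = 1.
Proof.
rewrite mulrDl Hgen_quad -scalerAl mul1r addrAC -scalerDl.
by rewrite addrC [X in X *: _](_ : _ = 0) ?scale0r ?addr0 //; ring.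
Qed.

Lemma Hinv_quad i : Hinv i * Hinv i = (v - v^-1) *: Hinv i + 1.
Proof.
rewrite {2}/Hinv mulrDr Hinv_gen -scalerAr mulr1 addrC //.
Qed.

Lemma Hinv_braid i j : i != j -> Hinv i * Hinv j * Hinv i = Hinv j * Hinv i * Hinv j.
Proof.
move=> ij.
have inv k l : (Hinv k * Hinv l * Hinv k) * (Hgen v k * Hgen v l * Hgen v k) = 1.
  rewrite -!mulrA (mulrA (Hinv k) (Hgen v k)) Hinv_gen mul1r.
  by rewrite (mulrA (Hinv l)) Hinv_gen mul1r Hinv_gen.
have inv' k l : (Hgen v k * Hgen v l * Hgen v k) * (Hinv k * Hinv l * Hinv k) = 1.
  rewrite -!mulrA (mulrA (Hgen v k) (Hinv k)) Hgen_inv mul1r.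
  by rewrite (mulrA (Hgen v l)) Hgen_inv mul1r Hgen_inv.
rewrite -[LHS]mulr1 -(inv' j i) mulrA -(Hgen_braid v ij).
by rewrite (inv i j) mul1r.
Qed.

Definition bar_scalar (c : laurent) : hv := (lbar c)%:A.

Lemma bar_scalarB : {morph bar_scalar : x y / x - y}.
Proof. by move=> x y; rewrite /bar_scalar rmorphB scalerBl. Qed.
Lemma bar_scalarM : {morph bar_scalar : x y / x * y}.
Proof. by move=> x y; rewrite /bar_scalar rmorphM -scalerAl mul1r scalerA. Qed.
Lemma bar_scalar1 : bar_scalar 1 = 1.
Proof. by rewrite /bar_scalar rmorph1 scale1r. Qed.

HB.instance Definition _ := GRing.isZmodMorphism.Build laurent hv bar_scalar bar_scalarB.
HB.instance Definition _ :=
  GRing.isMonoidMorphism.Build laurent hv bar_scalar (bar_scalar1, bar_scalarM).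

Definition bar_mon (m : {fmonom 'Z_3}) : hv := \prod_(i <- m) Hinv i.

Lemma bar_mon_morph : mmorphism bar_mon.
Proof. by split=> [m m'|]; rewrite /bar_mon ?fmM ?big_cat // fm1 big_nil. Qed.
HB.instance Definition _ :=
  monalg.isMultiplicative.Build {fmonom 'Z_3} hv bar_mon bar_mon_morph.

Definition bar_free (a : free_alg laurent) : hv := mmap bar_scalar bar_mon a.

Lemma bar_scalarZ c (h : hv) : bar_scalar c * h = lbar c *: h.
Proof. by rewrite /bar_scalar -scalerAl mul1r. Qed.

Lemma bar_freeB a b : bar_free (a - b) = bar_free a - bar_free b.
Proof. exact: mmapB. Qed.
Lemma bar_freeD a b : bar_free (a + b) = bar_free a + bar_free b.
Proof. exact: mmapD. Qed.
Lemma bar_freeM a b : bar_free (a * b) = bar_free a * bar_free b.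
Proof.
apply: (fst (commr_mmap_is_multiplicative _)) => g m m'.
by rewrite /GRing.comm bar_scalarZ /bar_scalar -scalerAr mulr1.
Qed.

Lemma bar_free1 : bar_free 1 = 1.
Proof. exact: mmap1. Qed.
Lemma bar_freeZ c a : bar_free (c *: a) = lbar c *: bar_free a.
Proof. by rewrite /bar_free mmapZ bar_scalarZ. Qed.
Lemma bar_free_gen i : bar_free (free_gen _ i) = Hinv i.
Proof.
by rewrite /bar_free /free_gen unlock mmapU /= bar_scalar1 mul1r /bar_mon fmU big_seq1.
Qed.

Lemma bar_ideal a : hecke_ideal v a -> bar_free a = 0.
Proof.
elim=> {a} [i|i j ij||a b _ a0 _ b0|a b _ b0|a b _ a0].
- rewrite bar_freeB bar_freeM bar_freeD bar_freeZ bar_free1 bar_free_gen.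
  by rewrite Hinv_quad lbarB lbar_v lbar_vV subrr.
- have M3 k l : bar_free (free_gen _ k * free_gen _ l * free_gen _ k) = Hinv k * Hinv l * Hinv k.
    by rewrite bar_freeM (bar_freeM (free_gen _ k)) !bar_free_gen.
  rewrite bar_freeB; apply/eqP; rewrite subr_eq0; apply/eqP.
  exact: etrans (M3 i j) (etrans (Hinv_braid ij) (esym (M3 j i))).
- exact: mmap0.
- by rewrite bar_freeD a0 b0 addr0.
- by rewrite bar_freeM b0 mulr0.
- by rewrite bar_freeM a0 mul0r.
Qed.

Definition bar (h : hv) : hv := bar_free (repr h).

Lemma bar_of_free a : bar (of_free v a) = bar_free a.
Proof.
by apply/eqP; rewrite -subr_eq0 -bar_freeB; apply/eqP/bar_ideal/hecke_repr.
Qed.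

Lemma barB : {morph bar : x y / x - y}.
Proof.
move=> x y; rewrite -[x]of_free_repr -[y]of_free_repr -scaleN1r -of_freeZ -of_freeD.
by rewrite scaleN1r !bar_of_free bar_freeB.
Qed.

Lemma barM : {morph bar : x y / x * y}.
Proof.
move=> x y; rewrite -[x]of_free_repr -[y]of_free_repr -of_freeM.
by rewrite !bar_of_free bar_freeM.
Qed.

Lemma bar1 : bar 1 = 1.
Proof. by rewrite bar_of_free bar_free1. Qed.

HB.instance Definition _ := GRing.isZmodMorphism.Build hv hv bar barB.
HB.instance Definition _ := GRing.isMonoidMorphism.Build hv hv bar (bar1, barM).

Lemma barZ c h : bar (c *: h) = lbar c *: bar h.
Proof. by rewrite -[h]of_free_repr -of_freeZ !bar_of_free bar_freeZ. Qed.

Lemma bar_Hgen i : bar (Hgen v i) = Hinv i.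
Proof. by rewrite bar_of_free bar_free_gen. Qed.

Lemma bar_Hinv i : bar (Hinv i) = Hgen v i.
Proof.
rewrite rmorphD /= bar_Hgen barZ lbarB lbar_v lbar_vV rmorph1 /Hinv -addrA -scalerDl.
by rewrite [X in X *: _](_ : _ = 0) ?scale0r ?addr0 //; ring.
Qed.

Lemma hecke_ind (P : hv -> Prop) : P 0 -> (forall g h, P g -> P h -> P (g + h)) ->
  (forall c h, P h -> P (c *: h)) -> P 1 -> (forall i h, P h -> P (Hgen v i * h)) ->
  forall h, P h.
Proof.
move=> P0 PD PZ P1 PM h; have [s ->] := hecke_span_word h.
elim: s => [|p s IH]; rewrite ?big_nil // big_cons; apply: PD => //; apply: PZ.
by elim: p.2 => [|i u IHu]; rewrite ?big_nil // big_cons; exact: PM.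
Qed.

Lemma barK : involutive bar.
Proof.
elim/hecke_ind => [|g h IHg IHh|c h IH||i h IH].
- by rewrite !rmorph0.
- by rewrite !rmorphD /= IHg IHh.
- by rewrite !barZ lbarK IH.
- by rewrite !rmorph1.
- by rewrite !rmorphM /= IH bar_Hgen bar_Hinv.
Qed.

Lemma bar_is_bar : is_bar (bar : {rmorphism hv -> hv}).
Proof.
split; [exact: barK | by rewrite /= barZ lbar_v bar1 | move=> x].
have [u uE su] := len_word x.
have -> : x^-1%g = of_word (rev u) by rewrite of_word_rev uE.
rewrite -uE !H_word ?uE ?of_word_rev ?size_rev ?uE ?lenV // rmorph_prod /=.
rewrite (eq_bigr (fun i => Hinv i)); last by move=> i _; rewrite bar_Hgen.
elim: u {uE su} => [|i u [IH1 IH2]]; first by rewrite !big_nil mulr1.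
rewrite rev_cons -cats1 big_cat big_seq1 !big_cons /=; split.
  by rewrite -mulrA (mulrA _ _ (Hgen v i)) IH1 mul1r Hinv_gen.
by rewrite -mulrA (mulrA (Hgen v i)) Hgen_inv mul1r IH2.
Qed.

Section IsBar.
Context (f : {rmorphism hv -> hv}) (fbar : is_bar f).

Lemma is_bar_vV : f v^-1%:A = v%:A.
Proof. by case: fbar => fK fv _; rewrite -fv; exact: fK. Qed.

(** [is_bar] prescribes only the image of [v]; the ring morphism laws extend it to polynomials and,
    after clearing denominators, to all scalars. *)
Lemma is_bar_scalar c : f c%:A = (lbar c)%:A.
Proof.
have fM a b : f (a * b)%:A = f a%:A * f b%:A.
  by rewrite -rmorphM -scalerAl mul1r scalerA.
have fD a b : f (a + b)%:A = f a%:A + f b%:A by rewrite scalerDl rmorphD.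
have fint (n : int) : f (n%:~R)%:A = (n%:~R)%:A by rewrite scaler_int rmorphMz rmorph1.
have fv : f v%:A = v^-1%:A by case: fbar.
have [[p k] /= cE] := laurentP c.
have -> : c = lev p v * v^-1 ^+ k by rewrite -cE -mulrA -exprMn vV expr1n mulr1.
have fVX : f (v^-1 ^+ k)%:A = (v ^+ k)%:A.
  elim: {cE} k => [|k IH]; first by rewrite !expr0 scale1r rmorph1.
  by rewrite !exprS fM is_bar_vV IH -scalerAl mul1r scalerA.
have flev : f (lev p v)%:A = (lev p v^-1)%:A.
  elim/poly_ind: p {cE} => [|p n IH]; first by rewrite !lev0 scale0r rmorph0.
  by rewrite !lev_cons fD fM fint IH fv -scalerAl mul1r scalerA -scalerDl.
rewrite lbarM lbar_lev lbar_v rmorphXn /= lbar_vV fM flev fVX.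
by rewrite -scalerAl mul1r scalerA.
Qed.

Lemma is_bar_gen i : f (Hgen v i) = Hinv i.
Proof.
case: fbar => _ _ fH; have [] := fH (gen i); rewrite genV H_gen => fHi _.
by rewrite -[LHS]mulr1 -(Hgen_inv i) mulrA fHi mul1r.
Qed.

Lemma is_bar_unique : f =1 bar.
Proof.
elim/hecke_ind => [|g h IHg IHh|c h IH||i h IH].
- by rewrite !rmorph0.
- by rewrite !rmorphD /= IHg IHh.
- have -> : c *: h = c%:A * h by rewrite -scalerAl mul1r.
  by rewrite rmorphM barM barZ bar1 is_bar_scalar IH.
- by rewrite !rmorph1.
- by rewrite !rmorphM /= IH bar_Hgen is_bar_gen.
Qed.

End IsBar.

(** By uniqueness, the quantifier over involutions can be replaced by the one constructed above. *)
Lemma bar_invariantP C : bar_invariant C <-> bar C = C.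
Proof.
split=> [[f [fb fC]]|bC]; first by rewrite -(is_bar_unique fb).
by exists bar; split=> //; exact: bar_is_bar.
Qed.

(** * Uniqueness of the Kazhdan-Lusztig basis *)

Section Uniqueness.
Local Open Scope classical_set_scope.
Local Open Scope ring_scope.

(** Each [Hinv i] is [Hgen v i] plus a scalar, so the product differs from the standard one by
    contributions of proper subwords, which are too short to reach [x]. *)
Lemma coef_Hinv_word u x : (size u <= len x)%N ->
  coef (\prod_(i <- u) Hinv i) x = delta _ (of_word u) x.
Proof.
elim: u x => [|i u IH] x ux; first by rewrite big_nil coef1.
rewrite big_cons mulrDl coefD coef_genM -scalerAl mul1r coefZ /lact.
have xu : (size u < len x)%N by [].
have -> : coef (\prod_(j <- u) Hinv j) x = 0.
  rewrite IH; last exact: ltnW.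
  rewrite /delta; case: eqVneq => [xE|_]; last reflexivity.
  by move: xu; rewrite xE ltnNge len_le.
rewrite !mulr0 !addr0 IH.
  rewrite /delta of_word_cons; congr (GRing.natmul _ (nat_of_bool _)).
  by apply/eqP/eqP => [<-|->]; rewrite genK.
rewrite len_genM; case: linv; last exact: ltnW (ltnW _).
by rewrite -ltnS (ltn_predK xu).
Qed.

Lemma coef_barH y x : (len y <= len x)%N -> coef (bar (H v y)) x = delta _ y x.
Proof.
move=> yx; have [u uE su] := len_word y.
rewrite -{1}uE H_word ?uE // rmorph_prod /= (eq_bigr (fun i => Hinv i)).
  by rewrite coef_Hinv_word ?uE ?su.
by move=> i _; rewrite bar_Hgen.
Qed.

(** [bar] is unitriangular for the length. A coefficient above which all others vanish is therefore
    fixed by [lbar], and [lbar_vpoly] kills it. *)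
Lemma bar_vpoly_eq0 C : bar C = C -> (forall x, vpoly (coef C x)) -> C = 0.
Proof.
move=> bC vC; have [s us sC] := hecke_support C.
pose K := \max_(y <- s) len y.
(* Descending induction on the length: [k] bounds how far [x] lies below the maximal length [K] of
   the support. *)
suff c0 k x : (K < len x + k)%N -> coef C x = 0.
  by apply: coef_inj => x; rewrite coef0; apply: (c0 K.+1); rewrite addnS ltnS leq_addl.
elim: k x => [|k IH] x Kx; have [xs|xs] := boolP (x \in s); last 1 first.
- by apply/eqP; apply: contraNT xs; exact: sC.
- by move: Kx; rewrite addn0 ltnNge /K (big_rem x) //= leq_maxl.
- by apply/eqP; apply: contraNT xs; exact: sC.
have barE : coef (bar C) x = \sum_(y <- s) lbar (coef C y) * coef (bar (H v y)) x.
  rewrite {1}(hecke_coefE us sC) rmorph_sum coef_sum; apply: eq_bigr => y _ /=.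
  by rewrite barZ coefZ.
apply: lbar_vpoly; first exact: vC.
rewrite -[in RHS]bC barE (bigD1_seq x xs us) /= coef_barH // /delta eqxx mulr1.
rewrite big1 ?addr0 // => y yx; have [le|lt] := leqP (len y) (len x).
  by rewrite coef_barH // /delta eq_sym (negPf yx) mulr0.
rewrite IH ?rmorph0 ?mul0r //; apply: leq_trans Kx _.
by rewrite addnS -addSn leq_add2r.
Qed.

Lemma is_KL_coefP w (C : hv) : is_KL w C <->
  [/\ bar C = C, coef C w = 1, forall x, x <> w -> vpoly (coef C x)
    & forall x, coef C x != 0 -> bruhat x w].
Proof.
pose S := [set x | bruhat x w /\ x <> w].
have fS : finite_set S by apply: sub_finite_set (finite_bruhat w) => x [].
split=> [[/bar_invariantP bC [p CE]]|[bC Cw Cx Cb]].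
  have CxE x : coef C x = (x == w)%:R + `[< S x >]%:R * (v * lev (p x) v).
    by rewrite CE coefD coefH coef_fsbig.
  split=> // [|x xw|x].
  - by rewrite CxE eqxx asboolF ?mul0r ?addr0 // => -[].
  - rewrite CxE (negPf (introN eqP xw)) add0r; case: asboolP => _.
      by rewrite mul1r; exists (p x).
    by rewrite mul0r; exact: vpoly0.
  rewrite CxE; case: (eqVneq x w) => [-> _|_]; first exact: bruhat_refl.
  by rewrite add0r; case: asboolP => [[]|]; rewrite // mul0r eqxx.
split; first exact/bar_invariantP.
have pE x : exists p, x <> w -> coef C x = v * lev p v.
  have [->|/eqP xw] := eqVneq x w; first by exists 0.
  by have [p ->] := Cx _ xw; exists p.
pose p x := sval (cid (pE x)); exists p; apply: coef_inj => x.
rewrite coefD coefH coef_fsbig // /delta.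
case: (eqVneq x w) => [->|/eqP xw]; first by rewrite asboolF ?mul0r ?addr0 // => -[].
have px : coef C x = v * lev (p x) v := svalP (cid (pE x)) xw.
rewrite add0r; case: asboolP => [_|nS]; first by rewrite mul1r px.
rewrite mul0r; apply/eqP; apply: contra_notT nS => c0; split=> //; exact: Cb.
Qed.

Lemma KL_unique w (C : hv) : is_KL w C -> KL v w = C.
Proof.
move=> CK; rewrite /KL; case: xgetP => [D _ DK|/(_ C)//].
case/is_KL_coefP: CK => bC Cw Cx _; case/is_KL_coefP: DK => bD Dw Dx _.
apply/eqP; rewrite -subr_eq0; apply/eqP/bar_vpoly_eq0 => [|x].
  by rewrite rmorphB /= bC bD.
rewrite coefB; have [->|/eqP xw] := eqVneq x w.
  by rewrite Cw Dw subrr; exact: vpoly0.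
by apply: vpolyB; [exact: Dx | exact: Cx].
Qed.
End Uniqueness.

(** * The action on the vertices of the alcoves *)

(* Triples of integers with sum 0, congruent modulo 3: three times the
   coordinates of a weight of type A_2. *)
Definition pt := (int * int * int)%type.

(** The reflections in the walls of the fundamental alcove: the two simple roots at level 0 and, for
    [i = 0], the highest root at level 1, which after scaling by three is the line a - c = 3. *)
Definition pt_act (i : 'Z_3) (u : pt) : pt :=
  let: (a, b, c) := u in
  if i == 0 then (c + 3, b, a - 3) else if i == 1 then (b, a, c) else (a, c, b).

Definition vert1 (i : 'Z_3) : pt :=
  if i == 0 then (0, 0, 0) else if i == 1 then (2, -1, -1) else (1, 1, -2).

Definition word_act (u : word) (x : pt) : pt := foldr pt_act x u.

Ltac pt_lia := congr (_, _, _); lia.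

Lemma word_act_cong u u' : cox_cong u u' -> word_act u =1 word_act u'.
Proof.
elim=> {u u'} //.
- by move=> u u' _ E x; rewrite E.
- by move=> u u' x _ E _ E' y; rewrite E E'.
- move=> u u' x x' _ E _ E' y; rewrite /word_act !foldr_cat.
  by rewrite -/(word_act _ _) -/(word_act x y) E' E.
- move=> i [[a b] c]; elim/Z3_ind: i => /=; pt_lia.
- move=> i j + [[a b] c]; elim/Z3_ind: i; elim/Z3_ind: j => //= _; pt_lia.
Qed.

(* The vertex of type [i] of the alcove [w] A_0, where A_0 has the vertices
   [vert1 0], [vert1 1] and [vert1 2]. *)
Definition vert (i : 'Z_3) (w : W) : pt := word_act (repr w) (vert1 i).

Lemma vert_word i u : vert i (of_word u) = word_act u (vert1 i).
Proof. exact/word_act_cong/cox_repr. Qed.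

Lemma vert_one i : vert i 1%g = vert1 i.
Proof. by rewrite -of_word_nil vert_word. Qed.

Lemma vert_genM i j w : vert i (gen j * w)%g = pt_act j (vert i w).
Proof. by rewrite -(of_word_repr w) -of_word_cons !vert_word. Qed.

(* The reflection of [u] in the line through [p] and [q], in an equilateral
   triangle. *)
Definition flip (u p q : pt) : pt :=
  (p.1.1 + q.1.1 - u.1.1, p.1.2 + q.1.2 - u.1.2, p.2 + q.2 - u.2).

Lemma pt_act_flip i u p q :
  pt_act i (flip u p q) = flip (pt_act i u) (pt_act i p) (pt_act i q).
Proof.
case: u p q => [[a b] c] [[d e] f] [[g h] k]; rewrite /flip.
elim/Z3_ind: i => /=; pt_lia.
Qed.

(** Right multiplication by [gen j] crosses the wall opposite to the vertex of type [j], so only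
    that vertex moves. *)
Lemma vert_mulgen i j w : vert i (w * gen j)%g =
  if i == j then flip (vert i w) (vert (i + 1) w) (vert (i + 1 + 1) w) else vert i w.
Proof.
elim/W_ind: w => [|k w IH]; last first.
  rewrite -mulgA !vert_genM IH; case: eqP => // _; exact: pt_act_flip.
rewrite mul1g -[gen j]mulg1 vert_genM !vert_one.
by elim/Z3_ind: i; elim/Z3_ind: j.
Qed.

(** The orbit of (3 w_1, 3 w_2) under the finite Weyl group: the possible displacements from a
    vertex of type [i] to those of types [i + 1] and [i + 1 + 1], the same list for each [i]. *)
Definition triangles : seq (pt * pt) :=
  [:: ((2, -1, -1), (1, 1, -2)); ((2, -1, -1), (1, -2, 1)); ((-1, 2, -1), (1, 1, -2));
      ((-1, 2, -1), (-2, 1, 1)); ((-1, -1, 2), (1, -2, 1)); ((-1, -1, 2), (-2, 1, 1))].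

Definition padd (u e : pt) : pt := (u.1.1 + e.1.1, u.1.2 + e.1.2, u.2 + e.2).

Definition pt_lin (i : 'Z_3) (u : pt) : pt :=
  let: (a, b, c) := u in
  if i == 0 then (c, b, a) else if i == 1 then (b, a, c) else (a, c, b).

Lemma pt_act_add i u e : pt_act i (padd u e) = padd (pt_act i u) (pt_lin i e).
Proof.
case: u e => [[a b] c] [[d e] f]; rewrite /padd; elim/Z3_ind: i => /=; pt_lia.
Qed.

Lemma pt_lin_triangles i e : e \in triangles -> (pt_lin i e.1, pt_lin i e.2) \in triangles.
Proof. by move: e; apply/allP; elim/Z3_ind: i. Qed.

Definition weight (k x y : int) : pt := (3 * x - k, 3 * y - k, 2 * k - 3 * x - 3 * y).

Lemma vert_alcove i w : exists x y, vert i w = weight (i : nat) x y /\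
  exists2 e, e \in triangles &
    vert (i + 1) w = padd (vert i w) e.1 /\ vert (i + 1 + 1) w = padd (vert i w) e.2.
Proof.
elim/W_ind: w => [|j w [x [y [uE [e te [pE qE]]]]]].
  rewrite !vert_one; elim/Z3_ind: i.
  - exists 0, 0; split=> //.
    by exists ((2, -1, -1), (1, 1, -2)).
  - exists 1, 0; split=> //.
    by exists ((-1, 2, -1), (-2, 1, 1)).
  - exists 1, 1; split=> //.
    by exists ((-1, -1, 2), (1, -2, 1)).
rewrite !vert_genM pE qE !pt_act_add uE.
have [x' [y' ->]] : exists x' y', pt_act j (weight (i : nat) x y) = weight (i : nat) x' y'.
  rewrite /weight; move: ((i : nat) : int) => k; elim/Z3_ind: j => /=.
  - by exists (k - x - y + 1), y; pt_lia.
  - by exists y, x; pt_lia.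
  - by exists x, (k - x - y); pt_lia.
exists x', y'; split=> //.
by exists (pt_lin j e.1, pt_lin j e.2); first exact: pt_lin_triangles.
Qed.

(* The right descent set of [theta m n] consists of the [gen i] with [i] other
   than [vtype m n], so its lower interval is described by vertices of this type. *)
Definition vtype (m n : nat) : 'Z_3 := (2 * m + n)%:R.

Lemma vtype_val m n : exists t : int, ((vtype m n : nat) : int) = 2 * m%:Z + n%:Z - 3 * t.
Proof.
exists ((2 * m + n) %/ 3)%N; rewrite /vtype.
have -> : ((2 * m + n)%:R : 'Z_3) = ((2 * m + n) %% 3)%N :> nat by rewrite val_Zp_nat.
lia.
Qed.

(** Case analysis on this predicate replaces the three vertices at once by linear expressions. The
    offset m + 2n is the upper bound in [hex], to which the coordinates of a vertex of type
    [vtype m n] are congruent modulo 3. *)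
Inductive alcove (m n : nat) : pt -> pt -> pt -> Prop :=
  Alcove x y e of e \in triangles :
    let u := (m%:Z + 2 * n%:Z + 3 * x, m%:Z + 2 * n%:Z + 3 * y,
              - 2 * (m%:Z + 2 * n%:Z) - 3 * x - 3 * y) in
    alcove m n u (padd u e.1) (padd u e.2).

Lemma alcoveP m n w : alcove m n
  (vert (vtype m n) w) (vert (vtype m n + 1) w) (vert (vtype m n + 1 + 1) w).
Proof.
have [x [y [-> [e te [-> ->]]]]] := vert_alcove (vtype m n) w.
have [t ->] := vtype_val m n.
have := Alcove m n (x - m%:Z - n%:Z + t) (y - m%:Z - n%:Z + t) te.
congr (alcove _ _ _ (padd _ _) (padd _ _)); rewrite /weight; pt_lia.
Qed.

(* The convex hull of the orbit of the weight n w_1 + m w_2 under the finite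
   Weyl group, where w_1 and w_2 are the fundamental weights. *)
Definition hex (m n : int) (u : pt) : bool :=
  let: (a, b, c) := u in
  [&& 0 <= m, 0 <= n, - (2 * m + n) <= a, a <= m + 2 * n,
   - (2 * m + n) <= b, b <= m + 2 * n, - (2 * m + n) <= c & c <= m + 2 * n].

(** The rotation of the fundamental alcove that raises the type of each vertex by one; it induces
    [rho]. *)
Definition rot (u : pt) : pt := let: (a, b, c) := u in (c + 2, a - 1, b - 1).

Lemma vert_rho i w : vert (i + 1) (rho w) = rot (vert i w).
Proof.
elim/W_ind: w => [|j w IH].
  have -> : rho 1%g = 1%g by rewrite -of_word_nil rho_word.
  by rewrite !vert_one; elim/Z3_ind: i.
have -> : rho (gen j * w)%g = (gen (j + 1) * rho w)%g.
  by rewrite rhoM {1}/gen rho_word.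
rewrite !vert_genM IH; case: (vert i w) => [[a b] c].
elim/Z3_ind: j => /=; pt_lia.
Qed.

(** * Unions and intersections of hexagons, as linear arithmetic in six orientations *)

Ltac hex_lia m n w :=
  case: (alcoveP m n w) => x y e; rewrite !inE;
  do 5?case/orP; let E := fresh "E" in (move/eqP=> E; rewrite ?E /hex /=; clear E; lia).

Section HexFacts.
Variables (m n : nat) (w : W).
Local Notation u := (vert (vtype m n) w).
Local Notation p := (vert (vtype m n + 1) w).
Local Notation q := (vert (vtype m n + 1 + 1) w).
Local Notation d := (flip u p q).
Local Notation A := (hex m n).
Local Notation A' := (hex (m%:Z - 1) (n%:Z - 1)).
Local Notation E1 := (hex m (n%:Z - 1)).
Local Notation E2 := (hex (m%:Z - 1) n).
Local Notation B1 u := (hex m (n%:Z - 1) (rot (rot u))).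
Local Notation B2 u := (hex (m%:Z - 1) n (rot u)).
Local Notation s0 := (pt_act 0).

Lemma hex_I0 : A u && A (s0 u) = B1 u || B2 u.
Proof. hex_lia m n w. Qed.

Lemma hex_B12 : B1 u && B2 u = A' u || A' (s0 u).
Proof. hex_lia m n w. Qed.

(** Excludes that one of two adjacent alcoves lies only in the first hexagon and the other only in
    the second: the configuration in which [cross_expand] would fail. *)
Lemma hex_B12_cross : B1 u -> B2 d -> B2 u || B1 d.
Proof. hex_lia m n w. Qed.

Lemma hex_B21_cross : B1 d -> B2 u -> B2 d || B1 u.
Proof. hex_lia m n w. Qed.

Lemma hex_Is : A u && A d = E1 q || E2 p.
Proof. hex_lia m n w. Qed.

Lemma hex_E12 : E1 q && E2 p = A' u || A' d.
Proof. hex_lia m n w. Qed.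

Lemma hex_E12_cross : E1 q -> E2 (s0 p) -> E2 p || E1 (s0 q).
Proof. hex_lia m n w. Qed.

Lemma hex_E21_cross : E1 (s0 q) -> E2 p -> E2 (s0 p) || E1 q.
Proof. hex_lia m n w. Qed.

(** Inside the hexagon with both indices positive, a mixed intersection is already contained in an
    unmixed one, so it adds nothing to the index set of [M]. *)
Lemma hex_A_cross : (0 < m)%N -> (0 < n)%N -> A u -> A (s0 d) -> A d || A (s0 u).
Proof. hex_lia m n w. Qed.

Lemma hex_A_cross' : (0 < m)%N -> (0 < n)%N -> A d -> A (s0 u) -> A u || A (s0 d).
Proof. hex_lia m n w. Qed.

(** When an index is 0 the mixed intersections do contribute: they account for the third hexagon,
    the source of the second index of [M] in the boundary cases. *)
Lemma hex_MMl_n0 : n = 0%N -> (0 < m)%N ->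
  (A u || A (s0 u)) && (A d || A (s0 d)) = [|| E2 p, E2 (s0 p) | E2 (rot (rot q))].
Proof. by move=> n0; rewrite n0 => m0; hex_lia m 0%N w. Qed.

Lemma hex_MMr_n0 : n = 0%N -> (0 < m)%N ->
  (A u || A d) && (A (s0 u) || A (s0 d)) = [|| B2 u, B2 d | E2 (rot (rot q))].
Proof. hex_lia m n w. Qed.

Lemma hex_MMl_m0 : m = 0%N -> (0 < n)%N ->
  (A u || A (s0 u)) && (A d || A (s0 d)) = [|| E1 q, E1 (s0 q) | E1 (rot p)].
Proof. hex_lia m n w. Qed.

Lemma hex_MMr_m0 : m = 0%N -> (0 < n)%N ->
  (A u || A d) && (A (s0 u) || A (s0 d)) = [|| B1 u, B1 d | E1 (rot p)].
Proof. hex_lia m n w. Qed.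

(* The three neighbours of [q] (respectively [p]) of the same type as [u] are
   [u], [d] and [flip u (flip p q u) q] (respectively [flip u p (flip q u p)]). *)
Local Notation u1 := (flip u (flip p q u) q).
Local Notation u2 := (flip u p (flip q u p)).

Lemma hex_q_some : [|| A u, A d | A u1] = hex (m%:Z + 1) n q.
Proof. hex_lia m n w. Qed.

Lemma hex_q_two : [|| A u && A d, A u && A u1 | A d && A u1] =
  hex (m%:Z - 1) (n%:Z + 1) q || (m == 0%N) && hex 0 (n%:Z - 1) q.
Proof. hex_lia m n w. Qed.

Lemma hex_q_all : [&& A u, A d & A u1] =
  hex m (n%:Z - 1) q || (n == 0%N) && hex (m%:Z - 2) 0 q.
Proof. hex_lia m n w. Qed.

Lemma hex_p_some : [|| A u, A d | A u2] = hex m (n%:Z + 1) p.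
Proof. hex_lia m n w. Qed.

Lemma hex_p_two : m = 0%N -> [|| A u && A d, A u && A u2 | A d && A u2] = hex 1 (n%:Z - 1) p.
Proof. hex_lia m n w. Qed.

Lemma hex_p_all : m = 0%N -> [&& A u, A d & A u2] = hex 0 (n%:Z - 2) p.
Proof. hex_lia m n w. Qed.

End HexFacts.

(** * The stabilizer of the origin *)

Section OriginStabilizer.
Local Open Scope group_scope.

Variant parabolic : W -> Prop :=
| Para0 : parabolic 1 | Para1 : parabolic g1 | Para2 : parabolic g2
| Para12 : parabolic (g1 * g2) | Para21 : parabolic (g2 * g1)
| Para121 : parabolic (g1 * (g2 * g1)).

Lemma parabolic_g1 f : parabolic f -> parabolic (g1 * f).
Proof.
by case; rewrite ?mulg1 ?gen_sq ?genK; constructor.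
Qed.

Lemma parabolic_g2 f : parabolic f -> parabolic (g2 * f).
Proof.
case; rewrite ?mulg1 ?gen_sq ?genK; try by constructor.
  by rewrite -gen_braid //; constructor.
by rewrite gen_braid // !genK; constructor.
Qed.

(* The translations by (3, 0, -3) and (0, 3, -3). *)
Definition tr1 : W := g0 * (g1 * (g2 * g1)).
Definition tr2 : W := g1 * (g0 * (g1 * g2)).

Lemma conj_tr1_g1 : tr1 ^ g1 = tr2.
Proof. by rewrite conj_gen /tr1 /tr2 -!mulgA gen_sq mulg1. Qed.

Lemma conj_tr2_g1 : tr2 ^ g1 = tr1.
Proof. by rewrite conj_gen /tr1 /tr2 -!mulgA genK. Qed.

Lemma conj_tr2_g2 : tr2 ^ g2 = tr2^-1.
Proof. by rewrite conj_gen /tr2 !invMg !genV -!mulgA gen_sq mulg1. Qed.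

Lemma tr_commute : commute tr1 tr2.
Proof.
rewrite /commute /tr1 /tr2 -!mulgA genK.
rewrite [RHS](gen_braidM (i := 1%R) (j := 0%R)) // (gen_braid (i := 1%R) (j := (1 + 1)%R)) //.
by rewrite (gen_braidM (i := 0%R) (j := (1 + 1)%R) (g2 * _)) // genK.
Qed.

Lemma conj_tr1_g2 : tr1 ^ g2 = tr1 * tr2^-1.
Proof.
apply: (canRL (mulgK _)); rewrite conj_gen /tr1 /tr2 -!mulgA.
rewrite (gen_braidM (i := 1%R) (j := (1 + 1)%R)) // !genK.
rewrite (gen_braidM (i := (1 + 1)%R) (j := 0%R)) // genK.
by rewrite gen_braid.
Qed.

(** The general translation, with the integer exponents a - c and b - e kept as pairs of natural
    numbers. *)
Definition tr (a b c e : nat) : W := tr1 ^+ a * tr2 ^+ b * (tr1 ^+ c * tr2 ^+ e)^-1.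

Lemma tr_commuteX a b : commute (tr1 ^+ a) (tr2 ^+ b).
Proof. exact/commuteX/commute_sym/commuteX/commute_sym/tr_commute. Qed.

Lemma tr_g1 a b c e : tr a b c e ^ g1 = tr b a e c.
Proof.
rewrite /tr conjMg conjVg !conjMg !conjXg conj_tr1_g1 conj_tr2_g1.
by rewrite -!tr_commuteX.
Qed.

Lemma tr_g2 a b c e : tr a b c e ^ g2 = tr a (c + e) c (a + b).
Proof.
rewrite /tr conjMg conjVg !conjMg !conjXg conj_tr1_g2 conj_tr2_g2.
have cV : commute tr1 tr2^-1 by exact/commuteV/tr_commute.
rewrite !(expgMn _ cV) !expVgn !invMg !invgK !mulgA; congr (_ * _).
rewrite -!mulgA; congr (_ * _).
have -> : tr2 ^- a * (tr2 ^- b * (tr2 ^+ e * tr2 ^+ c)) = tr2 ^- (a + b) * tr2 ^+ (c + e).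
  by rewrite !mulgA -invMg -!expgnDr addnC -mulgA -expgnDr addnC [(e + c)%N]addnC.
by apply/esym/commuteV/commuteX2.
Qed.

Lemma tr_tr1 a b c e : tr1 * tr a b c e = tr a.+1 b c e.
Proof. by rewrite /tr !mulgA -expgS. Qed.

Lemma g1_tr a b c e f : g1 * (tr a b c e * f) = tr b a e c * (g1 * f).
Proof. by rewrite -tr_g1 conj_gen -!mulgA genK. Qed.

Lemma g2_tr a b c e f : g2 * (tr a b c e * f) = tr a (c + e) c (a + b) * (g2 * f).
Proof. by rewrite -tr_g2 conj_gen -!mulgA genK. Qed.

Lemma W_tr_parabolic w : exists a b c e f, parabolic f /\ w = tr a b c e * f.
Proof.
elim/W_ind: w => [|i w [a [b [c [e [f [pf ->]]]]]]].
  by exists 0%N, 0%N, 0%N, 0%N, 1; split; [constructor | rewrite /tr !expg0 invMg !invg1 !mulg1].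
elim/Z3_ind: i.
- exists (e + c).+1, b, (b + a)%N, e, (g1 * (g2 * (g1 * f))).
  split; first exact/parabolic_g1/parabolic_g2/parabolic_g1.
  (* [g0] is the translation [tr1] times the finite reflection [g1 * (g2 * g1)]. *)
  have <- : tr1 * (g1 * (g2 * (g1 * (tr a b c e * f)))) =
            tr (e + c).+1 b (b + a) e * (g1 * (g2 * (g1 * f))).
    by rewrite g1_tr g2_tr g1_tr mulgA tr_tr1.
  by rewrite /tr1 -!mulgA !genK.
- exists b, a, e, c, (g1 * f); split; first exact: parabolic_g1.
  exact: g1_tr.
- exists a, (c + e)%N, c, (a + b)%N, (g2 * f); split; first exact: parabolic_g2.
  exact: g2_tr.
Qed.

Lemma vert0_parabolic f : parabolic f -> vert 0 f = (0, 0, 0)%R.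
Proof.
by case; rewrite /gen -?of_wordM ?vert_one ?vert_word.
Qed.

Lemma pt_act_tr1 a b c w : vert 0 w = (a, b, c) -> vert 0 (tr1 * w) = (a + 3, b, c - 3)%R.
Proof. by move=> wE; rewrite /tr1 -!mulgA !vert_genM wE. Qed.

Lemma pt_act_tr2 a b c w : vert 0 w = (a, b, c) -> vert 0 (tr2 * w) = (a, b + 3, c - 3)%R.
Proof. by move=> wE; rewrite /tr2 -!mulgA !vert_genM wE. Qed.

Lemma vert_tr1X k a b c w : vert 0 w = (a, b, c) ->
  vert 0 (tr1 ^+ k * w) = (a + 3 * k%:Z, b, c - 3 * k%:Z)%R.
Proof.
move=> wE; elim: k => [|k IH]; first by rewrite expg0 mul1g wE; pt_lia.
by rewrite expgS -mulgA (pt_act_tr1 IH); pt_lia.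
Qed.

Lemma vert_tr2X k a b c w : vert 0 w = (a, b, c) ->
  vert 0 (tr2 ^+ k * w) = (a, b + 3 * k%:Z, c - 3 * k%:Z)%R.
Proof.
move=> wE; elim: k => [|k IH]; first by rewrite expg0 mul1g wE; pt_lia.
by rewrite expgS -mulgA (pt_act_tr2 IH); pt_lia.
Qed.

Lemma tr_cancel a b c e : tr1 ^+ c * tr2 ^+ e * tr a b c e = tr1 ^+ a * tr2 ^+ b.
Proof.
rewrite /tr [LHS]mulgA; apply: (canLR (mulgK _)).
have [c1 c2] : commute (tr1 ^+ c * tr2 ^+ e) (tr1 ^+ a) /\
               commute (tr1 ^+ c * tr2 ^+ e) (tr2 ^+ b).
  split; apply/commute_sym/commuteM; rewrite ?[commute (tr2 ^+ _) (tr1 ^+ _)]commute_sym;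
  by [exact: commuteX2 | exact: tr_commuteX | exact/commute_sym/tr_commuteX].
exact: commuteM.
Qed.

(** A finite part fixes the origin, so the translation part must be trivial. This is the converse
    inclusion in the base case: the hexagon of theta(0,0) is the origin alone. *)
Lemma stabilizer_origin w : vert 0 w = (0, 0, 0)%R -> parabolic w.
Proof.
have [a [b [c [e [f [pf ->]]]]]] := W_tr_parabolic w => E.
suff [-> ->] : a = c /\ b = e by rewrite /tr mulgV mul1g.
(* Moving the negative translations to the other side leaves only powers with natural exponents,
   whose effect on coordinates is known. *)
have := vert_tr1X c (vert_tr2X e E).
rewrite (mulgA (tr2 ^+ e)) (mulgA (tr1 ^+ c)) (mulgA (tr1 ^+ c)) tr_cancel.
rewrite -(mulgA (tr1 ^+ a)) (vert_tr1X a (vert_tr2X b (vert0_parabolic pf))).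
by move=> [] *; lia.
Qed.
End OriginStabilizer.

(** * Lower intervals of the elements theta(m,n) *)

Section LowerSets.
Local Open Scope group_scope.

Lemma Z3_intr_eq (k l t : int) : (k = l + 3 * t)%R -> (k%:~R = l%:~R :> 'Z_3)%R.
Proof.
move=> ->; rewrite rmorphD rmorphM /=.
have -> : (3%:~R = 0 :> 'Z_3)%R by apply/val_inj.
by rewrite mul0r addr0.
Qed.

Lemma vtype_intr m n : vtype m n = ((2 * m + n)%N : int)%:~R%R.
Proof. by []. Qed.

Lemma vtype_intr1 m n : (vtype m n + 1 = ((2 * m + n)%N%:Z + 1)%:~R)%R.
Proof. by rewrite vtype_intr intrD. Qed.

Lemma vtype_intr2 m n : (vtype m n + 1 + 1 = ((2 * m + n)%N%:Z + 2)%:~R)%R.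
Proof. by rewrite vtype_intr intrD -addrA; congr (_ + _)%R; apply/val_inj. Qed.

Lemma theta00 : theta 0 0 = g1 * (g2 * g1).
Proof.
rewrite /theta muln0 big_nat_recl // big_nat1 big_nat1 /s_ mulgA.
by congr (gen _ * gen _ * gen _); apply/val_inj.
Qed.

Lemma thetaSn m n : theta m n.+1 =
  theta m n * gen (vtype m n) * gen (vtype m n + 1 + 1)%R.
Proof.
rewrite /theta mulnS add2n [X in _ * X]big_nat_recr // [X in _ * (X * _)]big_nat_recr //= !mulgA.
congr (_ * _ * gen _ * gen _).
  by rewrite vtype_intr; apply: (@Z3_intr_eq _ _ (- n%:Z)%R); lia.
by rewrite vtype_intr2; apply: (@Z3_intr_eq _ _ (- n%:Z - 1)%R); lia.
Qed.

Lemma thetaS0 m : theta m.+1 0 =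
  theta m 0 * gen (vtype m 0) * gen (vtype m 0 + 1)%R.
Proof.
rewrite /theta muln0 !big_nat1 mulnS (_ : (2 + 2 * m + 2)%N = (2 * m + 2).+2); last lia.
rewrite big_nat_recr // big_nat_recr //= -!mulgA; congr (_ * _).
set s := vtype m 0.
have -> : s_ (2 * m + 2).+1%:Z = gen s.
  rewrite /s /s_ vtype_intr; congr gen; apply: (@Z3_intr_eq _ _ 1%R) ; lia.
have -> : s_ (2 * m + 2).+2%:Z = gen (s + 1)%R.
  rewrite /s /s_ vtype_intr1; congr gen.
  by apply: (@Z3_intr_eq _ _ 1%R) ; lia.
have -> : s_ ((2 + 2 * m + 1)%:Z - 0%:Z)%R = gen s.
  rewrite /s /s_ vtype_intr; congr gen; apply: (@Z3_intr_eq _ _ 1%R) ; lia.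
have -> : s_ ((2 * m + 1)%:Z - 0%:Z)%R = gen (s + 1)%R.
  rewrite /s /s_ vtype_intr1; congr gen.
  by apply: (@Z3_intr_eq _ _ 0%R) ; lia.
(* The new turning point differs from the old word by one braid move on its last three letters. *)
by rewrite gen_braid // eq_sym -subr_eq0 addrC addKr.
Qed.

Lemma vtypeSn m n : vtype m n.+1 = (vtype m n + 1)%R.
Proof. by rewrite /vtype addnS mulrSr. Qed.

Lemma vtypeSm m n : vtype m.+1 n = (vtype m n + 1 + 1)%R.
Proof. by rewrite /vtype mulnS -addnA addSn add1n !mulrSr. Qed.

Lemma Z3_neq (i : 'Z_3) : ((i + 1 == i) = false) * ((i == i + 1) = false) *
  ((i + 1 + 1 == i) = false) * ((i == i + 1 + 1) = false) *
  ((i + 1 + 1 == i + 1) = false) * ((i + 1 == i + 1 + 1) = false) *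
  ((i + 1 + 1 + 1)%R = i).
Proof. by elim/Z3_ind: i; do !split=> //; apply/val_inj. Qed.

Lemma vert_gen0 i w : vert i (w * gen i) = flip (vert i w) (vert (i + 1) w) (vert (i + 1 + 1) w).
Proof. by rewrite vert_mulgen eqxx. Qed.

Lemma vert_gen1 i w : vert (i + 1) (w * gen (i + 1)%R) =
  flip (vert (i + 1) w) (vert (i + 1 + 1) w) (vert i w).
Proof. by rewrite vert_gen0 Z3_neq. Qed.

Lemma vert_gen2 i w : vert (i + 1 + 1) (w * gen (i + 1 + 1)%R) =
  flip (vert (i + 1 + 1) w) (vert i w) (vert (i + 1) w).
Proof. by rewrite vert_gen0 !Z3_neq. Qed.

Lemma vert_neq i j w : i == j = false -> vert i (w * gen j) = vert i w.
Proof. by rewrite vert_mulgen => ->. Qed.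

Definition theta_set (m n : nat) : pred W := fun w => hex m n (vert (vtype m n) w).

(** The alcove of theta(m,n) touches the hexagon at a corner, the lowest weight of the orbit, and
    its other two vertices lie outside. *)
Lemma theta_vert m n : [/\ vert (vtype m n) (theta m n)
    = (- (2 * m%:Z + n%:Z), m%:Z - n%:Z, m%:Z + 2 * n%:Z)%R,
  vert (vtype m n + 1) (theta m n)
    = (- (2 * m%:Z + n%:Z) - 1, m%:Z - n%:Z - 1, m%:Z + 2 * n%:Z + 2)%R &
  vert (vtype m n + 1 + 1) (theta m n)
    = (- (2 * m%:Z + n%:Z) - 2, m%:Z - n%:Z + 1, m%:Z + 2 * n%:Z + 1)%R].
Proof.
elim: n => [|n [uE pE qE]].
  elim: m => [|m [uE pE qE]].
    rewrite theta00 -[g1 * (g2 * g1)]mulg1 -!mulgA !vert_genM !vert_one.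
    by split; apply/eqP.
  rewrite thetaS0 vtypeSm Z3_neq; set s := vtype m 0 in uE pE qE *; split.
  - by rewrite !vert_neq ?Z3_neq // qE; pt_lia.
  - rewrite [LHS]vert_neq ?Z3_neq // vert_gen0 uE pE qE /flip /=; pt_lia.
  - rewrite vert_gen1 vert_gen0 !vert_neq ?Z3_neq // uE pE qE /flip /=; pt_lia.
rewrite thetaSn vtypeSn; set s := vtype m n in uE pE qE *; rewrite Z3_neq; split.
- by rewrite !vert_neq ?Z3_neq // pE; pt_lia.
- rewrite vert_gen2 vert_gen0 !vert_neq ?Z3_neq // uE pE qE /flip /=; pt_lia.
- rewrite [LHS]vert_neq ?Z3_neq // vert_gen0 uE pE qE /flip /=; pt_lia.
Qed.

Definition lower_set (A : pred W) (x : W) := forall z, bruhat z x <-> A z.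

(** Non-membership of [x * gen i] certifies the ascent, so the same geometric test yields both the
    new interval and the length. *)
Lemma lower_set_mulgen (A : pred W) x i : lower_set A x -> ~~ A (x * gen i) ->
  ~~ rinv x (gen i) /\ lower_set (fun z => A z || A (z * gen i)) (x * gen i).
Proof.
move=> Ax xi; have nxi : ~~ rinv x (gen i).
  by apply: contra xi => xi; apply/Ax/bruhat_mulgen_lt.
split=> // z; rewrite bruhat_mulgenE // !Ax.
by split=> [[]->|/orP//]; rewrite ?orbT.
Qed.

Lemma lower_set_genM (A : pred W) x i : lower_set A x -> ~~ A (gen i * x) ->
  ~~ linv (gen i) x /\ lower_set (fun z => A z || A (gen i * z)) (gen i * x).
Proof.
move=> Ax xi; have nxi : ~~ linv (gen i) x.
  apply: contra xi => xi; apply/Ax; rewrite -{2}(genK i x).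
  by apply: bruhat_stepl; [exact: reflection_gen | rewrite linv_genMl xi].
split=> // z; rewrite bruhat_genME // !Ax.
by split=> [[]->|/orP//]; rewrite ?orbT.
Qed.

Lemma eq_lower_set (A B : pred W) x : A =1 B -> lower_set A x -> lower_set B x.
Proof. by move=> AB Ax z; rewrite -AB. Qed.

Lemma lower_set_lower_closed A x : lower_set A x -> lower_closed A.
Proof. by move=> Ax y z yz /Ax zx; apply/Ax/(bruhat_trans yz). Qed.

Lemma bruhat1 z : bruhat z 1 -> z = 1.
Proof. by move/bruhat_len; rewrite len1 leqn0 => /eqP/len0. Qed.

Lemma len_mulgenS x i : ~~ rinv x (gen i) -> len (x * gen i) = (len x).+1.
Proof. by rewrite len_mulgen => /negPf->. Qed.

Lemma len_genMS x i : ~~ linv (gen i) x -> len (gen i * x) = (len x).+1.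
Proof. by rewrite len_genM => /negPf->. Qed.

Lemma hex00 u : hex 0 0 u -> u = (0, 0, 0)%R.
Proof. case: u => [[a b] c]; rewrite /hex => H; pt_lia. Qed.

Lemma theta00_lower : lower_set (theta_set 0 0) (theta 0 0) /\ len (theta 0 0) = 3.
Proof.
have r1 : ~~ rinv 1 g1 by rewrite /rinv invg1 linv1.
have r2 : ~~ rinv (1 * g1) g2 by rewrite mul1g rinv_gen (inj_eq gen_inj).
have r3 : ~~ rinv (1 * g1 * g2) g1.
  by rewrite mul1g rinvM rinv_gen (inj_eq gen_inj) /= rinv_gen genV conj_gen_neq.
have -> : theta 0 0 = 1 * g1 * g2 * g1 by rewrite theta00 mul1g !mulgA.
split; last by rewrite !len_mulgenS // len1.
have b1 z : bruhat z 1 <-> z = 1 by split=> [/bruhat1|->]; last exact: bruhat_refl.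
have v0 z i : i != 0%R -> vert 0 (z * gen i) = vert 0 z.
  by move=> i0; apply: vert_neq; apply/negbTE; rewrite eq_sym.
move=> z; split.
  rewrite !bruhat_mulgenE // !b1 => H.
  have -> : theta_set 0 0 z = hex 0 0 (vert 0 z) by [].
  suff -> : vert 0 z = vert 0 1 by rewrite vert_one.
  by do 3?case: H => H; rewrite -H ?v0.
move=> /hex00/stabilizer_origin pz; rewrite !bruhat_mulgenE // !b1.
case: pz; rewrite ?mul1g -?mulgA ?gen_sq ?mulg1 ?genK ?gen_sq ?mulg1; tauto.
Qed.

Lemma theta_setMs m n z : theta_set m n (z * gen (vtype m n)) =
  hex m n (flip (vert (vtype m n) z) (vert (vtype m n + 1) z) (vert (vtype m n + 1 + 1) z)).
Proof. by rewrite /theta_set vert_gen0. Qed.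

Lemma theta_set_inv m n z i : i != vtype m n -> theta_set m n (z * gen i) = theta_set m n z.
Proof. by move=> ni; rewrite /theta_set vert_neq // eq_sym; apply/negbTE. Qed.

Lemma theta_setMqs m n z : theta_set m n (z * gen (vtype m n + 1 + 1)%R * gen (vtype m n)) =
  hex m n (flip (vert (vtype m n) z) (vert (vtype m n + 1) z)
    (flip (vert (vtype m n + 1 + 1) z) (vert (vtype m n) z) (vert (vtype m n + 1) z))).
Proof. by rewrite theta_setMs vert_gen2 !vert_neq ?Z3_neq. Qed.

Lemma theta_setMps m n z : theta_set m n (z * gen (vtype m n + 1)%R * gen (vtype m n)) =
  hex m n (flip (vert (vtype m n) z)
    (flip (vert (vtype m n + 1) z) (vert (vtype m n + 1 + 1) z) (vert (vtype m n) z))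
    (vert (vtype m n + 1 + 1) z)).
Proof. by rewrite theta_setMs vert_gen1 !vert_neq ?Z3_neq. Qed.

Lemma theta_s_notin m n : ~~ theta_set m n (theta m n * gen (vtype m n)).
Proof.
have [uE pE qE] := theta_vert m n; rewrite theta_setMs uE pE qE /flip /hex /=; lia.
Qed.

Lemma theta_setSn m n z : theta_set m n.+1 z =
  [|| theta_set m n z, theta_set m n (z * gen (vtype m n))
    | theta_set m n (z * gen (vtype m n + 1 + 1)%R * gen (vtype m n))].
Proof.
rewrite theta_setMs theta_setMqs /theta_set hex_p_some vtypeSn.
by congr (hex _ _ _); lia.
Qed.

Lemma theta_setSm m n z : theta_set m.+1 n z =
  [|| theta_set m n z, theta_set m n (z * gen (vtype m n))
    | theta_set m n (z * gen (vtype m n + 1)%R * gen (vtype m n))].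
Proof.
rewrite theta_setMs theta_setMps /theta_set hex_q_some vtypeSm.
by congr (hex _ _ _); lia.
Qed.

(** Raising an index appends two letters, and the interval grows to the alcoves having one of the
    three neighbouring vertices in the old hexagon; [hex_p_some] and [hex_q_some] identify these
    with the new hexagon. *)
Lemma theta_lower m n :
  lower_set (theta_set m n) (theta m n) /\ len (theta m n) = (2 * m + 2 * n + 3)%N.
Proof.
elim: n => [|n [Ln ln]].
  elim: m => [|m [Lm lm]]; first exact: theta00_lower.
  have [r1 L1] := lower_set_mulgen Lm (theta_s_notin m 0).
  have [uE pE qE] := theta_vert m 0.
  have [|r2 L2] := lower_set_mulgen (i := (vtype m 0 + 1)%R) L1.
    rewrite theta_set_inv ?Z3_neq // (negPf (theta_s_notin m 0)) /= theta_setMps.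
    rewrite vert_gen0 !vert_neq ?Z3_neq // uE pE qE /flip /hex /=; lia.
  split; last by rewrite thetaS0 !len_mulgenS // lm; lia.
  rewrite thetaS0; apply: eq_lower_set L2 => z.
  by rewrite theta_setSm (theta_set_inv z (i := (vtype m 0 + 1)%R)) ?Z3_neq //; do 3!case: theta_set.
have [r1 L1] := lower_set_mulgen Ln (theta_s_notin m n).
have [uE pE qE] := theta_vert m n.
have [|r2 L2] := lower_set_mulgen (i := (vtype m n + 1 + 1)%R) L1.
  rewrite theta_set_inv ?Z3_neq // (negPf (theta_s_notin m n)) /= theta_setMqs.
  rewrite vert_gen0 !vert_neq ?Z3_neq // uE pE qE /flip /hex /=; lia.
split; last by rewrite thetaSn !len_mulgenS // ln; lia.
rewrite thetaSn; apply: eq_lower_set L2 => z.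
by rewrite theta_setSn (theta_set_inv z (i := (vtype m n + 1 + 1)%R)) ?Z3_neq //; do 3!case: theta_set.
Qed.

Lemma s_mnE m n : s_mn m n = gen (vtype m n).
Proof.
have [L _] := theta_lower m n.
have [r _] := lower_set_mulgen L (theta_s_notin m n).
rewrite /s_mn; case: pickP => [i /=|/(_ (vtype m n))]; last first.
  by rewrite gt_rinv ?r //; exact: reflection_gen.
have [-> //|ni] := eqVneq i (vtype m n).
have /L/bruhat_len : theta_set m n (theta m n * gen i).
  by rewrite theta_set_inv //; apply/L/bruhat_refl.
by rewrite ltnNge => ->.
Qed.
End LowerSets.

(** * Sums over lower sets and multiplication by C_s *)

Section LowerSums.
Local Open Scope classical_set_scope.
Local Open Scope ring_scope.
Context (A : comUnitRingType) (v : A) (vU : v \is a GRing.unit).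
Local Notation hv := (hecke v).
Local Notation fn := (W -> A).

(* The coefficient function of [\sum_(w in S) v^(- len w) H w]. *)
Definition fbr (S : pred W) : fn := fun w => (S w)%:R * v^-1 ^+ len w.

Lemma eq_fbr (S S' : pred W) : S =1 S' -> fbr S =1 fbr S'.
Proof. by move=> SS w; rewrite /fbr SS. Qed.

Definition Cgen i : hv := Hgen v i + v%:A.

Definition Rc i (f : fn) : fn :=
  fun w => f (w * gen i)%g + (if rinv w (gen i) then v^-1 else v) * f w.
Definition Lc i (f : fn) : fn :=
  fun w => f (gen i * w)%g + (if linv (gen i) w then v^-1 else v) * f w.

Lemma coef_mulCgen h i : coef (h * Cgen i) =1 Rc i (coef h).
Proof.
move=> w; rewrite /Cgen mulrDr coefD coef_mulgen -scalerAr mulr1 coefZ /ract /Rc.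
by case: rinv => /=; ring.
Qed.

Lemma coef_CgenM h i : coef (Cgen i * h) =1 Lc i (coef h).
Proof.
move=> w; rewrite /Cgen mulrDl coefD coef_genM -scalerAl mul1r coefZ /lact /Lc.
by case: linv => /=; ring.
Qed.

Lemma eq_Rc i (f g : fn) : f =1 g -> Rc i f =1 Rc i g.
Proof. by move=> fg w; rewrite /Rc !fg. Qed.

Lemma eq_Lc i (f g : fn) : f =1 g -> Lc i f =1 Lc i g.
Proof. by move=> fg w; rewrite /Lc !fg. Qed.

Lemma RcD i (f g : fn) w : Rc i (fun x => f x + g x) w = Rc i f w + Rc i g w.
Proof. by rewrite /Rc; ring. Qed.

Lemma LcD i (f g : fn) w : Lc i (fun x => f x + g x) w = Lc i f w + Lc i g w.
Proof. by rewrite /Lc; ring. Qed.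

Lemma RcZ i c (f : fn) w : Rc i (fun x => c * f x) w = c * Rc i f w.
Proof. by rewrite /Rc; ring. Qed.

Lemma LcZ i c (f : fn) w : Lc i (fun x => c * f x) w = c * Lc i f w.
Proof. by rewrite /Lc; ring. Qed.

Lemma vVK (x : A) : v * (v^-1 * x) = x.
Proof. by rewrite mulrA divrr // mul1r. Qed.

(** Checked on each pair [w], [w * gen i]: a lower closed set contains neither, only the shorter
    one, or both. *)
Lemma Rc_fbr i (S : pred W) w : lower_closed S ->
  Rc i (fbr S) w = v * fbr (fun z => S z || S (z * gen i)%g) w
                 + v^-1 * fbr (fun z => S z && S (z * gen i)%g) w.
Proof.
move=> lS; rewrite /Rc /fbr; have [wi|wi] := boolP (rinv w (gen i)).
  have := lower_closed_gen (i := i) lS (x := (w * gen i)%g).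
  rewrite rinv_mulgen mulgenK wi => /(_ isT).
  have -> : len w = (len (w * gen i)%g).+1.
    by rewrite -{1}(mulgenK i w) len_mulgenS // rinv_mulgen wi.
  rewrite exprS; case: (S w) => /= [->//|_]; first by rewrite !mul1r vVK.
  by case: (S _); rewrite /= ?mul1r ?mul0r ?mulr0 ?addr0 ?vVK.
have := lower_closed_gen lS wi.
rewrite len_mulgenS // exprS; case: (S w) => /=; last case: (S _) => [/(_ isT)//|_] /=;
  by rewrite addrC [_ * (v^-1 * _)]mulrCA.
Qed.

Lemma Lc_fbr i (S : pred W) w : lower_closed S ->
  Lc i (fbr S) w = v * fbr (fun z => S z || S (gen i * z)%g) w
                 + v^-1 * fbr (fun z => S z && S (gen i * z)%g) w.
Proof.
move=> /lower_closedV lS; have := Rc_fbr i (w^-1)%g lS.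
by rewrite /Rc /Lc /fbr /rinv !invMg !invgK genV !lenV -[len (_ * gen i)%g]lenV invMg invgK genV.
Qed.

Lemma Rc_Lc_fbr i j (S : pred W) w : lower_closed S ->
  let D := fun z => S z || S (gen j * z)%g in
  let K := fun z => S z && S (gen j * z)%g in
  Rc i (Lc j (fbr S)) w =
    v ^+ 2 * fbr (fun z => D z || D (z * gen i)%g) w
    + fbr (fun z => D z && D (z * gen i)%g) w
    + fbr (fun z => K z || K (z * gen i)%g) w
    + v^-1 ^+ 2 * fbr (fun z => K z && K (z * gen i)%g) w.
Proof.
move=> lS D K; rewrite (eq_Rc _ (fun x => Lc_fbr j x lS)) RcD !RcZ.
rewrite (Rc_fbr _ _ (lower_closedUl (i := j) lS)) (Rc_fbr _ _ (lower_closedIl (i := j) lS)).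
by rewrite -/D -/K !mulrDr vVK (mulrA v^-1 v) mulVr // mul1r; ring.
Qed.

Lemma Lc_Rc_fbr i j (S : pred W) w : lower_closed S ->
  let D := fun z => S z || S (z * gen i)%g in
  let K := fun z => S z && S (z * gen i)%g in
  Lc j (Rc i (fbr S)) w =
    v ^+ 2 * fbr (fun z => D z || D (gen j * z)%g) w
    + fbr (fun z => D z && D (gen j * z)%g) w
    + fbr (fun z => K z || K (gen j * z)%g) w
    + v^-1 ^+ 2 * fbr (fun z => K z && K (gen j * z)%g) w.
Proof.
move=> lS D K; rewrite (eq_Lc _ (fun x => Rc_fbr i x lS)) LcD !LcZ.
rewrite (Lc_fbr _ _ (lower_closedUr (i := i) lS)) (Lc_fbr _ _ (lower_closedIr (i := i) lS)).
by rewrite -/D -/K !mulrDr vVK (mulrA v^-1 v) mulVr // mul1r; ring.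
Qed.

Lemma Rc_Rc_fbr i j (S : pred W) w : lower_closed S ->
  let D := fun z => S z || S (z * gen i)%g in
  let K := fun z => S z && S (z * gen i)%g in
  Rc j (Rc i (fbr S)) w =
    v ^+ 2 * fbr (fun z => D z || D (z * gen j)%g) w
    + fbr (fun z => D z && D (z * gen j)%g) w
    + fbr (fun z => K z || K (z * gen j)%g) w
    + v^-1 ^+ 2 * fbr (fun z => K z && K (z * gen j)%g) w.
Proof.
move=> lS D K; rewrite (eq_Rc _ (fun x => Rc_fbr i x lS)) RcD !RcZ.
rewrite (Rc_fbr _ _ (lower_closedUr (i := i) lS)) (Rc_fbr _ _ (lower_closedIr (i := i) lS)).
by rewrite -/D -/K !mulrDr vVK (mulrA v^-1 v) mulVr // mul1r; ring.
Qed.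

Lemma coef_N (S : pred W) x w : lower_set S x -> coef (N v x) w = v ^+ len x * fbr S w.
Proof.
move=> Sx; rewrite /N coef_fsbig; last exact: finite_bruhat.
have -> : `[< [set z | bruhat z x] w >] = S w by apply/asboolP/idP => /Sx.
by rewrite /fbr exprzDr // -exprnN -exprVn -exprnP mulrCA.
Qed.

Lemma coef_M (S S' : pred W) x y w : lower_set S x -> lower_set S' y ->
  coef (M v x y) w = v ^+ len x * fbr (fun z => S z || S' z) w.
Proof.
move=> Sx Sy; rewrite /M coef_fsbig; last first.
  by rewrite (_ : [set w | _] = [set z | bruhat z x] `|` [set z | bruhat z y]) // finite_setU;
    split; exact: finite_bruhat.
have -> : `[< [set z | bruhat z x \/ bruhat z y] w >] = S w || S' w.
  by apply/asboolP/orP => /= -[/Sx|/Sy]; by [left | right].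
by rewrite /fbr exprzDr // -exprnN -exprVn -exprnP mulrCA.
Qed.
End LowerSums.

(** * The automorphism rho *)

Lemma rho_gen i : rho (gen i) = gen (i + 1).
Proof. by rewrite {1}/gen rho_word. Qed.

Lemma len_rho w : len (rho w) = len w.
Proof.
have le x : (len (rho x) <= len x)%N.
  by have [u <- <-] := len_word x; rewrite rho_word -(size_map (+%R^~ 1) u) len_le.
apply/eqP; rewrite eqn_leq le /= -{1}(rho3 w).
exact: leq_trans (le _) (le _).
Qed.

Lemma bruhat_rho x y : bruhat x y -> bruhat (rho x) (rho y).
Proof.
elim=> [{}x {}y [t [i [w ->]] [-> lt]]|{}x|{}x {}y z _ xy _ yz].
- apply: Relation_Operators.rt_step; exists (gen (i + 1) ^ rho w)%g.
    by exists (i + 1), (rho w).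
  split; last by rewrite !len_rho.
  have rhoV z : rho z^-1%g = ((rho z)^-1)%g.
    apply/(mulgI (rho z)); rewrite -rhoM !mulgV.
    by rewrite -of_word_nil rho_word.
  by rewrite rhoM !conjgE !rhoM rhoV rho_gen.
- exact: bruhat_refl.
- exact: bruhat_trans yz.
Qed.

Definition rhoX k (w : W) : W := iter k rho w.

Lemma rhoXD k l w : rhoX (k + l) w = rhoX k (rhoX l w).
Proof. by rewrite /rhoX iterD. Qed.

Lemma rhoX3 k w : rhoX (3 * k) w = w.
Proof. by rewrite mulnC; elim: k => // k IH; rewrite mulSn /rhoX iterD -/(rhoX _ w) IH /= rho3. Qed.

Lemma rhoXK k w : rhoX (2 * k) (rhoX k w) = w.
Proof. by rewrite -rhoXD -mulSnr rhoX3. Qed.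

Lemma rhoXK' k w : rhoX k (rhoX (2 * k) w) = w.
Proof. by rewrite -rhoXD -mulSn rhoX3. Qed.

Lemma len_rhoX k w : len (rhoX k w) = len w.
Proof. by elim: k => //= k IH; rewrite len_rho. Qed.

Lemma bruhat_rhoX k x y : bruhat x y -> bruhat (rhoX k x) (rhoX k y).
Proof. by move=> xy; elim: k => //= k; exact: bruhat_rho. Qed.

Lemma rhoX_mulgen k w i : rhoX k (w * gen i)%g = (rhoX k w * gen (i + k%:R))%g.
Proof.
elim: k => [|k IH]; first by rewrite addr0.
by rewrite /= -/(rhoX k _) IH rhoM rho_gen -addrA -mulrSr.
Qed.

Lemma natZ3 k : (3 * k)%:R = 0 :> 'Z_3.
Proof. by rewrite mulrnA (_ : 3%:R = 0 :> 'Z_3) ?mul0rn //; apply/val_inj. Qed.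

Lemma rhoX2_mulgen k w i :
  rhoX (2 * k) (w * gen (i + k%:R))%g = (rhoX (2 * k) w * gen i)%g.
Proof. by rewrite rhoX_mulgen -addrA -natrD -mulSn natZ3 addr0. Qed.

Lemma lower_set_rhoX k (S : pred W) x : lower_set S x ->
  lower_set (fun z => S (rhoX (2 * k) z)) (rhoX k x).
Proof.
move=> Sx z; split=> [/(bruhat_rhoX (2 * k))|/Sx/(bruhat_rhoX k)].
  by rewrite rhoXK => /Sx.
by rewrite rhoXK'.
Qed.

(* The image of [theta_set m n] under [rhoX k], whose inverse is [rhoX (2 * k)]. *)
Definition tset k m n : pred W := fun z => theta_set m n (rhoX (2 * k) z).

Lemma tset_lower k m n : lower_set (tset k m n) (rhoX k (theta m n)).
Proof. by apply: lower_set_rhoX; have [] := theta_lower m n. Qed.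

Lemma tset_lower_closed k m n : lower_closed (tset k m n).
Proof. exact: lower_set_lower_closed (tset_lower k m n). Qed.

Definition lth m n := (2 * m + 2 * n + 3)%N.

Lemma len_theta k m n : len (rhoX k (theta m n)) = lth m n.
Proof. by rewrite len_rhoX; have [] := theta_lower m n. Qed.

Lemma theta_set_pm m n z : theta_set m n z = hex m n (vert (vtype m.+1 n + 1) z).
Proof. by rewrite vtypeSm Z3_neq. Qed.

Lemma theta_set_qn m n z : theta_set m n z = hex m n (vert (vtype m n.+1 + 1 + 1) z).
Proof. by rewrite vtypeSn Z3_neq. Qed.

Lemma theta_set_qm m n z : theta_set m n.+1 z = hex m n.+1 (vert (vtype m.+1 n + 1 + 1) z).
Proof. by rewrite vtypeSm Z3_neq -vtypeSn. Qed.

Lemma hex_neg (a b : int) u : (a < 0) || (b < 0) -> hex a b u = false.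
Proof. by case: u => [[x y] z]; rewrite /hex; lia. Qed.

Lemma hex_eq (a b c e : int) u : a = c -> b = e -> hex a b u = hex c e u.
Proof. by move=> -> ->. Qed.

Lemma vtypeSS m n : vtype m.+1 n.+1 = vtype m n.
Proof. by rewrite vtypeSn vtypeSm Z3_neq. Qed.

(** * The elements [T(m,n)], shifted by [rho], and their recursions *)

Section Trace.
Context (A : comUnitRingType) (v : A) (vU : v \is a GRing.unit) (k : nat).
Local Notation hv := (hecke v).
Local Notation fn := (W -> A).
Local Notation fbr := (fbr v).

Fixpoint tf (m n : nat) (w : W) : A :=
  v ^+ lth m n * fbr (tset k m n) w
  + match m, n with m'.+1, n'.+1 => v ^+ 2 * tf m' n' w | _, _ => 0 end.

Fixpoint Tsum (m n : nat) : hv :=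
  N v (rhoX k (theta m n))
  + match m, n with m'.+1, n'.+1 => v ^+ 2 *: Tsum m' n' | _, _ => 0 end.

Lemma coef_Tsum m n : coef (Tsum m n) =1 tf m n.
Proof.
move=> w; elim: m n => [|m IH] [|n] /=;
  by rewrite coefD (coef_N vU _ (tset_lower k _ _)) len_theta ?coef0 ?coefZ ?IH.
Qed.

Lemma vX2 j : v ^+ j.+2 * v^-1 ^+ 2 = v ^+ j.
Proof. by rewrite -addn2 exprD -mulrA -exprMn divrr // expr1n mulr1. Qed.

Lemma vX2K j x : v ^+ j.+2 * (v^-1 ^+ 2 * x) = v ^+ j * x.
Proof. by rewrite mulrA vX2. Qed.

Definition Qop t s (f : fn) : fn := fun w => Rc v t (Rc v s f) w - f w.

Lemma eq_Qop t s f g : f =1 g -> Qop t s f =1 Qop t s g.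
Proof. by move=> fg w; rewrite /Qop fg (eq_Rc v _ (eq_Rc v _ fg)). Qed.

Lemma QopZ t s c (f : fn) w : Qop t s (fun x => c * f x) w = c * Qop t s f w.
Proof. by rewrite /Qop (eq_Rc v _ (RcZ v s c f)) RcZ mulrBr. Qed.

Lemma QopD t s (f g : fn) w : Qop t s (fun x => f x + g x) w = Qop t s f w + Qop t s g w.
Proof. by rewrite /Qop (eq_Rc v _ (RcD v s f g)) RcD opprD addrACA. Qed.

Lemma tf0n n w : tf 0 n w = v ^+ lth 0 n * fbr (tset k 0 n) w.
Proof. by rewrite /= addr0. Qed.

Lemma tfm0 m w : tf m 0 w = v ^+ lth m 0 * fbr (tset k m 0) w.
Proof. by case: m => [|m]; rewrite /= addr0. Qed.

Lemma tfSS m n w : tf m.+1 n.+1 w =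
  v ^+ lth m.+1 n.+1 * fbr (tset k m.+1 n.+1) w + v ^+ 2 * tf m n w.
Proof. by []. Qed.

(** The powers v^2, 1 and v^-2 select the alcoves with at least one, two or three of the relevant
    neighbours in the hexagon. The extra disjuncts at m = 0 and n = 0 replace hexagons that become
    empty; they supply the inner terms of the [T] on the right of the recursion. *)
Lemma Rc_q m n w :
  let s := vtype m n in let V2 := v^-1 ^+ 2 in
  Qop (s + 1 + k%:R) (s + k%:R) (fbr (tset k m n)) w =
  v ^+ 2 * fbr (tset k m.+1 n) w
  + fbr (fun z => let q := vert (s + 1 + 1) (rhoX (2 * k) z) in
       hex (m%:Z - 1) (n%:Z + 1) q || (m == 0%N) && hex 0 (n%:Z - 1) q) w
  + V2 * fbr (fun z => let q := vert (s + 1 + 1) (rhoX (2 * k) z) in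
       hex m (n%:Z - 1) q || (n == 0%N) && hex (m%:Z - 2) 0 q) w.
Proof.
move=> s V2; rewrite /Qop Rc_Rc_fbr //; last exact: tset_lower_closed.
rewrite /fbr /tset !rhoX2_mulgen theta_setSm; set z := rhoX _ w.
rewrite -/s -hex_q_two -hex_q_all -/(theta_set m n z) -theta_setMs -theta_setMps.
rewrite (theta_set_inv z (i := s + 1)) ?Z3_neq //.
set x := v^-1 ^+ len w; clearbody x.
by case: (theta_set m n z); case: (theta_set _ _ _); case: (theta_set _ _ _) => /=;
  rewrite /V2; ring.
Qed.

Lemma Rc_p m n w : m = 0%N ->
  let s := vtype m n in let V2 := v^-1 ^+ 2 in
  Qop (s + 1 + 1 + k%:R) (s + k%:R) (fbr (tset k m n)) w =
  v ^+ 2 * fbr (tset k m n.+1) w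
  + fbr (fun z => hex 1 (n%:Z - 1) (vert (s + 1) (rhoX (2 * k) z))) w
  + V2 * fbr (fun z => hex 0 (n%:Z - 2) (vert (s + 1) (rhoX (2 * k) z))) w.
Proof.
move=> m0 s V2; rewrite /Qop Rc_Rc_fbr //; last exact: tset_lower_closed.
rewrite /fbr /tset !rhoX2_mulgen theta_setSn; set z := rhoX _ w.
rewrite -/s -(hex_p_two _ _ m0) -(hex_p_all _ _ m0) -/(theta_set m n z).
rewrite -theta_setMs -theta_setMqs.
rewrite (theta_set_inv z (i := s + 1 + 1)) ?Z3_neq //.
set x := v^-1 ^+ len w; clearbody x.
by case: (theta_set m n z); case: (theta_set _ _ _); case: (theta_set _ _ _) => /=;
  rewrite /V2; ring.
Qed.

Lemma fbr0 (S : pred W) w : S w = false -> fbr S w = 0.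
Proof. by rewrite /fbr => ->; rewrite mul0r. Qed.

Lemma fbr_eq (S S' : pred W) w : S w = S' w -> fbr S w = fbr S' w.
Proof. by rewrite /fbr => ->. Qed.

Lemma tf_step_q m n w :
  Qop (vtype m n + 1 + k%:R) (vtype m n + k%:R) (tf m n) w =
  tf m.+1 n w + (if m is m'.+1 then tf m' n.+1 w else 0)
              + (if n is n'.+1 then tf m n' w else 0).
Proof.
elim: m n => [|m IH] [|n].
- rewrite (eq_Qop _ _ (tf0n 0)) QopZ Rc_q tfm0 !addr0.
  set S2 := (X in _ + fbr X w + _); set S3 := (X in _ + _ * fbr X w).
  rewrite (@fbr0 S2); last by rewrite /S2 /= !hex_neg.
  by rewrite mulr0 !addr0 mulrA -exprD; congr (v ^+ _ * _); rewrite /lth; lia.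
- rewrite (eq_Qop _ _ (tf0n n.+1)) QopZ Rc_q tfSS tf0n addr0.
  set S2 := (X in _ + fbr X w + _); set S3 := (X in _ + _ * fbr X w).
  have -> : fbr S2 w = fbr (tset k 0 n) w.
    apply: fbr_eq; rewrite /S2 /= hex_neg //= /tset theta_set_qn.
    by apply: hex_eq => //; lia.
  have -> : fbr S3 w = fbr (tset k 0 n) w.
    apply: fbr_eq; rewrite /S3 /= orbF /tset theta_set_qn.
    by apply: hex_eq => //; lia.
  have -> : lth 0 n.+1 = (lth 0 n).+2 by rewrite /lth; lia.
  have -> : lth 1 n.+1 = (lth 0 n).+4 by rewrite /lth; lia.
  by rewrite mulrDr vX2K !exprS; ring.
- rewrite (eq_Qop _ _ (tfm0 m.+1)) QopZ Rc_q tfm0 addr0.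
  set S2 := (X in _ + fbr X w + _); set S3 := (X in _ + _ * fbr X w).
  have -> : fbr S2 w = fbr (tset k m 1) w.
    apply: fbr_eq; rewrite /S2 /= /tset theta_set_qm.
    by rewrite orbF; apply: hex_eq => //; lia.
  have -> : lth m.+2 0 = (lth m.+1 0).+2 by rewrite /lth; lia.
  rewrite mulrDr; case: m IH @S2 @S3 => [|m] IH S2 S3.
    rewrite (@fbr0 S3); last by rewrite /S3 /= !hex_neg.
    by rewrite tf0n !mulr0 addr0 !exprS; ring.
  have -> : fbr S3 w = fbr (tset k m 0) w.
    apply: fbr_eq; rewrite /S3 /= hex_neg ?orbT //= /tset /theta_set vtypeSm vtypeSm !Z3_neq.
    by apply: hex_eq => //; lia.
  rewrite tfSS tfm0 (_ : lth m.+1 1 = (lth m 0).+4); last by rewrite /lth; lia.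
  rewrite (_ : lth m.+2 0 = (lth m 0).+4); last by rewrite /lth; lia.
  by rewrite vX2K !exprS; ring.
- rewrite (eq_Qop _ _ (tfSS m n)) QopD !QopZ Rc_q.
  set S2 := (X in _ + fbr X w + _); set S3 := (X in _ + _ * fbr X w).
  (* Lowering both indices preserves the type, so the inner part of [T] is multiplied by the same
     two factors. *)
  rewrite vtypeSS IH (tfSS m.+1).
  have -> : fbr S2 w = fbr (tset k m n.+2) w.
    apply: fbr_eq; rewrite /S2 /= /tset theta_set_qm.
    by rewrite orbF; apply: hex_eq => //; lia.
  have -> : fbr S3 w = fbr (tset k m.+1 n) w.
    apply: fbr_eq; rewrite /S3 /= orbF /tset theta_set_qn.
    by apply: hex_eq => //; lia.
  have -> : tf m.+1 n w = v ^+ lth m.+1 n * fbr (tset k m.+1 n) w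
      + v ^+ 2 * (if n is n'.+1 then tf m n' w else 0).
    by case: (n) => [|n']; rewrite ?mulr0 ?addr0 ?tfm0.
  have -> : tf m n.+2 w = v ^+ lth m n.+2 * fbr (tset k m n.+2) w
      + v ^+ 2 * (if m is m'.+1 then tf m' n.+1 w else 0).
    by case: (m) => [|m']; rewrite ?mulr0 ?addr0 ?tf0n.
  have -> : lth m.+2 n.+1 = (lth m.+1 n).+4 by rewrite /lth; lia.
  have -> : lth m n.+2 = (lth m.+1 n).+2 by rewrite /lth; lia.
  have -> : lth m.+1 n.+1 = (lth m.+1 n).+2 by rewrite /lth; lia.
  rewrite mulrDr vX2K; move: (lth m.+1 n) => l; rewrite !exprS.
  by move: (match n with 0 => _ | _ => _ end) (match m with 0 => _ | _ => _ end) => a b; ring.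
Qed.

Lemma tf_step_p n w :
  Qop (vtype 0 n + 1 + 1 + k%:R) (vtype 0 n + k%:R) (tf 0 n) w =
  tf 0 n.+1 w + (if n is n'.+1 then tf 1 n' w else 0).
Proof.
rewrite (eq_Qop _ _ (tf0n n)) QopZ Rc_p //.
set S2 := (X in _ + fbr X w + _); set S3 := (X in _ + _ * fbr X w).
rewrite tf0n mulrDr (_ : lth 0 n.+1 = (lth 0 n).+2); last by rewrite /lth; lia.
case: n @S2 @S3 => [|n] S2 S3.
  rewrite (@fbr0 S2); last by rewrite /S2 /= !hex_neg.
  by rewrite !mulr0 !addr0 mulrA -exprD addn2.
have -> : fbr S2 w = fbr (tset k 1 n) w.
  apply: fbr_eq; rewrite /S2 /tset /theta_set vtypeSm vtypeSn.
  by apply: hex_eq => //; lia.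
case: n @S2 @S3 => [|n] S2 S3.
  rewrite (@fbr0 S3); last by rewrite /S3 /= !hex_neg.
  by rewrite tfm0 !mulr0 addr0; move: (lth 0 1) (lth 1 0) (erefl : lth 0 1 = lth 1 0) => l _ <-;
    rewrite !exprS; ring.
have -> : fbr S3 w = fbr (tset k 0 n) w.
  apply: fbr_eq; rewrite /S3 /tset /theta_set !vtypeSn Z3_neq.
  by apply: hex_eq => //; lia.
rewrite tfSS tf0n (_ : lth 0 n.+2 = (lth 0 n).+4); last by rewrite /lth; lia.
rewrite (_ : lth 1 n.+1 = (lth 0 n).+4); last by rewrite /lth; lia.
by rewrite vX2K; move: (lth 0 n) => l; rewrite !exprS; ring.
Qed.

End Trace.

(** * The index sets occurring in C_0 T(m,n) C_s *)

Section Sets.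
Variables (m n : nat).
Local Notation s := (vtype m n).
Local Notation S := (theta_set m n).

(* [Dl], [Dr] and [Xset] are the lower intervals of [gen 0 * theta m n], of
   [theta m n * gen s] and of [gen 0 * theta m n * gen s].  [MMl] and [MMr] are the
   index sets of the elements [M] in the first and in the second formula. *)
Definition Dl : pred W := fun z => S z || S (gen 0 * z)%g.
Definition Dr : pred W := fun z => S z || S (z * gen s)%g.
Definition Xset : pred W := fun z => Dl z || Dl (z * gen s)%g.
Definition MMl : pred W := fun z => Dl z && Dl (z * gen s)%g.
Definition MMr : pred W := fun z => Dr z && Dr (gen 0 * z)%g.

(* The lower intervals of [rho (theta m n.-1)], [rho (rho (theta m.-1 n))],
   [theta m n.-1] and [theta m.-1 n]; they are empty when the index would be -1. *)
Definition B1 : pred W := fun z => hex m (n%:Z - 1) (rot (rot (vert s z))).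
Definition B2 : pred W := fun z => hex (m%:Z - 1) n (rot (vert s z)).
Definition E1 : pred W := fun z => hex m (n%:Z - 1) (vert (s + 1 + 1) z).
Definition E2 : pred W := fun z => hex (m%:Z - 1) n (vert (s + 1) z).

Definition Bjoin : pred W := fun z => B1 z && B2 z || B1 (z * gen s)%g && B2 (z * gen s)%g.
Definition Bmeet : pred W := fun z => B1 z && B2 z && (B1 (z * gen s)%g && B2 (z * gen s)%g).
Definition Ejoin : pred W := fun z => E1 z && E2 z || E1 (gen 0 * z)%g && E2 (gen 0 * z)%g.
Definition Emeet : pred W := fun z => E1 z && E2 z && (E1 (gen 0 * z)%g && E2 (gen 0 * z)%g).

Lemma Xset_r z : Xset z = Dr z || Dr (gen 0 * z)%g.
Proof. by rewrite /Xset /Dl /Dr !mulgA; do 4!case: (theta_set _ _ _). Qed.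

Lemma S_I0 z : S z && S (gen 0 * z)%g = B1 z || B2 z.
Proof. by rewrite /theta_set vert_genM hex_I0. Qed.

Lemma S_Is z : S z && S (z * gen s)%g = E1 z || E2 z.
Proof. by rewrite theta_setMs /theta_set hex_Is. Qed.

Lemma B12_cross z : B1 z -> B2 (z * gen s)%g -> B2 z || B1 (z * gen s)%g.
Proof. by rewrite /B1 /B2 vert_gen0; exact: hex_B12_cross. Qed.

Lemma B21_cross z : B1 (z * gen s)%g -> B2 z -> B2 (z * gen s)%g || B1 z.
Proof. by rewrite /B1 /B2 vert_gen0; exact: hex_B21_cross. Qed.

Lemma E12_cross z : E1 z -> E2 (gen 0 * z)%g -> E2 z || E1 (gen 0 * z)%g.
Proof. by rewrite /E1 /E2 !vert_genM; exact: hex_E12_cross. Qed.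

Lemma E21_cross z : E1 (gen 0 * z)%g -> E2 z -> E2 (gen 0 * z)%g || E1 z.
Proof. by rewrite /E1 /E2 !vert_genM; exact: hex_E21_cross. Qed.
End Sets.

Lemma B1_0 m z : B1 m 0 z = false. Proof. by rewrite /B1 hex_neg ?orbT. Qed.
Lemma B2_0 n z : B2 0 n z = false. Proof. by rewrite /B2 hex_neg. Qed.
Lemma E1_0 m z : E1 m 0 z = false. Proof. by rewrite /E1 hex_neg ?orbT. Qed.
Lemma E2_0 n z : E2 0 n z = false. Proof. by rewrite /E2 hex_neg. Qed.

Lemma B1_S m n z : B1 m n.+1 z = tset 1 m n z.
Proof.
rewrite /B1 /tset /theta_set /= -!vert_rho !vtypeSn Z3_neq.
by apply: hex_eq => //; lia.
Qed.

Lemma B2_S m n z : B2 m.+1 n z = tset 2 m n z.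
Proof.
rewrite /B2 /tset /theta_set /= -[X in vert _ (rho X)]/(rho (rho (rho z))) rho3.
by rewrite -!vert_rho !vtypeSm Z3_neq; apply: hex_eq => //; lia.
Qed.

Lemma E1_S m n z : E1 m n.+1 z = theta_set m n z.
Proof. by rewrite theta_set_qn; apply: hex_eq => //; lia. Qed.

Lemma E2_S m n z : E2 m.+1 n z = theta_set m n z.
Proof. by rewrite theta_set_pm; apply: hex_eq => //; lia. Qed.

Lemma hexSS m n u : hex (m.+1%:Z - 1) (n.+1%:Z - 1) u = hex m n u.
Proof. by apply: hex_eq; lia. Qed.

(** The overlap of the two intervals is the interval of [gen 0 * theta m n]. Its join and meet with
    the translate by s are therefore the sets [Xset] and [MMl] of the smaller indices, ready to
    cancel. *)
Lemma B12_SS m n z : B1 m.+1 n.+1 z && B2 m.+1 n.+1 z = Dl m n z.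
Proof. by rewrite /B1 /B2 hex_B12 !hexSS vtypeSS /Dl /theta_set vert_genM. Qed.

Lemma E12_SS m n z : E1 m.+1 n.+1 z && E2 m.+1 n.+1 z = Dr m n z.
Proof. by rewrite /E1 /E2 hex_E12 !hexSS vtypeSS /Dr theta_setMs. Qed.

Lemma Bjoin_SS m n : Bjoin m.+1 n.+1 =1 Xset m n.
Proof. by move=> z; rewrite /Bjoin !B12_SS vtypeSS. Qed.
Lemma Bmeet_SS m n : Bmeet m.+1 n.+1 =1 MMl m n.
Proof. by move=> z; rewrite /Bmeet !B12_SS vtypeSS. Qed.
Lemma Ejoin_SS m n : Ejoin m.+1 n.+1 =1 Xset m n.
Proof. by move=> z; rewrite /Ejoin !E12_SS Xset_r. Qed.
Lemma Emeet_SS m n : Emeet m.+1 n.+1 =1 MMr m n.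
Proof. by move=> z; rewrite /Emeet !E12_SS. Qed.

Lemma BE_empty m n : (m == 0%N) || (n == 0%N) -> [/\ Bjoin m n =1 xpred0,
  Bmeet m n =1 xpred0, Ejoin m n =1 xpred0 & Emeet m n =1 xpred0].
Proof.
by case/orP=> /eqP->; split=> z; rewrite /Bjoin /Bmeet /Ejoin /Emeet
  ?B2_0 ?B1_0 ?E1_0 ?E2_0 ?andbF ?B2_0 ?E2_0 ?andbF.
Qed.

Lemma B1_lower m n : lower_closed (B1 m n).
Proof.
case: n => [|n] x y xy; first by rewrite !B1_0.
by rewrite !B1_S; exact: tset_lower_closed xy.
Qed.

Lemma B2_lower m n : lower_closed (B2 m n).
Proof.
case: m => [|m] x y xy; first by rewrite !B2_0.
by rewrite !B2_S; exact: tset_lower_closed xy.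
Qed.

Lemma theta_set_lower_closed m n : lower_closed (theta_set m n).
Proof. exact: (@tset_lower_closed 0). Qed.

Lemma E1_lower m n : lower_closed (E1 m n).
Proof.
case: n => [|n] x y xy; first by rewrite !E1_0.
by rewrite !E1_S; exact: theta_set_lower_closed xy.
Qed.

Lemma E2_lower m n : lower_closed (E2 m n).
Proof.
case: m => [|m] x y xy; first by rewrite !E2_0.
by rewrite !E2_S; exact: theta_set_lower_closed xy.
Qed.

Lemma lthSn m n : lth m n.+1 = (lth m n).+2.
Proof. by rewrite /lth; lia. Qed.

Lemma lthSm m n : lth m.+1 n = (lth m n).+2.
Proof. by rewrite /lth; lia. Qed.

(** * The two expansions of C_0 T(m,n) C_s *)

Section Expand.
Context (A : comUnitRingType) (v : A) (vU : v \is a GRing.unit).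
Local Notation fn := (W -> A).
Local Notation fbr := (fbr v).

(** Inclusion-exclusion for a union of two sets and its translate. The hypotheses exclude the two
    patterns where the union meets its translate but neither set meets its own. *)
Lemma cross_expand (b1 b2 c1 c2 : bool) (x : A) :
  (b1 -> c2 -> b2 || c1) -> (c1 -> b2 -> c2 || b1) ->
  ((b1 || b2) || (c1 || c2))%:R * x + v^-1 ^+ 2 * (((b1 || b2) && (c1 || c2))%:R * x) =
  (b1 || c1)%:R * x + v^-1 * (v^-1 * ((b1 && c1)%:R * x))
  + ((b2 || c2)%:R * x + v^-1 * (v^-1 * ((b2 && c2)%:R * x)))
  + (- (((b1 && b2) || (c1 && c2))%:R * x)
     - v^-1 ^+ 2 * (((b1 && b2) && (c1 && c2))%:R * x)).
Proof.
move=> H1 H2; case: b1 b2 c1 c2 H1 H2 => -[] [] [] /= H1 H2;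
  try (by have := H1 isT isT); try (by have := H2 isT isT); ring.
Qed.

Lemma core_l m n w : let s := vtype m n in
  Rc v s (Lc v 0 (fbr (theta_set m n))) w =
    v ^+ 2 * fbr (Xset m n) w + fbr (MMl m n) w
    + v^-1 * (Rc v s (fbr (B1 m n)) w + Rc v s (fbr (B2 m n)) w)
    - fbr (Bjoin m n) w
    - v^-1 ^+ 2 * fbr (Bmeet m n) w.
Proof.
move=> s; rewrite Rc_Lc_fbr //; last exact: theta_set_lower_closed.
rewrite (Rc_fbr vU _ _ (@B1_lower m n)) (Rc_fbr vU _ _ (@B2_lower m n)).
rewrite -!addrA; congr (_ + (_ + _)); rewrite /fbr !S_I0.
rewrite !mulrDr !(mulrA v^-1 v) mulVr // !mul1r.
rewrite cross_expand ?addrA //; [exact: B12_cross | exact: B21_cross].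
Qed.

Lemma core_r m n w : let s := vtype m n in
  Lc v 0 (Rc v s (fbr (theta_set m n))) w =
    v ^+ 2 * fbr (Xset m n) w + fbr (MMr m n) w
    + v^-1 * (Lc v 0 (fbr (E1 m n)) w + Lc v 0 (fbr (E2 m n)) w)
    - fbr (Ejoin m n) w
    - v^-1 ^+ 2 * fbr (Emeet m n) w.
Proof.
move=> s; rewrite Lc_Rc_fbr //; last exact: theta_set_lower_closed.
rewrite (Lc_fbr vU _ _ (@E1_lower m n)) (Lc_fbr vU _ _ (@E2_lower m n)).
rewrite -!addrA (eq_fbr v (Xset_r m n)); congr (_ + (_ + _)); rewrite /fbr !S_Is.
rewrite !mulrDr !(mulrA v^-1 v) mulVr // !mul1r.
rewrite cross_expand ?addrA //; [exact: E12_cross | exact: E21_cross].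
Qed.

Lemma Rc0 i w : Rc v i (fun=> 0) w = 0.
Proof. by rewrite /Rc mulr0 addr0. Qed.

Lemma Lc0 i w : Lc v i (fun=> 0) w = 0.
Proof. by rewrite /Lc mulr0 addr0. Qed.

Lemma fbr_empty (S : pred W) : S =1 xpred0 -> fbr S =1 fun=> 0.
Proof. by move=> S0 w; apply: fbr0; exact: S0. Qed.

Lemma vVX2K j x : v ^+ j.+2 * (v^-1 * x) = v * (v ^+ j * x).
Proof. by rewrite mulrA exprS exprSr -!mulrA (mulrA v v^-1) divrr // mul1r. Qed.

Definition ifS (n : nat) (f : nat -> A) : A := if n is n'.+1 then f n' else 0.

Arguments tf : simpl never.

Lemma tfE k m n w : tf v k m n w = v ^+ lth m n * fbr (tset k m n) w
  + v ^+ 2 * ifS m (fun m' => ifS n (fun n' => tf v k m' n' w)).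
Proof. by case: m n => [|m] [|n] //; rewrite /= mulr0. Qed.

Lemma Rc_tfE i k m n w : Rc v i (tf v k m n) w = v ^+ lth m n * Rc v i (fbr (tset k m n)) w
  + v ^+ 2 * ifS m (fun m' => ifS n (fun n' => Rc v i (tf v k m' n') w)).
Proof.
rewrite (eq_Rc v i (tfE k m n)) RcD !RcZ.
by case: m n => [|m] [|n] //=; rewrite Rc0.
Qed.

Lemma Lc_tfE i k m n w : Lc v i (tf v k m n) w = v ^+ lth m n * Lc v i (fbr (tset k m n)) w
  + v ^+ 2 * ifS m (fun m' => ifS n (fun n' => Lc v i (tf v k m' n') w)).
Proof.
rewrite (eq_Lc v i (tfE k m n)) LcD !LcZ.
by case: m n => [|m] [|n] //=; rewrite Lc0.
Qed.

Lemma Rc_fbr_empty i (S : pred W) w : S =1 xpred0 -> Rc v i (fbr S) w = 0.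
Proof. by move=> S0; rewrite (eq_Rc v i (fbr_empty S0)) Rc0. Qed.

Lemma Lc_fbr_empty i (S : pred W) w : S =1 xpred0 -> Lc v i (fbr S) w = 0.
Proof. by move=> S0; rewrite (eq_Lc v i (fbr_empty S0)) Lc0. Qed.

(** In the inductive step the leading two terms of the smaller expansion, times v^2, cancel the
    overlap terms of [core_l]; its other two terms complete the sums over the outer hexagons to
    [T(m,n-1)] and [T(m-1,n)]. *)
Lemma tf_expand_l m n w : let s := vtype m n in
  Rc v s (Lc v 0 (tf v 0 m n)) w =
    v ^+ (lth m n).+2 * fbr (Xset m n) w + v ^+ lth m n * fbr (MMl m n) w
    + v * ifS n (fun n' => Rc v s (tf v 1 m n') w)
    + v * ifS m (fun m' => Rc v s (tf v 2 m' n) w).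
Proof.
elim: m n => [|m IH] n s.
  have [eU eI _ _] := BE_empty (isT : (0 == 0)%N || (n == 0%N)).
  rewrite (eq_Rc v s (Lc_tfE 0 0 0 n)) RcD !RcZ /= Rc0 mulr0 !addr0 core_l -/s.
  rewrite (Rc_fbr_empty _ _ (B2_0 n)) (fbr_empty eU) (fbr_empty eI).
  rewrite !mulr0 !subr0 addr0; case: n @s {eU eI} => [|n] s.
    by rewrite (Rc_fbr_empty _ _ (B1_0 0)) !mulr0 !addr0 mulrDr mulrA -exprD.
  rewrite (eq_Rc v s (eq_fbr v (B1_S 0 n))) /ifS Rc_tfE mulr0 addr0 lthSn.
  move: (Rc v s (fbr (tset 1 0 n)) w) (lth 0 n) => R l.
  by rewrite !mulrDr vVX2K !exprS; ring.
case: n @s => [|n] s.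
  have [eU eI _ _] := BE_empty (orbT _ : (m.+1 == 0)%N || (0 == 0)%N).
  rewrite (eq_Rc v s (Lc_tfE 0 0 m.+1 0)) RcD !RcZ /= Rc0 mulr0 !addr0 core_l -/s.
  rewrite (Rc_fbr_empty _ _ (B1_0 m.+1)) (fbr_empty eU) (fbr_empty eI).
  rewrite !mulr0 !subr0 add0r addr0 (eq_Rc v s (eq_fbr v (B2_S m 0))).
  rewrite Rc_tfE lthSm (_ : ifS m _ = 0); last by case: (m).
  move: (Rc v s (fbr (tset 2 m 0)) w) (lth m 0) => R l.
  by rewrite !mulrDr vVX2K !exprS; ring.
rewrite (eq_Rc v s (Lc_tfE 0 0 m.+1 n.+1)) RcD !RcZ /= core_l /= -/s.
have -> : Rc v s (Lc v 0 (tf v 0 m n)) w =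
    v ^+ (lth m n).+2 * fbr (Xset m n) w + v ^+ lth m n * fbr (MMl m n) w
    + v * ifS n (fun n' => Rc v s (tf v 1 m n') w)
    + v * ifS m (fun m' => Rc v s (tf v 2 m' n) w).
  by have := IH n; rewrite /= -(vtypeSS m n).
rewrite (eq_fbr v (Bjoin_SS m n)) (eq_fbr v (Bmeet_SS m n)).
rewrite (eq_Rc v s (eq_fbr v (B1_S m.+1 n))) (eq_Rc v s (eq_fbr v (B2_S m n.+1))).
rewrite !Rc_tfE /= lthSn !lthSm lthSn.
set a := ifS m _; set b := ifS n _.
move: (Rc v s (fbr (tset 1 m.+1 n)) w) (Rc v s (fbr (tset 2 m n.+1)) w) => R1 R2.
move: (lth m n) a b => l a b.
rewrite !mulrBr !mulrDr !vVX2K vX2K // !exprS; ring.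
Qed.

Lemma tf_expand_r m n w : let s := vtype m n in
  Lc v 0 (Rc v s (tf v 0 m n)) w =
    v ^+ (lth m n).+2 * fbr (Xset m n) w + v ^+ lth m n * fbr (MMr m n) w
    + v * ifS n (fun n' => Lc v 0 (tf v 0 m n') w)
    + v * ifS m (fun m' => Lc v 0 (tf v 0 m' n) w).
Proof.
elim: m n => [|m IH] n s.
  have [_ _ eU eI] := BE_empty (isT : (0 == 0)%N || (n == 0%N)).
  rewrite (eq_Lc v 0 (Rc_tfE s 0 0 n)) LcD !LcZ /= Lc0 mulr0 !addr0 core_r -/s.
  rewrite (Lc_fbr_empty _ _ (E2_0 n)) (fbr_empty eU) (fbr_empty eI).
  rewrite !mulr0 !subr0 addr0; case: n @s {eU eI} => [|n] s.
    by rewrite (Lc_fbr_empty _ _ (E1_0 0)) !mulr0 !addr0 mulrDr mulrA -exprD.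
  rewrite (eq_Lc v 0 (eq_fbr v (E1_S 0 n))) /ifS Lc_tfE mulr0 addr0 lthSn.
  rewrite -[tset 0 0 n]/(theta_set 0 n).
  move: (Lc v 0 (fbr (theta_set 0 n)) w) (lth 0 n) => R l.
  by rewrite !mulrDr vVX2K !exprS; ring.
case: n @s => [|n] s.
  have [_ _ eU eI] := BE_empty (orbT _ : (m.+1 == 0)%N || (0 == 0)%N).
  rewrite (eq_Lc v 0 (Rc_tfE s 0 m.+1 0)) LcD !LcZ /= Lc0 mulr0 !addr0 core_r -/s.
  rewrite (Lc_fbr_empty _ _ (E1_0 m.+1)) (fbr_empty eU) (fbr_empty eI).
  rewrite !mulr0 !subr0 add0r addr0 (eq_Lc v 0 (eq_fbr v (E2_S m 0))).
  rewrite Lc_tfE lthSm (_ : ifS m _ = 0); last by case: (m).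
  rewrite -[tset 0 m 0]/(theta_set m 0).
  move: (Lc v 0 (fbr (theta_set m 0)) w) (lth m 0) => R l.
  by rewrite !mulrDr vVX2K !exprS; ring.
rewrite (eq_Lc v 0 (Rc_tfE s 0 m.+1 n.+1)) LcD !LcZ /= core_r /= -/s.
have -> : Lc v 0 (Rc v s (tf v 0 m n)) w =
    v ^+ (lth m n).+2 * fbr (Xset m n) w + v ^+ lth m n * fbr (MMr m n) w
    + v * ifS n (fun n' => Lc v 0 (tf v 0 m n') w)
    + v * ifS m (fun m' => Lc v 0 (tf v 0 m' n) w).
  by have := IH n; rewrite /= -(vtypeSS m n).
rewrite (eq_fbr v (Ejoin_SS m n)) (eq_fbr v (Emeet_SS m n)).
rewrite (eq_Lc v 0 (eq_fbr v (E1_S m.+1 n))) (eq_Lc v 0 (eq_fbr v (E2_S m n.+1))).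
rewrite !Lc_tfE /= lthSn !lthSm lthSn.
rewrite -[tset 0 m.+1 n]/(theta_set m.+1 n) -[tset 0 m n.+1]/(theta_set m n.+1).
set a := ifS m _; set b := ifS n _.
move: (Lc v 0 (fbr (theta_set m.+1 n)) w) (Lc v 0 (fbr (theta_set m n.+1)) w) => R1 R2.
move: (lth m n) a b => l a b.
rewrite !mulrBr !mulrDr !vVX2K vX2K // !exprS; ring.
Qed.

End Expand.

Lemma odd_word_neq1 u : odd (size u) -> (of_word u == 1%g) = false.
Proof. by move=> ou; apply/eqP => u1; move: ou; rewrite -odd_len u1 len1. Qed.

(** * Bar invariance of [T(m,n)] *)

Section Dihedral.
Context (A : comUnitRingType) (v : A) (vU : v \is a GRing.unit).
Variables (a b : 'Z_3).
Hypothesis ab : a != b.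

Definition dS0 : pred W := fun z => z == 1%g.
Definition dS1 : pred W := fun z => dS0 z || dS0 (z * gen a)%g.
Definition dS2 : pred W := fun z => dS1 z || dS1 (z * gen b)%g.
Definition dS3 : pred W := fun z => dS2 z || dS2 (z * gen a)%g.

Let odd1 u := odd_word_neq1 (u := u).

Lemma gen2_neq1 i j : i != j -> (gen i * gen j == 1 :> W)%g = false.
Proof.
move=> ij; apply/eqP => /(canRL (mulgK _)); rewrite mul1g genV => /gen_inj.
exact/eqP.
Qed.

Lemma gen3_neq1 i j : (gen i * gen j * gen i == 1 :> W)%g = false.
Proof. by have := odd1 (u := [:: i; j; i]) isT; rewrite !of_word_cons mulg1 mulgA. Qed.

Lemma gen4_neq1 i j : i != j -> (gen i * gen j * gen i * gen j == 1 :> W)%g = false.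
Proof.
move=> ij; apply/eqP => /(canRL (mulgK _)); rewrite mul1g genV => /eqP.
by rewrite conj_gen_neq.
Qed.

Lemma dK1 z : dS0 z && dS0 (z * gen a)%g = false.
Proof.
rewrite /dS0; case: eqVneq => // ->; rewrite mul1g.
by have := odd1 (u := [:: a]) isT; rewrite of_word_cons mulg1.
Qed.

Lemma dK2 z : dS1 z && dS1 (z * gen b)%g = false.
Proof.
have ba : b != a by rewrite eq_sym.
have gb : (gen b == 1%g) = false.
  by have := odd1 (u := [:: b]) isT; rewrite of_word_cons mulg1.
apply/negbTE/negP; rewrite /dS1 /dS0 => /andP[/orP[/eqP->|/eqP za]].
  by rewrite mul1g gb gen2_neq1.
have -> : z = gen a by rewrite -(mulgenK a z) za mul1g.
by rewrite gen2_neq1 // gen3_neq1.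
Qed.

Lemma dK3 z : dS2 z && dS2 (z * gen a)%g = dS1 z.
Proof.
have ba : b != a by rewrite eq_sym.
have d1a x : dS1 (x * gen a)%g = dS1 x by rewrite /dS1 mulgenK orbC.
rewrite /dS2 d1a; case z1: (dS1 z) => //=; apply/negbTE/negP => /andP[/orP z2].
case: z2 => /eqP E.
  have -> : z = gen b by rewrite -(mulgenK b z) E mul1g.
  by rewrite /dS1 /dS0 gen3_neq1 gen4_neq1.
have -> : z = (gen a * gen b)%g by rewrite -(mulgenK b z) -(mulgenK a (z * gen b)%g) E mul1g.
rewrite /dS1 /dS0 gen4_neq1 //=.
by have := odd1 (u := [:: a; b; a; b; a]) isT; rewrite !of_word_cons mulg1 !mulgA => ->.
Qed.

Lemma lower_dihedral : lower_set dS3 (gen a * gen b * gen a)%g /\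
  len (gen a * gen b * gen a)%g = 3.
Proof.
have r1 : ~~ rinv 1%g (gen a) by rewrite /rinv invg1 linv1.
have r2 : ~~ rinv (1 * gen a)%g (gen b) by rewrite mul1g rinv_gen (inj_eq gen_inj) eq_sym.
have r3 : ~~ rinv (1 * gen a * gen b)%g (gen a).
  by rewrite mul1g rinvM rinv_gen (inj_eq gen_inj) (negPf ab) /= rinv_gen genV conj_gen_neq // eq_sym.
rewrite -[(gen a * gen b)%g]mul1g mulgA; split; last by rewrite !len_mulgenS // len1.
have b1 z : bruhat z 1%g <-> dS0 z.
  by rewrite /dS0; split=> [/bruhat1 zE|/eqP ->]; [exact/eqP | exact: bruhat_refl].
by move=> z; rewrite !bruhat_mulgenE // !b1 /dS3 /dS2 /dS1 -!(rwP orP); tauto.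
Qed.

(** Of the three intersections that arise only the last is nonempty, and it is the interval of
    [gen a]. Hence C_a C_b C_a - C_a is the element [N] of the longest element. *)
Lemma Rc_dihedral w : Rc v a (Rc v b (Rc v a (fbr v dS0))) w =
  v ^+ 3 * fbr v dS3 w + Rc v a (fbr v dS0) w.
Proof.
have l0 : lower_closed dS0.
  by move=> x y xy /eqP yE; rewrite yE in xy; apply/eqP; exact: bruhat1.
have l1 : lower_closed dS1 by exact: lower_closedUr.
have l2 : lower_closed dS2 by exact: lower_closedUr.
have R1 x : Rc v a (fbr v dS0) x = v * fbr v dS1 x.
  by rewrite Rc_fbr // (fbr_empty v dK1) mulr0 addr0.
have R2 x : Rc v b (Rc v a (fbr v dS0)) x = v ^+ 2 * fbr v dS2 x.
  by rewrite (eq_Rc v b R1) RcZ Rc_fbr // (fbr_empty v dK2) mulr0 addr0 mulrA expr2.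
rewrite R1 (eq_Rc v a R2) RcZ Rc_fbr // (eq_fbr v dK3) mulrDr mulrA -exprSr expr2 -mulrA.
by rewrite vVK.
Qed.
End Dihedral.

Local Notation Cv i := (Cgen v i).

Lemma bar_Cgen i : bar (Cv i) = Cv i.
Proof.
rewrite /Cgen rmorphD /= bar_Hgen barZ lbar_v bar1 /Hinv -addrA -scalerDl.
by rewrite subrK.
Qed.

Lemma coef1_fbr : coef (1 : hecke v) =1 fbr v dS0.
Proof.
move=> w; rewrite coef1 /delta /fbr /dS0; case: eqVneq => [->|_]; last by rewrite mul0r.
by rewrite len1 expr0 mulr1.
Qed.

Lemma rhoXM k x y : rhoX k (x * y)%g = (rhoX k x * rhoX k y)%g.
Proof. by elim: k => //= k IH; rewrite /rhoX /= -/(rhoX k _) IH rhoM. Qed.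

Lemma rhoX_gen k i : rhoX k (gen i) = gen (i + k%:R).
Proof.
elim: k => [|k IH]; first by rewrite addr0.
by rewrite /rhoX /= -/(rhoX k _) IH rho_gen -addrA -mulrSr.
Qed.

Lemma bar_Tsum00 k : bar (Tsum v k 0 0) = Tsum v k 0 0.
Proof.
set a : 'Z_3 := 1 + k%:R; set b : 'Z_3 := 1 + 1 + k%:R.
have ab : a != b by rewrite /a /b (inj_eq (addIr _)).
have [L3 l3] := lower_dihedral ab.
suff -> : Tsum v k 0 0 = Cv a * Cv b * Cv a - Cv a.
  by rewrite rmorphB !rmorphM /= !bar_Cgen.
have cC w : coef (Cv a) w = Rc v a (fbr v dS0) w.
  by rewrite -[Cv a]mul1r coef_mulCgen (eq_Rc v a coef1_fbr).
apply: coef_inj => w; rewrite coefB cC.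
have -> : coef (Cv a * Cv b * Cv a) w = Rc v a (Rc v b (Rc v a (fbr v dS0))) w.
  rewrite coef_mulCgen; apply: eq_Rc => {}w; rewrite coef_mulCgen; apply: eq_Rc => {}w.
  exact: cC.
rewrite (Rc_dihedral v_unit ab) addrK coef_Tsum ?v_unit // tfE /= mulr0 addr0.
have -> : lth 0 0 = 3%N by [].
congr (_ * _); apply: fbr_eq; apply/idP/idP => [/(tset_lower k 0 0 w)|/L3].
  rewrite theta00 !rhoXM !rhoX_gen mulgA; move/L3; exact.
rewrite -mulgA => H; apply/(tset_lower k 0 0 w).
by rewrite theta00 !rhoXM !rhoX_gen.
Qed.

Arguments Tsum : simpl never.

Lemma Tsum_step_q k m n : Tsum v k m.+1 n =
  Tsum v k m n * Cv (vtype m n + k%:R) * Cv (vtype m n + 1 + k%:R) - Tsum v k m n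
  - (if m is m'.+1 then Tsum v k m' n.+1 else 0) - (if n is n'.+1 then Tsum v k m n' else 0).
Proof.
apply: coef_inj => w; have := tf_step_q v_unit k m n w.
rewrite /Qop !coefB coef_mulCgen (eq_Rc v _ (coef_mulCgen _ _)).
rewrite (eq_Rc v _ (eq_Rc v _ (coef_Tsum v_unit k m n))) !coef_Tsum ?v_unit // => ->.
have -> : coef (if m is m'.+1 then Tsum v k m' n.+1 else 0) w =
          if m is m'.+1 then tf v k m' n.+1 w else 0.
  by case: (m) => [|m']; rewrite ?coef0 ?coef_Tsum ?v_unit.
have -> : coef (if n is n'.+1 then Tsum v k m n' else 0) w =
          if n is n'.+1 then tf v k m n' w else 0.
  by case: (n) => [|n']; rewrite ?coef0 ?coef_Tsum ?v_unit.
by rewrite [X in X - _]addrAC addrK addrK.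
Qed.

Lemma Tsum_step_p k n : Tsum v k 0 n.+1 =
  Tsum v k 0 n * Cv (vtype 0 n + k%:R) * Cv (vtype 0 n + 1 + 1 + k%:R) - Tsum v k 0 n
  - (if n is n'.+1 then Tsum v k 1 n' else 0).
Proof.
apply: coef_inj => w; have := tf_step_p v_unit k n w.
rewrite /Qop !coefB coef_mulCgen (eq_Rc v _ (coef_mulCgen _ _)).
rewrite (eq_Rc v _ (eq_Rc v _ (coef_Tsum v_unit k 0 n))) !coef_Tsum ?v_unit // => ->.
have -> : coef (if n is n'.+1 then Tsum v k 1 n' else 0) w =
          if n is n'.+1 then tf v k 1 n' w else 0.
  by case: (n) => [|n']; rewrite ?coef0 ?coef_Tsum ?v_unit.
by rewrite addrK.
Qed.

(** The recursion for [T(m+1,n)] involves [T(m-1,n+1)] and that for [T(0,n+1)] involves [T(1,n-1)],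
    so it is the sum of the indices that decreases. *)
Lemma bar_Tsum k m n : bar (Tsum v k m n) = Tsum v k m n.
Proof.
have [N] := ubnP (m + n)%N; elim: N m n => // N IH [|m] [|n] mnN.
- exact: bar_Tsum00.
- rewrite Tsum_step_p !rmorphB !rmorphM /= !bar_Cgen (IH 0%N n); last by lia.
  by case: n mnN => [|n] mnN; rewrite ?rmorph0 ?IH //; lia.
- rewrite Tsum_step_q !rmorphB !rmorphM /= !bar_Cgen (IH m 0%N); last by lia.
  by case: m mnN => [|m] mnN; rewrite ?rmorph0 ?IH //; lia.
- rewrite Tsum_step_q !rmorphB !rmorphM /= !bar_Cgen (IH m n.+1); last by lia.
  rewrite (IH m n); last by lia.
  by case: m mnN => [|m] mnN; rewrite ?rmorph0 ?IH //; lia.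
Qed.

(** * Lower sets of the elements in the theorem *)

Lemma len_lower (S : pred W) x z : lower_set S x -> S z -> (len z <= len x)%N.
Proof. by move=> Sx /Sx/bruhat_len. Qed.

Lemma tset_len k m n z : tset k m n z -> (len z <= lth m n)%N.
Proof. by move=> /(len_lower (tset_lower k m n)); rewrite len_theta. Qed.

Lemma theta_set_len m n z : theta_set m n z -> (len z <= lth m n)%N.
Proof. exact: (@tset_len 0). Qed.

(** The gap of two outweighs the factor v^-1 on the intersection, leaving a positive power of v. *)
Lemma S_I0_len m n z : theta_set m n z -> theta_set m n (gen 0 * z)%g ->
  ((len z).+2 <= lth m n)%N.
Proof.
move=> S1 S2; have := S_I0 m n z; rewrite S1 S2 => /esym/orP[].
  by case: n {S1 S2} => [|n]; rewrite ?B1_0 // B1_S => /tset_len; rewrite lthSn.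
by case: m {S1 S2} => [|m]; rewrite ?B2_0 // B2_S => /tset_len; rewrite lthSm.
Qed.

Lemma S_Is_len m n z : theta_set m n z -> theta_set m n (z * gen (vtype m n))%g ->
  ((len z).+2 <= lth m n)%N.
Proof.
move=> S1 S2; have := S_Is m n z; rewrite S1 S2 => /esym/orP[].
  by case: n {S1 S2} => [|n]; rewrite ?E1_0 // E1_S => /theta_set_len; rewrite lthSn.
by case: m {S1 S2} => [|m]; rewrite ?E2_0 // E2_S => /theta_set_len; rewrite lthSm.
Qed.

Lemma theta_set_SS m n z : theta_set m n z -> theta_set m.+1 n.+1 z.
Proof.
rewrite /theta_set vtypeSS; case: (vert _ z) => [[a b] c]; rewrite /hex; lia.
Qed.

Definition DRs k m n : pred W :=
  fun z => tset k m n z || tset k m n (z * gen (vtype m n + k%:R))%g.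

Lemma theta_s_lower k m n :
  let y := (rhoX k (theta m n) * gen (vtype m n + k%:R))%g in
  lower_set (DRs k m n) y /\ len y = (lth m n).+1.
Proof.
move=> y; have [|r L] := lower_set_mulgen (i := vtype m n + k%:R) (tset_lower k m n).
  by rewrite /tset rhoX2_mulgen rhoXK; exact: theta_s_notin.
by split=> //; rewrite len_mulgenS // len_theta.
Qed.

Lemma theta_0_notin m n : ~~ theta_set m n (gen 0 * theta m n)%g.
Proof.
have [uE _ _] := theta_vert m n; rewrite /theta_set vert_genM uE /hex /=; lia.
Qed.

Lemma theta_0_lower m n :
  lower_set (Dl m n) (gen 0 * theta m n)%g /\ len (gen 0 * theta m n)%g = (lth m n).+1.
Proof.
have [r L] := lower_set_genM (tset_lower 0 m n) (theta_0_notin m n).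
by split=> //; rewrite len_genMS // (len_theta 0).
Qed.

Lemma theta_0s_lower m n : let y := (gen 0 * theta m n * gen (vtype m n))%g in
  lower_set (Xset m n) y /\ len y = (lth m n).+2.
Proof.
move=> y; have [L l] := theta_0_lower m n.
have [|r X] := lower_set_mulgen (i := vtype m n) L.
  have [uE pE qE] := theta_vert m n.
  rewrite /Dl -(mulgA (gen 0) (theta m n)) genK (negPf (theta_s_notin m n)) orbF /theta_set vert_genM vert_gen0.
  rewrite uE pE qE /flip /hex /=; lia.
by split=> //; rewrite len_mulgenS // l.
Qed.

Lemma MMl_SS m n z : MMl m.+1 n.+1 z = Dl m.+1 n z || Dl m n.+1 z.
Proof.
have := S_Is m.+1 n.+1 z; have := S_Is m.+1 n.+1 (gen 0 * z)%g.
have := @hex_A_cross m.+1 n.+1 z isT isT; have := @hex_A_cross' m.+1 n.+1 z isT isT.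
rewrite -vert_gen0 -!vert_genM -!/(theta_set _ _ _) !mulgA.
rewrite !E1_S !E2_S /MMl /Dl !mulgA.
do 4!case: (theta_set m.+1 n.+1 _) => /=; do 4!case: (theta_set _ _ _) => //=;
 by move=> H1 H2; first [have := H1 isT isT | have := H2 isT isT].
Qed.

Lemma DRs1E m n z : DRs 1 m n z = B1 m n.+1 z || B1 m n.+1 (z * gen (vtype m n.+1))%g.
Proof. by rewrite !B1_S /DRs vtypeSn. Qed.

Lemma DRs2E m n z : DRs 2 m n z = B2 m.+1 n z || B2 m.+1 n (z * gen (vtype m.+1 n))%g.
Proof. by rewrite !B2_S /DRs vtypeSm -addrA. Qed.

Lemma MMr_SS m n z : MMr m.+1 n.+1 z = DRs 1 m.+1 n z || DRs 2 m n.+1 z.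
Proof.
rewrite DRs1E DRs2E.
have := S_I0 m.+1 n.+1 z; have := S_I0 m.+1 n.+1 (z * gen (vtype m.+1 n.+1))%g.
have := @hex_A_cross m.+1 n.+1 z isT isT; have := @hex_A_cross' m.+1 n.+1 z isT isT.
rewrite -vert_gen0 -!vert_genM -!/(theta_set _ _ _) /MMr /Dr !mulgA.
do 4!case: (theta_set m.+1 n.+1 _) => /=; do 2!case: (B1 _ _ _); do 2!case: (B2 _ _ _) => //=;
 by move=> H1 H2; first [have := H1 isT isT | have := H2 isT isT].
Qed.

Lemma tset1_q (m : nat) z : hex m 0 (rot (rot (vert (vtype m.+1 0 + 1 + 1) z))) = tset 1 m 0 z.
Proof. by rewrite /tset /theta_set /= -!vert_rho !vtypeSm !Z3_neq. Qed.

Lemma tset2_p (n : nat) z : hex 0 n (rot (vert (vtype 0 n.+1 + 1) z)) = tset 2 0 n z.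
Proof.
rewrite /tset /theta_set /= -[X in vert _ (rho X)]/(rho (rho (rho z))) rho3.
by rewrite -!vert_rho !vtypeSn Z3_neq.
Qed.

Lemma MMl_S0 m z : MMl m.+1 0 z = Dl m 0 z || tset 1 m 0 z.
Proof.
have := @hex_MMl_n0 m.+1 0 z erefl isT.
rewrite -!vert_gen0 -!vert_genM -!/(theta_set _ _ _) /MMl /Dl => ->.
by rewrite -!E2_S -orbA /E2 -tset1_q !(@hex_eq (m.+1%:Z - 1) 0 m 0) //; lia.
Qed.

Lemma MMr_S0 m z : MMr m.+1 0 z = DRs 2 m 0 z || tset 1 m 0 z.
Proof.
have := @hex_MMr_n0 m.+1 0 z erefl isT.
rewrite -!vert_gen0 -!vert_genM -!/(theta_set _ _ _) /MMr /Dr !mulgA => ->.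
rewrite DRs2E -orbA /B2 -tset1_q vert_gen0.
by rewrite !(@hex_eq (m.+1%:Z - 1) 0 m 0) //; lia.
Qed.

Lemma MMl_0S n z : MMl 0 n.+1 z = Dl 0 n z || tset 2 0 n z.
Proof.
have := @hex_MMl_m0 0 n.+1 z erefl isT.
rewrite -!vert_gen0 -!vert_genM -!/(theta_set _ _ _) /MMl /Dl => ->.
by rewrite -!E1_S -orbA /E1 -tset2_p !(@hex_eq 0 (n.+1%:Z - 1) 0 n) //; lia.
Qed.

Lemma MMr_0S n z : MMr 0 n.+1 z = DRs 1 0 n z || tset 2 0 n z.
Proof.
have := @hex_MMr_m0 0 n.+1 z erefl isT.
rewrite -!vert_gen0 -!vert_genM -!/(theta_set _ _ _) /MMr /Dr !mulgA => ->.
rewrite DRs1E -orbA /B1 -tset2_p vert_gen0.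
by rewrite !(@hex_eq 0 (n.+1%:Z - 1) 0 n) //; lia.
Qed.

Lemma origin_pair z : theta_set 0 0 z -> theta_set 0 0 (gen 0 * z * gen 0)%g -> z = 1%g.
Proof.
rewrite -mulgA /theta_set => /hex00 z0; have pz := stabilizer_origin z0.
rewrite vert_genM vert_gen0 => /hex00; move: z0.
case: pz => // _; rewrite /gen -?of_wordM !vert_word => //.
Qed.

(** With no smaller hexagon available, only the mixed intersections survive. The resulting factor
    v^3 is v^2 times the factor v in [N v (gen 0)]. *)
Lemma MMl_00 z : MMl 0 0 z -> z = 1%g \/ z = gen 0.
Proof.
have E0 x : theta_set 0 0 x && theta_set 0 0 (x * gen 0)%g = false.
  by rewrite (S_Is 0 0) E1_0 E2_0.
rewrite /MMl /Dl => /andP[/orP[z1|z1] /orP[z2|z2]].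
- by have := E0 z; rewrite z1 z2.
- by left; apply: origin_pair z1 _; rewrite -mulgA.
- right; rewrite -[z](genK 0) (_ : (gen 0 * z)%g = 1%g) ?mulg1 //.
  by apply: origin_pair z1 _; rewrite genK.
- by have := E0 (gen 0 * z)%g; rewrite z1 -mulgA z2.
Qed.

Lemma Dl_len m n z : Dl m n z -> (len z <= (lth m n).+1)%N.
Proof. by have [L l] := theta_0_lower m n; move/(len_lower L); rewrite l. Qed.

Lemma MMl_len m n z : MMl m n z -> (len z < lth m n)%N.
Proof.
case: m n => [|m] [|n].
- case/MMl_00 => ->; first by rewrite len1.
  exact: leq_ltn_trans (len_gen _) _.
- by rewrite MMl_0S lthSn => /orP[/Dl_len//|/tset_len]; rewrite ltnS => /leqW.
- by rewrite MMl_S0 lthSm => /orP[/Dl_len//|/tset_len]; rewrite ltnS => /leqW.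
- rewrite MMl_SS => /orP[/Dl_len|/Dl_len]; first by rewrite lthSn.
  by rewrite lthSm.
Qed.

Lemma MMl_Xset m n z : MMl m n z -> Xset m n z.
Proof. by rewrite /MMl /Xset => /andP[-> _]. Qed.

(** * Degree bounds for the products with C_0 and C_s *)

Section KLform.
Context (A : comUnitRingType) (v : A) (vU : v \is a GRing.unit).
Local Notation fn := (W -> A).
Local Notation fbr := (fbr v).
(* [vp] stands for v Z[v]. *)
Variable vp : A -> Prop.
Hypotheses (vp0 : vp 0) (vpD : forall a b, vp a -> vp b -> vp (a + b))
  (vpM : forall a, vp a -> vp (v * a)) (vpv : vp v).

Lemma vpX j : (0 < j)%N -> vp (v ^+ j).
Proof.
case: j => // j _; elim: j => [|j IH]; first by rewrite expr1.
by rewrite exprS; exact: vpM.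
Qed.

Definition KLform (y : W) (f : fn) :=
  [/\ f y = 1, forall x, x <> y -> vp (f x) & forall x, f x != 0 -> bruhat x y].

Lemma eq_KLform y f g : f =1 g -> KLform y f -> KLform y g.
Proof. by move=> fg [fy fx fb]; split=> [|x|x]; rewrite -fg; [|exact: fx|exact: fb]. Qed.

(* The terms of the Kazhdan-Lusztig element of [y] other than [H y]. *)
Definition small (y : W) (f : fn) :=
  forall x, vp (f x) /\ (f x != 0 -> bruhat x y /\ x <> y).

Lemma smallD y f g : small y f -> small y g -> small y (fun x => f x + g x).
Proof.
move=> sf sg x; have [vf bf] := sf x; have [vg bg] := sg x; split; first exact: vpD.
by case: (eqVneq (f x) 0) => [->|/bf//]; rewrite add0r.
Qed.

Lemma smallM y f : small y f -> small y (fun x => v * f x).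
Proof.
move=> sf x; have [vf bf] := sf x; split; first exact: vpM.
by move=> vf0; apply: bf; apply: contra_neq vf0 => ->; rewrite mulr0.
Qed.

Lemma small0 y : small y (fun=> 0).
Proof. by move=> x; split; [exact: vp0 | rewrite eqxx]. Qed.

Lemma eq_small y f g : f =1 g -> small y f -> small y g.
Proof. by move=> fg sf x; rewrite -fg; exact: sf. Qed.

Lemma vX_fbr j (S : pred W) x : S x -> (len x <= j)%N -> v ^+ j * fbr S x = v ^+ (j - len x).
Proof.
move=> Sx lx; rewrite /fbr Sx mul1r -{1}(subnK lx) exprD -mulrA -exprMn divrr //.
by rewrite expr1n mulr1.
Qed.

Lemma small_fbr y (S : pred W) j :
  (forall x, S x -> [/\ (len x < j)%N, bruhat x y & x <> y]) ->
  small y (fun x => v ^+ j * fbr S x).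
Proof.
move=> HS x; case Sx: (S x); last first.
  by rewrite fbr0 // mulr0; exact: small0.
have [lx bx xy] := HS x Sx; split=> //.
by rewrite vX_fbr //; [apply: vpX; rewrite subn_gt0 | exact: ltnW].
Qed.

Lemma KLform_intro y (S : pred W) (R : fn) : lower_set S y -> small y R ->
  KLform y (fun x => v ^+ len y * fbr S x + R x).
Proof.
move=> Sy sR; have Syy : S y by apply/Sy/bruhat_refl.
split=> [|x xy|x].
- have [_ Ry] := sR y; rewrite vX_fbr // subnn expr0.
  have -> : R y = 0 by apply/eqP/negPn/negP => /Ry[].
  by rewrite addr0.
- have [vR _] := sR x; apply: vpD => //.
  case Sx: (S x); last by rewrite fbr0 // mulr0; exact: vp0.
  have lx : (len x < len y)%N by apply: bruhat_len_lt => //; apply/Sy.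
  by rewrite vX_fbr //; [apply: vpX; rewrite subn_gt0 | exact: ltnW].
- have [_ bR] := sR x; case Sx: (S x); first by move=> _; apply/Sy.
  by rewrite fbr0 // mulr0 add0r => /bR[].
Qed.

Lemma small_KL y y' f : KLform y' f -> bruhat y' y -> (len y' < len y)%N ->
  small y (fun x => v * f x).
Proof.
case=> Cy' Cx Cb y'y lt x; split.
  have [->|/eqP xy'] := eqVneq x y'; last by apply: vpM; exact: Cx.
  by rewrite Cy' mulr1.
move=> vC0; have Cx0 : f x != 0 by apply: contra_neq vC0 => ->; rewrite mulr0.
have xy' := Cb x Cx0; split; first exact: bruhat_trans y'y.
by move=> xy; move: (bruhat_len xy'); rewrite xy leqNgt lt.
Qed.

Lemma vVl j x : v ^+ j.+1 * (v^-1 * x) = v ^+ j * x.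
Proof. by rewrite exprSr -mulrA vVK. Qed.

Lemma lthE m n : lth m n = (2 * m + 2 * n + 2).+1.
Proof. by rewrite /lth addnS. Qed.

Lemma KLform_theta_s k m n :
  KLform (rhoX k (theta m n) * gen (vtype m n + k%:R))%g
    (Rc v (vtype m n + k%:R) (tf v k m n)).
Proof.
have [N] := ubnP m; elim: N m n => // N IH m n mN.
have [L l] := theta_s_lower k m n; set y := (_ * _)%g in L l *.
(* The exponent is [lth m n] minus one: the intersection carries a factor v^-1. *)
pose R x := v ^+ (2 * m + 2 * n + 2) *
    fbr (fun z => tset k m n z && tset k m n (z * gen (vtype m n + k%:R))%g) x
  + v ^+ 2 * ifS m (fun m' => ifS n (fun n' => Rc v (vtype m n + k%:R) (tf v k m' n') x)).
apply: (@eq_KLform y (fun x => v ^+ len y * fbr (DRs k m n) x + R x)).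
  move=> x; rewrite Rc_tfE (Rc_fbr vU) ?l; last exact: tset_lower_closed.
  rewrite /R addrA; congr (_ + _); rewrite mulrDr mulrA -exprSr; congr (_ + _).
  by rewrite lthE vVl.
apply: (KLform_intro L); apply: smallD.
  apply: small_fbr => x /andP[]; rewrite {1 2}/tset rhoX2_mulgen => S1 S2.
  have := S_Is_len S1 S2; rewrite len_rhoX => lx; split.
  - by move: lx; rewrite lthE ltnS.
  - by apply/L; rewrite /DRs {1}/tset S1.
  - by move=> xy; move: lx; rewrite xy l => /ltnW/ltnW; rewrite ltnn.
case: m n mN @y L l @R => [|m] [|n] mN y L l R /=;
  try by apply: eq_small (small0 y) => x; rewrite mulr0.
apply: (@eq_small y (fun x => v * (v * Rc v (vtype m n + k%:R) (tf v k m n) x))).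
  by move=> x; rewrite vtypeSS mulrA expr2.
have [L' l'] := theta_s_lower k m n.
apply: smallM; apply: small_KL (IH m n _) _ _ => //.
  apply/L; rewrite /DRs orbC /tset vtypeSS rhoX2_mulgen theta_set_SS //.
  rewrite rhoX2_mulgen mulgenK rhoXK; have [Lt _] := theta_lower m n.
  exact/Lt/bruhat_refl.
by rewrite l l' lthSm lthSn; lia.
Qed.

Lemma KLform_0_theta m n :
  KLform (gen 0 * theta m n)%g (Lc v 0 (tf v 0 m n)).
Proof.
have [N] := ubnP m; elim: N m n => // N IH m n mN.
have [L l] := theta_0_lower m n; set y := (_ * _)%g in L l *.
pose R x := v ^+ (2 * m + 2 * n + 2) *
    fbr (fun z => theta_set m n z && theta_set m n (gen 0 * z)%g) x
  + v ^+ 2 * ifS m (fun m' => ifS n (fun n' => Lc v 0 (tf v 0 m' n') x)).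
apply: (@eq_KLform y (fun x => v ^+ len y * fbr (Dl m n) x + R x)).
  move=> x; rewrite Lc_tfE (Lc_fbr vU) ?l; last exact: tset_lower_closed.
  rewrite /R addrA; congr (_ + _); rewrite mulrDr mulrA -exprSr; congr (_ + _).
  by rewrite lthE vVl.
apply: (KLform_intro L); apply: smallD.
  apply: small_fbr => x /andP[S1 S2].
  have lx := S_I0_len S1 S2; split.
  - by move: lx; rewrite lthE ltnS.
  - by apply/L; rewrite /Dl S1.
  - by move=> xy; move: lx; rewrite xy l => /ltnW/ltnW; rewrite ltnn.
case: m n mN @y L l @R => [|m] [|n] mN y L l R /=;
  try by apply: eq_small (small0 y) => x; rewrite mulr0.
apply: (@eq_small y (fun x => v * (v * Lc v 0 (tf v 0 m n) x))).
  by move=> x; rewrite mulrA expr2.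
have [L' l'] := theta_0_lower m n.
apply: smallM; apply: small_KL (IH m n _) _ _ => //.
  apply/L; rewrite /Dl genK orbC theta_set_SS //; have [Lt _] := theta_lower m n.
  exact/Lt/bruhat_refl.
by rewrite l l' lthSm lthSn; lia.
Qed.

Lemma KLform_0_theta_s m n :
  KLform (gen 0 * theta m n * gen (vtype m n))%g (Rc v (vtype m n) (Lc v 0 (tf v 0 m n))).
Proof.
have [L l] := theta_0s_lower m n; set y := (_ * _)%g in L l *.
have ylt x : (len x < lth m n)%N -> x <> y.
  by move=> lx xy; move: lx; rewrite xy l => /ltnW/ltnW; rewrite ltnn.
pose R x := v ^+ lth m n * fbr (MMl m n) x
    + v * ifS n (fun n' => Rc v (vtype m n) (tf v 1 m n') x)
    + v * ifS m (fun m' => Rc v (vtype m n) (tf v 2 m' n) x).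
apply: (@eq_KLform y (fun x => v ^+ len y * fbr (Xset m n) x + R x)).
  by move=> x; rewrite (tf_expand_l vU) l /R !addrA.
apply: (KLform_intro L); apply: smallD; first apply: smallD.
- apply: small_fbr => x Mx; have lx := MMl_len Mx.
  by split=> //; [apply/L/MMl_Xset | exact: ylt].
- case: n @y L l ylt @R => [|n] y L l ylt R /=.
    by apply: eq_small (small0 y) => x; rewrite mulr0.
  have [L' l'] := theta_s_lower 1 m n.
  rewrite vtypeSn; apply: small_KL (KLform_theta_s 1 m n) _ _.
    apply/L; rewrite /Xset orbC vtypeSn mulgenK /Dl.
    have : B1 m n.+1 (rhoX 1 (theta m n)) || B2 m n.+1 (rhoX 1 (theta m n)).
      by rewrite B1_S; apply/orP; left; apply/(tset_lower 1 m n)/bruhat_refl.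
    by rewrite -S_I0 => /andP[-> _].
  by rewrite l l' lthSn; lia.
- case: m @y L l ylt @R => [|m] y L l ylt R /=.
    by apply: eq_small (small0 y) => x; rewrite mulr0.
  have [L' l'] := theta_s_lower 2 m n.
  rewrite vtypeSm -addrA; apply: small_KL (KLform_theta_s 2 m n) _ _.
    apply/L; rewrite /Xset orbC vtypeSm -addrA mulgenK /Dl.
    have : B1 m.+1 n (rhoX 2 (theta m n)) || B2 m.+1 n (rhoX 2 (theta m n)).
      by rewrite B2_S; apply/orP; right; apply/(tset_lower 2 m n)/bruhat_refl.
    by rewrite -S_I0 => /andP[-> _].
  by rewrite l l' lthSm; lia.
Qed.
End KLform.

(** * The formulas for the products, and their Kazhdan-Lusztig property *)

Section Identities.
Context (A : comUnitRingType) (v : A) (vU : v \is a GRing.unit).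
Local Notation fbr := (fbr v).

Definition Ts k m n : hecke v := Tsum v k m n * Cgen v (vtype m n + k%:R).
Definition T0 m n : hecke v := Cgen v 0 * Tsum v 0 m n.
Definition T0s m n : hecke v := Cgen v 0 * Tsum v 0 m n * Cgen v (vtype m n).

Lemma coef_Ts k m n : coef (Ts k m n) =1 Rc v (vtype m n + k%:R) (tf v k m n).
Proof. by move=> w; rewrite coef_mulCgen; apply: eq_Rc; exact: coef_Tsum vU _ _ _. Qed.

Lemma coef_T0 m n : coef (T0 m n) =1 Lc v 0 (tf v 0 m n).
Proof. by move=> w; rewrite coef_CgenM; apply: eq_Lc; exact: coef_Tsum vU _ _ _. Qed.

Lemma coef_T0s_l m n : coef (T0s m n) =1 Rc v (vtype m n) (Lc v 0 (tf v 0 m n)).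
Proof. by move=> w; rewrite coef_mulCgen; apply: eq_Rc; exact: coef_T0. Qed.

Lemma coef_T0s_r m n : coef (T0s m n) =1 Lc v 0 (Rc v (vtype m n) (tf v 0 m n)).
Proof.
move=> w; rewrite /T0s -mulrA coef_CgenM; apply: eq_Lc => {}w.
by have := coef_Ts 0 m n w; rewrite /Ts addr0.
Qed.

(** The factor v^(lth m n) splits as v times v^(len x). Only the length of [x] enters, which matters
    when an index is 0: there [y] is one shorter. *)
Lemma T0s_expand_l m n (S S' : pred W) x y : lower_set S x -> lower_set S' y ->
  (len x).+1 = lth m n -> MMl m n =1 (fun z => S z || S' z) ->
  T0s m n = N v (gen 0 * theta m n * gen (vtype m n))%g + v *: M v x y
    + v *: (if n is n'.+1 then Ts 1 m n' else 0)
    + v *: (if m is m'.+1 then Ts 2 m' n else 0).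
Proof.
move=> Sx Sy lx ME; apply: coef_inj => w.
have [X lX] := theta_0s_lower m n.
rewrite coef_T0s_l (tf_expand_l vU) !coefD (coef_N vU _ X) lX !coefZ (coef_M vU _ Sx Sy).
rewrite -lx -(eq_fbr v ME); congr (_ + _ + _ * _ + _ * _).
  by rewrite exprS -mulrA.
  by case: n {X lX lx ME} => [|n]; [exact/esym/coef0 | rewrite vtypeSn coef_Ts].
by case: m {X lX lx ME} => [|m]; [exact/esym/coef0 | rewrite vtypeSm -addrA coef_Ts].
Qed.

Lemma T0s_expand_r m n (S S' : pred W) x y : lower_set S x -> lower_set S' y ->
  (len x).+1 = lth m n -> MMr m n =1 (fun z => S z || S' z) ->
  T0s m n = N v (gen 0 * theta m n * gen (vtype m n))%g + v *: M v x y
    + v *: (if n is n'.+1 then T0 m n' else 0)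
    + v *: (if m is m'.+1 then T0 m' n else 0).
Proof.
move=> Sx Sy lx ME; apply: coef_inj => w.
have [X lX] := theta_0s_lower m n.
rewrite coef_T0s_r (tf_expand_r vU) !coefD (coef_N vU _ X) lX !coefZ (coef_M vU _ Sx Sy).
rewrite -lx -(eq_fbr v ME); congr (_ + _ + _ * _ + _ * _).
  by rewrite exprS -mulrA.
  by case: n {X lX lx ME} => [|n]; [exact/esym/coef0 | rewrite coef_T0].
by case: m {X lX lx ME} => [|m]; [exact/esym/coef0 | rewrite coef_T0].
Qed.

Lemma lower_gen0 : lower_set (fun z => (z == 1%g) || (z == gen 0)) (gen 0).
Proof.
have r1 : ~~ rinv 1%g (gen 0) by rewrite /rinv invg1 linv1.
move=> z; rewrite -{1}[gen 0]mul1g bruhat_mulgenE //.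
have b1 x : bruhat x 1%g <-> x = 1%g by split=> [/bruhat1|->]; last exact: bruhat_refl.
rewrite !b1; split=> [[->|/(canRL (mulgK _))]|/orP[/eqP->|/eqP->]].
- by rewrite eqxx.
- by rewrite mul1g genV => ->; rewrite eqxx orbT.
- by left.
- by right; rewrite gen_sq.
Qed.

Lemma MMl_00E : MMl 0 0 =1 (fun z => (z == 1%g) || (z == gen 0)).
Proof.
have S1 : theta_set 0 0 1%g by rewrite /theta_set vert_one.
have D1 : Dl 0 0 1%g by rewrite /Dl S1.
have Dg : Dl 0 0 (gen 0) by rewrite /Dl gen_sq S1 orbT.
move=> z; apply/idP/idP => [/MMl_00[->|->]|/orP[/eqP->|/eqP->]]; rewrite ?eqxx ?orbT //.
  by rewrite /MMl D1 mul1g.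
by rewrite /MMl Dg gen_sq.
Qed.

Lemma T0s_00 :
  T0s 0 0 = N v (gen 0 * theta 0 0 * gen (vtype 0 0))%g + v ^+ 2 *: N v (gen 0).
Proof.
apply: coef_inj => w; have [X lX] := theta_0s_lower 0 0.
rewrite coef_T0s_l (tf_expand_l vU) coefD (coef_N vU _ X) lX coefZ (coef_N vU _ lower_gen0).
have -> : len (gen 0) = 1%N.
  by rewrite -[gen 0]mul1g len_mulgenS ?len1 // /rinv invg1 linv1.
by rewrite /= !mulr0 !addr0 (eq_fbr v MMl_00E) [v ^+ 2 * (_ * _)]mulrA -exprD.
Qed.

End Identities.

Lemma vpolyD a b : vpoly a -> vpoly b -> vpoly (a + b).
Proof. by case=> p ->; case=> q ->; exists (p + q); rewrite levD mulrDr. Qed.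

Lemma vpolyM a : vpoly a -> vpoly (v * a).
Proof. by case=> p ->; exists ('X * p); rewrite levM levX. Qed.

Lemma vpolyv : vpoly v.
Proof. by exists 1; rewrite lev1 mulr1. Qed.

Lemma KL_KLform y (C : hecke v) f : bar C = C -> coef C =1 f -> KLform vpoly y f -> KL v y = C.
Proof.
move=> bC Cf [fy fx fb]; apply: KL_unique; apply/is_KL_coefP; split.
- exact: bC.
- by rewrite Cf fy.
- by move=> x xy; rewrite Cf; exact: fx.
- by move=> x; rewrite Cf; exact: fb.
Qed.

Lemma KL_theta_s k m n :
  KL v (rhoX k (theta m n) * gen (vtype m n + k%:R))%g = Ts v k m n.
Proof.
apply: KL_KLform (coef_Ts v_unit k m n) (KLform_theta_s v_unit vpoly0 vpolyD vpolyM vpolyv k m n).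
by rewrite /Ts barM bar_Tsum bar_Cgen.
Qed.

Lemma KL_0_theta m n : KL v (gen 0 * theta m n)%g = T0 v m n.
Proof.
apply: KL_KLform (coef_T0 v_unit m n) (KLform_0_theta v_unit vpoly0 vpolyD vpolyM vpolyv m n).
by rewrite /T0 barM bar_Tsum bar_Cgen.
Qed.

Lemma KL_0_theta_s m n : KL v (gen 0 * theta m n * gen (vtype m n))%g = T0s v m n.
Proof.
apply: KL_KLform (coef_T0s_l v_unit m n) (KLform_0_theta_s v_unit vpoly0 vpolyD vpolyM vpolyv m n).
by rewrite /T0s !barM bar_Tsum !bar_Cgen.
Qed.

Theorem proposition3p3 (m n : nat) :
  let s := s_mn m n in
  [/\ (m = 0%N -> n = 0%N ->
        KL v (s_ 0 * theta 0 0 * s)%g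
        = N v (s_ 0 * theta 0 0 * s)%g + v ^+ 2 *: N v (s_ 0)),

      ((0 < m)%N -> n = 0%N ->
        KL v (s_ 0 * theta m 0 * s)%g
        = N v (s_ 0 * theta m 0 * s)%g
          + v *: M v (s_ 0 * theta m.-1 0)%g (rho (theta m.-1 0))
          + v *: KL v (rho (rho (theta m.-1 0)) * s)%g
        /\
        KL v (s_ 0 * theta m 0 * s)%g
        = N v (s_ 0 * theta m 0 * s)%g
          + v *: M v (rho (rho (theta m.-1 0)) * s)%g (rho (theta m.-1 0))
          + v *: KL v (s_ 0 * theta m.-1 0)%g),

      (m = 0%N -> (0 < n)%N ->
        KL v (s_ 0 * theta 0 n * s)%g
        = N v (s_ 0 * theta 0 n * s)%g
          + v *: M v (s_ 0 * theta 0 n.-1)%g (rho (rho (theta 0 n.-1)))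
          + v *: KL v (rho (theta 0 n.-1) * s)%g
        /\
        KL v (s_ 0 * theta 0 n * s)%g
        = N v (s_ 0 * theta 0 n * s)%g
          + v *: M v (rho (theta 0 n.-1) * s)%g (rho (rho (theta 0 n.-1)))
          + v *: KL v (s_ 0 * theta 0 n.-1)%g)

    & ((0 < m)%N -> (0 < n)%N ->
        KL v (s_ 0 * theta m n * s)%g
        = N v (s_ 0 * theta m n * s)%g
          + v *: M v (s_ 0 * theta m n.-1)%g (s_ 0 * theta m.-1 n)%g
          + v *: KL v (rho (theta m n.-1) * s)%g
          + v *: KL v (rho (rho (theta m.-1 n)) * s)%g
        /\
        KL v (s_ 0 * theta m n * s)%g
        = N v (s_ 0 * theta m n * s)%g
          + v *: M v (rho (theta m n.-1) * s)%g (rho (rho (theta m.-1 n)) * s)%g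
          + v *: KL v (s_ 0 * theta m n.-1)%g
          + v *: KL v (s_ 0 * theta m.-1 n)%g)].
Proof.
have s0 : s_ 0 = gen 0 by [].
have rho1 x : rho x = rhoX 1 x by [].
(* Raising n by one applies [rho] to the ascent, so this element is the image under [rho] of
   theta(m',n') times its own ascent. *)
have KLs1 m' n' : KL v (rho (theta m' n') * gen (vtype m' n'.+1))%g = Ts v 1 m' n'.
  by rewrite vtypeSn rho1 -KL_theta_s.
have rho2 x : rho (rho x) = rhoX 2 x by [].
have KLs2 m' n' : KL v (rho (rho (theta m' n')) * gen (vtype m'.+1 n'))%g = Ts v 2 m' n'.
  by rewrite vtypeSm -addrA rho2 -KL_theta_s.
have L0 m' n' := theta_0_lower m' n'.
have L1 m' n' : lower_set (DRs 1 m' n') (rho (theta m' n') * gen (vtype m' n'.+1))%g /\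
    len (rho (theta m' n') * gen (vtype m' n'.+1))%g = (lth m' n').+1.
  by rewrite vtypeSn rho1; exact: theta_s_lower.
have L2 m' n' : lower_set (DRs 2 m' n') (rho (rho (theta m' n')) * gen (vtype m'.+1 n'))%g /\
    len (rho (rho (theta m' n')) * gen (vtype m'.+1 n'))%g = (lth m' n').+1.
  by rewrite vtypeSm -addrA rho2; exact: theta_s_lower.
rewrite /= s_mnE s0; split.
- by move=> -> ->; rewrite KL_0_theta_s; exact: T0s_00 v_unit.
- case: m => // m _ ->; rewrite /= KLs2 KL_0_theta KL_0_theta_s; split.
  + rewrite (T0s_expand_l v_unit (proj1 (L0 m 0%N)) (tset_lower 1 m 0)); last 2 first.
    - by rewrite (proj2 (L0 m 0%N)) lthSm.
    - exact: MMl_S0.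
    by rewrite scaler0 addr0.
  + rewrite (T0s_expand_r v_unit (proj1 (L2 m 0%N)) (tset_lower 1 m 0)); last 2 first.
    - by rewrite (proj2 (L2 m 0%N)) lthSm.
    - exact: MMr_S0.
    by rewrite scaler0 addr0.
- move=> ->; case: n => // n _; rewrite /= KLs1 KL_0_theta KL_0_theta_s; split.
  + rewrite (T0s_expand_l v_unit (proj1 (L0 0%N n)) (tset_lower 2 0 n)); last 2 first.
    - by rewrite (proj2 (L0 0%N n)) lthSn.
    - exact: MMl_0S.
    by rewrite scaler0 addr0.
  + rewrite (T0s_expand_r v_unit (proj1 (L1 0%N n)) (tset_lower 2 0 n)); last 2 first.
    - by rewrite (proj2 (L1 0%N n)) lthSn.
    - exact: MMr_0S.
    by rewrite scaler0 addr0.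
- case: m n => // m [//|n] _ _; rewrite /= KLs1 KLs2 !KL_0_theta KL_0_theta_s; split.
  + rewrite (T0s_expand_l v_unit (proj1 (L0 m.+1 n)) (proj1 (L0 m n.+1))) //.
    - by rewrite (proj2 (L0 m.+1 n)) lthSn.
    - exact: MMl_SS.
  + rewrite (T0s_expand_r v_unit (proj1 (L1 m.+1 n)) (proj1 (L2 m n.+1))) //.
    - by rewrite (proj2 (L1 m.+1 n)) lthSn.
    - exact: MMr_SS.
Qed.
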